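(* Let $X$ be a compact complex manifold and $E\to X$ a holomorphic vector bundle. If $\mathcal{E}\to\mathcal{X}$ and $\mathcal{E}'\to\mathcal{X}'$ are isomorphic deformations of $(X,E)$, represented by families $(A_t,\varphi_t)$ and $(A'_t,\varphi'_t)$ respectively, then their first order terms $(A_1,\varphi_1)$ and $(A'_1,\varphi'_1)$ differ by a $\bar\partial_{A(E)}$-exact form, i.e. $(A'_1,\varphi'_1)-(A_1,\varphi_1)=\bar\partial_{A(E)}\eta$ for some $\eta\in\Omega^0(A(E))$.
   Context: Notation: $T_X$ is the holomorphic tangent bundle, $\Omega^{0,q}(V)$ denotes smooth $V$-valued $(0,q)$-forms. Fix a hermitian metric on $E$ with Chern connection $\nabla$ and curvature $F_\nabla$; $Q=\mathrm{End}(E)$. Contraction: for $\varphi=\varphi_J^i\,d\bar z^J\otimes\frac{\partial}{\partial z^i}$, $\varphi\lrcorner\alpha:=\varphi_J^i\,d\bar z^J\wedge(\frac{\partial}{\partial z^i}\lrcorner\alpha)$. The Atiyah extension $A(E)$ is the smooth bundle $Q\oplus T_X$ with Dolbeault operator $\bar\partial_{A(E)}(A,\varphi)=(\bar\partial_QA-(-1)^{q}\varphi\lrcorner F_\nabla,\ \bar\partial_{T_X}\varphi)$ on $\Omega^{0,q}(A(E))$. A family of deformations of $(X,E)$ over a small ball $\Delta\subset\mathbb{C}^d$ centred at $0$ is a proper submersive holomorphic map $\pi:\mathcal{X}\to\Delta$ with a holomorphic vector bundle $\mathcal{E}\to\mathcal{X}$ such that $\pi^{-1}(0)=X$, $\mathcal{E}|_X=E$.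 Two families over $\Delta$ are isomorphic if there are a biholomorphism $F:\mathcal{X}\to\mathcal{X}'$ (compatible with the projections to $\Delta$) and a holomorphic bundle isomorphism $\Phi:\mathcal{E}\to\mathcal{E}'$ covering $F$ with $F|_X=\mathrm{id}_X$, $\Phi|_E=\mathrm{id}_E$. After a smooth trivialization $\Delta\times E\to\Delta\times X$ (identity over $t=0$) with fibres $(X_t,E_t)$, a family is represented by $(A_t,\varphi_t)\in\Omega^{0,1}(A(E))$, $(A_0,\varphi_0)=0$: $\varphi_t\in\Omega^{0,1}(T_X)$ represents the complex structure of $X_t$ (its $(0,1)$-tangent bundle is spanned by $\partial_{\bar z^i}+(\varphi_t)_i^j\partial_{z^j}$), and $A_t=\bar D_t-\bar\partial_E-\varphi_t\lrcorner\nabla$, where $\bar D_t(s^ke_k)=(\bar\partial+\varphi_t\lrcorner\partial)s^k\otimes e_k$ for a local holomorphic frame $\{e_k\}$ of $E_t$. The first order term is the linear term of the Taylor expansion at $t=0$ along a one-real-parameter direction: $(A_1,\varphi_1)=\frac{d}{ds}|_{s=0}(A_{su},\varphi_{su})$, $s\in\mathbb{R}$, for a fixed $u\in\mathbb{C}^d$ (the same $u$ for both families). *)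

(* Defs.v *)
From HB Require Import structures.
From mathcomp Require Import all_boot all_order all_algebra.
From mathcomp Require Import complex.
From mathcomp Require Import all_classical all_reals all_analysis.

Set Implicit Arguments.
Unset Strict Implicit.
Unset Printing Implicit Defensive.
Import Order.TTheory GRing.Theory Num.Theory numFieldNormedType.Exports.
Local Open Scope classical_set_scope.
Local Open Scope ring_scope.

(* Conventions.
   - All manifolds and bundles are described by atlases: a chart is given by
     its domain, its coordinate map and the inverse of that map (total
     functions, meaningful on the domain resp. its image); a vector bundle is a
     family of complex vector spaces with a set of local trivializations.
   - Tangent vectors are row vectors of components, elements of a fibre of a
     vector bundle are column vectors of components in a local frame.
   - Tensors, forms and connections on a manifold are families of local
     components, one for each chart and each local frame, subject to the usual
     transformation laws on overlaps. *)

(* R[i] retyped so that the topology of a numFieldType is found on it. *)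
Definition Cplx (R : realType) : numClosedFieldType := R[i].

Section Calculus.
Variable R : realType.
Local Notation C := (Cplx R).

Definition rtoc (s : R) : C := (s%:C)%C.

Definition rderivable (g : R -> C) (s : R) : Prop :=
  derivable (fun y => complex.Re (g y)) s 1 /\
  derivable (fun y => complex.Im (g y)) s 1.

Definition rderive (g : R -> C) (s : R) : C :=
  (derive1 (fun y => complex.Re (g y)) s
   +i* derive1 (fun y => complex.Im (g y)) s)%C.

Section Domain.
Variable n : nat.
Implicit Types (U : set 'rV[C]_n) (f : 'rV[C]_n -> C) (v x : 'rV[C]_n).

Definition along f v x : R -> C := fun s => f (x + rtoc s *: v).

(* Derivative along the real direction v of C^n = R^(2n). *)
Definition dirderive f v x : C := rderive (along f v x) 0.

(* U is meant to be open. *)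
Fixpoint Ck (k : nat) U f : Prop :=
  match k with
  | 0 => forall x, U x -> {for x, continuous f}
  | k'.+1 => (forall x, U x -> {for x, continuous f}) /\
      forall v, (forall x, U x -> rderivable (along f v x) 0) /\
                Ck k' U (dirderive f v)
  end.

Definition smooth U f : Prop := forall k, Ck k U f.

Definition dz (i : 'I_n) f x : C :=
  (dirderive f (delta_mx 0 i) x
   - 'i * dirderive f ('i *: delta_mx 0 i) x) / 2.

Definition dzbar (i : 'I_n) f x : C :=
  (dirderive f (delta_mx 0 i) x
   + 'i * dirderive f ('i *: delta_mx 0 i) x) / 2.

Definition holomorphic U f : Prop :=
  smooth U f /\ forall i x, U x -> dzbar i f x = 0.

(* a euclidean ball: the norm of 'rV is the sup norm *)
Definition eball (rho : R) : set 'rV[C]_n :=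
  [set t | \sum_i (complex.Re (t 0 i) ^+ 2 + complex.Im (t 0 i) ^+ 2)
           < rho ^+ 2].

End Domain.

(* [@smooth R] and [@holomorphic R] are the two instances used below. *)
Definition regularity := forall n, set 'rV[C]_n -> ('rV[C]_n -> C) -> Prop.

End Calculus.

Section Manifolds.
Variable R : realType.
Local Notation C := (Cplx R).

Record chart (X : Type) (n : nat) := Chart {
  cdom : set X;
  cmap : X -> 'rV[C]_n;
  cinv : 'rV[C]_n -> X }.

Definition is_chart (X : topologicalType) n (a : chart X n) : Prop :=
  [/\ open (cdom a),
      open (cmap a @` cdom a),
      forall x, cdom a x -> cinv a (cmap a x) = x,
      forall x, cdom a x -> {for x, continuous (cmap a)} &
      forall z, (cmap a @` cdom a) z -> {for z, continuous (cinv a)}].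

Record atlased (n : nat) := Atlased {
  carrier :> topologicalType;
  atlas : set (chart carrier n) }.
Arguments atlas {n} _.

Definition complex_manifold n (X : atlased n) : Prop :=
  [/\ hausdorff_space X, @second_countable X,
      forall a, atlas X a -> is_chart a,
      forall x : X, exists2 a, atlas X a & cdom a x &
      forall a b, atlas X a -> atlas X b -> forall j,
        holomorphic (cmap a @` (cdom a `&` cdom b))
          (fun z => cmap b (cinv a z) 0 j)].

Definition Cspace (d : nat) : atlased d :=
  @Atlased d 'rV[C]_d [set Chart setT id id].

Definition prod_chart (X Y : Type) m n (a : chart X m) (b : chart Y n) :
    chart (X * Y) (m + n) :=
  Chart (cdom a `*` cdom b)
        (fun p => row_mx (cmap a p.1) (cmap b p.2))
        (fun z => (cinv a (lsubmx z), cinv b (rsubmx z))).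

Definition prod_atlased m n (X : atlased m) (Y : atlased n) :
    atlased (m + n) :=
  @Atlased (m + n) (X * Y)%type
    [set c | exists a b, [/\ atlas X a, atlas Y b & c = prod_chart a b]].

(* Class P on a set O that is meant to be open; in regular_map, continuity on O
   makes the sets on which P is required open as well. *)
Definition regular_fun (P : regularity R) n (X : atlased n) (O : set X)
    (f : X -> C) : Prop :=
  forall a, atlas X a ->
    P n (cmap a @` (cdom a `&` O)) (fun z => f (cinv a z)).

Definition regular_map (P : regularity R) m n (X : atlased m) (Y : atlased n)
    (O : set X) (F : X -> Y) : Prop :=
  (forall x, O x -> {for x, continuous F}) /\
  forall a b, atlas X a -> atlas Y b -> forall j,
    P m (cmap a @` (cdom a `&` O `&` F @^-1` cdom b))
        (fun z => cmap b (F (cinv a z)) 0 j).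

Section Partials.
Variables (n : nat) (X : atlased n) (a : chart X n).

Definition pd (i : 'I_n) (f : X -> C) (x : X) : C :=
  dz i (fun z => f (cinv a z)) (cmap a x).

Definition pdbar (i : 'I_n) (f : X -> C) (x : X) : C :=
  dzbar i (fun z => f (cinv a z)) (cmap a x).

Definition mpd p q (i : 'I_n) (M : X -> 'M[C]_(p, q)) (x : X) : 'M[C]_(p, q) :=
  \matrix_(k, l) pd i (fun y => M y k l) x.

Definition mpdbar p q (i : 'I_n) (M : X -> 'M[C]_(p, q)) (x : X) :
    'M[C]_(p, q) :=
  \matrix_(k, l) pdbar i (fun y => M y k l) x.

(* row i contains the derivatives with respect to the coordinate i *)
Definition jac m (g : X -> 'rV[C]_m) (x : X) : 'M[C]_(n, m) :=
  \matrix_(i, j) pd i (fun y => g y 0 j) x.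

(* The complexified tangent vector v^j d/dz^j + w^i d/dzbar^i applied to f. *)
Definition tangent_act (v w : 'rV[C]_n) (f : X -> C) (x : X) : C :=
  \sum_j v 0 j * pd j f x + \sum_i w 0 i * pdbar i f x.

End Partials.

Definition immersion m n (X : atlased m) (Y : atlased n) (F : X -> Y) : Prop :=
  forall a b x, atlas X a -> atlas Y b -> cdom a x -> cdom b (F x) ->
    \rank (jac a (fun y => cmap b (F y)) x) = m.

Definition submersion m n (X : atlased m) (Y : atlased n) (F : X -> Y) : Prop :=
  forall a b x, atlas X a -> atlas Y b -> cdom a x -> cdom b (F x) ->
    \rank (jac a (fun y => cmap b (F y)) x) = n.

Definition holomorphic_embedding m n (X : atlased m) (Y : atlased n)
    (F : X -> Y) : Prop :=
  [/\ regular_map (@holomorphic R) setT F, immersion F, injective F &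
      forall U : set X, open U -> exists2 V : set Y, open V & U = F @^-1` V].

End Manifolds.
Arguments atlas {R n} _.

Section Bundles.
Variable R : realType.
Local Notation C := (Cplx R).

Record triv (X : Type) (E : X -> lmodType C) (r : nat) := Triv {
  tdom : set X;
  tmap : forall x, E x -> 'cV[C]_r;
  tinv : forall x, 'cV[C]_r -> E x }.
Arguments tmap {X E r} _ _ _.

Record vbundle (X : Type) (r : nat) := Vbundle {
  fibre :> X -> lmodType C;
  trivs : set (triv fibre r) }.
Arguments trivs {X r} _.

Definition total (X : Type) r (E : vbundle X r) : Type := {x : X & E x}.

Definition total_point (X : Type) r (E : vbundle X r) (x : X) (v : E x) :
    total E :=
  existT (fun y => E y : Type) x v.

(* Matrix of L in the local frames given by e at x and by f at y. *)
Definition coordmx (X Y : Type) r (E : vbundle X r) (E' : vbundle Y r)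
    (e : triv E r) (f : triv E' r) (x : X) (y : Y) (L : E x -> E' y) :
    'M[C]_r :=
  \matrix_(i, j) tmap f y (L (tinv e x (delta_mx j 0))) i 0.

Definition transition (X : Type) r (E : vbundle X r) (e f : triv E r) (x : X) :
    'M[C]_r :=
  coordmx e f (fun v : E x => v).

Definition holomorphic_vbundle n r (X : atlased R n) (E : vbundle X r) : Prop :=
  [/\ forall e, trivs E e -> open (tdom e),
      forall e x, trivs E e -> tdom e x ->
        [/\ linear (tmap e x), cancel (tmap e x) (tinv e x) &
            cancel (tinv e x) (tmap e x)],
      forall x, exists2 e, trivs E e & tdom e x &
      forall e f, trivs E e -> trivs E f -> forall i j,
        regular_fun (@holomorphic R) (tdom e `&` tdom f)
          (fun x => transition e f x i j)].

(* The inverse is of class P as well, by Cramer's rule. *)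
Definition bundle_iso (P : regularity R) m n r (X : atlased R m)
    (Y : atlased R n) (E : vbundle X r) (E' : vbundle Y r) (O : set X)
    (F : X -> Y) (Phi : forall x, E x -> E' (F x)) : Prop :=
  (forall x, O x -> linear (Phi x) /\ bijective (Phi x)) /\
  forall e f, trivs E e -> trivs E' f -> forall i j,
    regular_fun P (O `&` tdom e `&` F @^-1` tdom f)
      (fun x => coordmx e f (Phi x) i j).

(* T * E -> T * X *)
Definition pull_snd (T X : Type) r (E : vbundle X r) : vbundle (T * X) r :=
  @Vbundle (T * X) r (fun p => E p.2)
    [set e' | exists2 e, trivs E e &
       e' = Triv (snd @^-1` tdom e) (fun p => tmap e p.2)
                 (fun p => tinv e p.2)].

Definition hermitian_metric n r (X : atlased R n) (E : vbundle X r)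
    (h : forall x, E x -> E x -> C) : Prop :=
  [/\ forall x w, scalar (fun v => h x v w),
      forall x v w, h x w v = (h x v w)^*,
      forall x v, v != 0 -> 0 < h x v v &
      forall e, trivs E e -> forall i j,
        regular_fun (@smooth R) (tdom e)
          (fun x => h x (tinv e x (delta_mx i 0)) (tinv e x (delta_mx j 0)))].

Definition gram n r (X : atlased R n) (E : vbundle X r)
    (h : forall x, E x -> E x -> C) (e : triv E r) (x : X) : 'M[C]_r :=
  \matrix_(i, j) h x (tinv e x (delta_mx i 0)) (tinv e x (delta_mx j 0)).

End Bundles.
Arguments tmap {R X E r} _ _ _.
Arguments trivs {R X r} _.

Section AtiyahForms.
Variable R : realType.
Local Notation C := (Cplx R).
Variables (n r : nat) (X : atlased R n) (E : vbundle R X r).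

Definition conjmx p q (M : 'M[C]_(p, q)) : 'M[C]_(p, q) := map_mx Num.conj M.

(* Connection matrices: on the components s of a section in the frame e,
   nabla_{d/dz^i} s = d_i s + conn10 a e i *m s and
   nabla_{d/dzbar^i} s = dbar_i s + conn01 a e i *m s. *)
Record connection := Connection {
  conn10 : chart R X n -> triv E r -> 'I_n -> X -> 'M[C]_r;
  conn01 : chart R X n -> triv E r -> 'I_n -> X -> 'M[C]_r }.

Definition is_connection (D : connection) : Prop :=
  (forall a e, atlas X a -> trivs E e -> forall i k l,
     regular_fun (@smooth R) (cdom a `&` tdom e)
       (fun x => conn10 D a e i x k l) /\
     regular_fun (@smooth R) (cdom a `&` tdom e)
       (fun x => conn01 D a e i x k l)) /\
  forall a b e f, atlas X a -> atlas X b -> trivs E e -> trivs E f ->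
  forall x, cdom a x -> cdom b x -> tdom e x -> tdom f x -> forall i,
    let J := jac a (cmap b) x in let g := transition e f in
    g x *m conn10 D a e i x =
      (\sum_k J i k *: conn10 D b f k x) *m g x + mpd a i g x /\
    g x *m conn01 D a e i x =
      (\sum_k conjmx J i k *: conn01 D b f k x) *m g x + mpdbar a i g x.

(* The (0,1)-part of D is the Dolbeault operator of E, and
   d h(e_k, e_l) = h(D e_k, e_l) + h(e_k, D e_l); since h is hermitian the
   (0,1)-part of the latter identity is the conjugate of its (1,0)-part. *)
Definition is_chern (h : forall x, E x -> E x -> C) (D : connection) : Prop :=
  is_connection D /\
  forall a e, atlas X a -> trivs E e ->
  forall x, cdom a x -> tdom e x -> forall i,
    conn01 D a e i x = 0 /\
    mpd a i (gram h e) x = (conn10 D a e i x)^T *m gram h e x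
                           + gram h e x *m conjmx (conn01 D a e i x).

(* F(d/dz^i, d/dzbar^j), i.e. the components of F = F_{i jbar} dz^i /\ dzbar^j
   (the curvature of a Chern connection is of type (1,1)). *)
Definition curvature (D : connection) (a : chart R X n) (e : triv E r)
    (i j : 'I_n) (x : X) : 'M[C]_r :=
  mpd a i (conn01 D a e j) x - mpdbar a j (conn10 D a e i) x
  + conn10 D a e i x *m conn01 D a e j x
  - conn01 D a e j x *m conn10 D a e i x.

(* Omega^0(A(E)), A(E) = End(E) + T_X *)
Record form0 := Form0 {
  f0Q : triv E r -> X -> 'M[C]_r;
  f0T : chart R X n -> X -> 'rV[C]_n }.

Definition is_form0 (eta : form0) : Prop :=
  [/\ forall e, trivs E e -> forall k l,
        regular_fun (@smooth R) (tdom e) (fun x => f0Q eta e x k l),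
      forall a, atlas X a -> forall j,
        regular_fun (@smooth R) (cdom a) (fun x => f0T eta a x 0 j),
      forall e f, trivs E e -> trivs E f -> forall x, tdom e x -> tdom f x ->
        f0Q eta f x *m transition e f x = transition e f x *m f0Q eta e x &
      forall a b, atlas X a -> atlas X b -> forall x, cdom a x -> cdom b x ->
        f0T eta b x = f0T eta a x *m jac a (cmap b) x].

(* Omega^{0,1}(A(E)): f1Q a e i is the coefficient of dzbar^i, and the entry
   (i, j) of f1T a is the coefficient of dzbar^i (x) d/dz^j. *)
Record form01 := Form01 {
  f1Q : chart R X n -> triv E r -> 'I_n -> X -> 'M[C]_r;
  f1T : chart R X n -> X -> 'M[C]_n }.

Definition is_form01 (w : form01) : Prop :=
  [/\ forall a e, atlas X a -> trivs E e -> forall i k l,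
        regular_fun (@smooth R) (cdom a `&` tdom e)
          (fun x => f1Q w a e i x k l),
      forall a, atlas X a -> forall i j,
        regular_fun (@smooth R) (cdom a) (fun x => f1T w a x i j),
      forall a b e f, atlas X a -> atlas X b -> trivs E e -> trivs E f ->
        forall x, cdom a x -> cdom b x -> tdom e x -> tdom f x -> forall i,
        transition e f x *m f1Q w a e i x =
        (\sum_k conjmx (jac a (cmap b) x) i k *: f1Q w b f k x)
          *m transition e f x &
      forall a b, atlas X a -> atlas X b -> forall x, cdom a x -> cdom b x ->
        conjmx (jac a (cmap b) x) *m f1T w b x =
        f1T w a x *m jac a (cmap b) x].

Definition form01_eq (w w' : form01) : Prop :=
  (forall a e, atlas X a -> trivs E e -> forall i x, cdom a x -> tdom e x ->
     f1Q w a e i x = f1Q w' a e i x) /\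
  (forall a, atlas X a -> forall x, cdom a x -> f1T w a x = f1T w' a x).

Definition form01_zero : form01 :=
  Form01 (fun _ _ _ _ => 0) (fun _ _ => 0).

Definition form01_sub (w w' : form01) : form01 :=
  Form01 (fun a e i x => f1Q w a e i x - f1Q w' a e i x)
         (fun a x => f1T w a x - f1T w' a x).

(* The Dolbeault operator of A(E) in degree q = 0, where (-1)^q = 1:
   (B, xi) |-> (dbar B - xi _| F, dbar xi). *)
Definition dbar_atiyah (D : connection) (eta : form0) : form01 :=
  Form01
    (fun a e i x => mpdbar a i (f0Q eta e) x
                    - \sum_j f0T eta a x 0 j *: curvature D a e j i x)
    (fun a x => \matrix_(i, j) pdbar a i (fun y => f0T eta a y 0 j) x).

End AtiyahForms.

Section Deformations.
Variable R : realType.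
Local Notation C := (Cplx R).
Variables (n r d : nat) (X : atlased R n) (E : vbundle R X r) (rho : R).

Local Notation Delta := (@eball R d rho).

(* A family over Delta, with the identifications of X with the central fibre
   and of E with the restriction of the total bundle to it. *)
Record deformation := Deformation {
  tot : atlased R (d + n);
  totE : vbundle R tot r;
  proj : tot -> Cspace R d;
  incl : X -> tot;
  inclE : forall x, E x -> totE (incl x) }.
Arguments proj _ _ : clear implicits.
Arguments inclE _ _ _ : clear implicits.

Definition is_deformation (D : deformation) : Prop :=
  [/\ complex_manifold (tot D), holomorphic_vbundle (totE D),
      [/\ regular_map (@holomorphic R) setT (proj D),
          forall y, Delta (proj D y),
          submersion (proj D) &
          forall K : set (Cspace R d), compact K -> K `<=` Delta ->
            compact (proj D @^-1` K)],
      holomorphic_embedding (incl D) /\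
      range (incl D) = proj D @^-1` [set 0] &
      bundle_iso (@holomorphic R) setT (inclE D)].

(* Phi|_E = id is expressed in the total space of totE D', as Phi (inclE x v)
   and inclE' x v lie in fibres over points that are only provably equal. *)
Definition isomorphic (D D' : deformation) : Prop :=
  exists (F : tot D -> tot D') (G : tot D' -> tot D)
         (Phi : forall y, totE D y -> totE D' (F y)),
  [/\ [/\ regular_map (@holomorphic R) setT F,
          regular_map (@holomorphic R) setT G, cancel F G & cancel G F],
      forall y, proj D' (F y) = proj D y,
      bundle_iso (@holomorphic R) setT Phi,
      forall x, F (incl D x) = incl D' x &
      forall x (v : E x),
        total_point (Phi (incl D x) (inclE D x v)) =
        total_point (inclE D' x v)].

(* Smooth trivialization Delta * E -> Delta * X; [tr_retr] is the second
   component of the inverse of [tr_map]. *)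
Record trivialization (D : deformation) := Trivialization {
  tr_map : prod_atlased (Cspace R d) X -> tot D;
  tr_retr : tot D -> X;
  tr_mapE : forall p, pull_snd (Cspace R d) E p -> totE D (tr_map p) }.
Arguments tr_mapE {D} _ _ _.

Definition is_trivialization (D : deformation) (T : trivialization D) : Prop :=
  [/\ regular_map (X := prod_atlased (Cspace R d) X)
        (@smooth R) (Delta `*` setT) (tr_map T) /\
      regular_map (@smooth R) setT (tr_retr T),
      forall t x, Delta t ->
        proj D (tr_map T (t, x)) = t /\ tr_retr T (tr_map T (t, x)) = x,
      forall y, tr_map T (proj D y, tr_retr T y) = y,
      bundle_iso (X := prod_atlased (Cspace R d) X)
        (@smooth R) (Delta `*` setT) (tr_mapE T) &
      (forall x, tr_map T (0, x) = incl D x) /\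
      forall x (v : E x),
        total_point (tr_mapE T (0, x) v) = total_point (inclE D x v)].

Section Representation.
Variables (D : deformation) (T : trivialization D).

(* The complexified tangent vector v^j d/dz^j + w^i d/dzbar^i at x is of type
   (0,1) for the complex structure of X_t: its image in the total space has
   no (1,0)-component. *)
Definition tangent01 (t : 'rV[C]_d) (a : chart R X n) (x : X)
    (v w : 'rV[C]_n) : Prop :=
  forall b, atlas (tot D) b -> cdom b (tr_map T (t, x)) -> forall k,
    tangent_act a v w (fun y => cmap b (tr_map T (t, y)) 0 k) x = 0.

(* The (0,1)-tangent bundle of X_t is spanned by the vectors
   d/dzbar^i + phi_i^j d/dz^j. *)
Definition represents_structure (t : 'rV[C]_d)
    (phi : chart R X n -> X -> 'M[C]_n) : Prop :=
  forall a x, atlas X a -> cdom a x -> forall v w,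
    tangent01 t a x v w <-> v = w *m phi a x.

(* fr is a holomorphic frame of E_t over O, written as a frame of the smooth
   bundle E. *)
Definition holomorphic_frame (t : 'rV[C]_d) (O : set X)
    (fr : 'I_r -> forall x, E x) : Prop :=
  (forall e x, trivs E e -> O x -> tdom e x ->
     \matrix_(i, k) tmap e x (fr k x) i 0 \in unitmx) /\
  forall f, trivs (totE D) f -> forall k l,
    let O' := [set x | O x /\ tdom f (tr_map T (t, x))] in
    let s := fun x =>
      tmap f (tr_map T (t, x)) (tr_mapE T (t, x) (fr k x)) l 0 in
    regular_fun (@smooth R) O' s /\
    forall a x v w, atlas X a -> cdom a x -> O' x -> tangent01 t a x v w ->
      tangent_act a v w s x = 0.

(* A = Dbar_t - dbar_E - phi _| nabla on all sections s = s^k e_k, where (e_k)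
   is a local holomorphic frame of E_t and
   Dbar_t (s^k e_k) = (dbar + phi _| d) s^k (x) e_k. *)
Definition represents_bundle (nabla : connection E) (t : 'rV[C]_d)
    (w : form01 E) : Prop :=
  forall (O : set X) fr, open O -> holomorphic_frame t O fr ->
  forall c : 'I_r -> X -> C,
  (forall k, regular_fun (@smooth R) O (c k)) ->
  forall a e x, atlas X a -> trivs E e -> O x -> cdom a x -> tdom e x ->
  forall i,
    let phi := f1T w a x in
    let s := fun y => tmap e y (\sum_k c k y *: fr k y) in
    f1Q w a e i x *m s x =
      \sum_k (pdbar a i (c k) x + \sum_j phi i j * pd a j (c k) x)
               *: tmap e x (fr k x)
      - mpdbar a i s x
      - \sum_j phi i j *: (mpd a j s x + conn10 nabla a e j x *m s x).

End Representation.

(* A smooth family t |-> w t in Omega^{0,1}(A(E)) vanishing at t = 0. *)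
Definition is_family (w : 'rV[C]_d -> form01 E) : Prop :=
  [/\ forall t, Delta t -> is_form01 (w t),
      forall a e, atlas X a -> trivs E e -> forall i k l,
        regular_fun (X := prod_atlased (Cspace R d) X) (@smooth R)
          (Delta `*` (cdom a `&` tdom e))
          (fun p => f1Q (w p.1) a e i p.2 k l),
      forall a, atlas X a -> forall i j,
        regular_fun (X := prod_atlased (Cspace R d) X) (@smooth R)
          (Delta `*` cdom a) (fun p => f1T (w p.1) a p.2 i j) &
      form01_eq (w 0) (form01_zero E)].

Definition represented_by (nabla : connection E) (D : deformation)
    (w : 'rV[C]_d -> form01 E) : Prop :=
  is_family w /\
  exists2 T : trivialization D, is_trivialization T &
    forall t, Delta t ->
      represents_structure T t (f1T (w t)) /\ represents_bundle T nabla t (w t).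

End Deformations.

(* d/ds at s = 0 of w (s u), s real *)
Definition first_order (R : realType) n r d (X : atlased R n)
    (E : vbundle R X r) (u : 'rV[Cplx R]_d) (w : 'rV[Cplx R]_d -> form01 E) :
    form01 E :=
  Form01
    (fun a e i x => \matrix_(k, l)
       rderive (fun s => f1Q (w (rtoc s *: u)) a e i x k l) 0)
    (fun a x => \matrix_(i, j)
       rderive (fun s => f1T (w (rtoc s *: u)) a x i j) 0).

(* Main.v *)
From HB Require Import structures.
From mathcomp Require Import all_boot all_order all_algebra.
From mathcomp Require Import complex.
From mathcomp Require Import all_classical all_reals all_analysis.
From mathcomp Require Import ring.
Require Import Defs.
Set Implicit Arguments.
Unset Strict Implicit.
Unset Printing Implicit Defensive.
Import Order.TTheory GRing.Theory Num.Theory numFieldNormedType.Exports.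
Local Open Scope classical_set_scope.
Local Open Scope ring_scope.

(* Read in the two smooth trivializations, the isomorphism of families is a
   family of maps g_t : X -> X with g_0 = id, holomorphic from X_t to X'_t,
   covered by isomorphisms of bundles. With s small and t = s u, let xi be the
   (1,0)-part of d/ds g_t at s = 0. The derivative at s = 0 of the equation
   saying that g_t is holomorphic is phi'_1 - phi_1 = dbar xi.

   For the bundle part, let M_t(x) be the matrix of E_x -> E_t -> E'_t from a
   frame of E to a holomorphic frame f of the second total bundle, and M'_t(x)
   that of E_x -> E'_t; then M_0 = M'_0. As the columns of the inverse of M_t
   form a holomorphic frame of E_t, the definition of A_t becomes
     M A_i = dbar_i M + phi_i^j (d_j M - M Gamma_j),
   and likewise for M'. Since dbar M_0 = 0, the difference of the derivatives of
   the two equations is dbar of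
     eta_Q = M_0^-1 d/ds (M'_t(g_t x) - M_t(x)) - xi^j Gamma_j
   up to the term xi^j dbar_i Gamma_j = - xi^j F_(j ibar). The points of the
   total space at which M'_t(g_t x) and M_t(x) are evaluated agree, so that
   eta_Q does not depend on f. *)

(** Two exchanges carry the computation: of d/ds with dbar, and of differentiation with composition
    by g_t. Smoothness being given by iterated derivatives along real directions, both rest on a
    chain rule and a symmetry of second derivatives that are derived from the mean value theorem in
    one variable. Once time and a chart of X are put together in C^(d+n), d/ds at s = 0 and the
    operators d_j, dbar_i on a time slice are all first order operators with constant coefficients,
    and these commute.

    The linearizations are short because A, A', phi and phi' vanish at t = 0 on all of X: a product
    with such a factor keeps one term only, and the motion of the base point does not affect phi'.
    The same vanishing is the reason for dbar M_0 = 0, so that only the (1,0)-part xi of the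
    velocity enters d/ds M'_t(g_t x).

    The summand - xi^j Gamma_j of eta_Q has two tasks. The frame e is used both at x and at g_t x,
    so that a change of e produces the derivative of a transition matrix along xi, which the
    transformation law of Gamma absorbs; and it completes d_j M_0 to the bracket d_j M_0 - M_0
    Gamma_j that multiplies phi'_1 - phi_1. *)

(** * Convergence of complex numbers and of matrices by components *)

Section ComplexNumbers.
Variable R : realType.
Local Notation C := (Cplx R).
Local Notation Re := (@complex.Re R).
Local Notation Im := (@complex.Im R).
Implicit Types z : C.

Lemma CplxE (z : C) : z = rtoc (Re z) + 'i * rtoc (Im z).
Proof. exact: complexE. Qed.

Lemma rtocD (a b : R) : rtoc (a + b) = rtoc a + rtoc b.
Proof. exact: (rmorphD (real_complex R)). Qed.

Lemma rtoc0 : rtoc 0 = 0 :> C. Proof. by []. Qed.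

Lemma rtoc1 : rtoc 1 = 1 :> C. Proof. by []. Qed.

Lemma ReD (x y : C) : Re (x + y) = Re x + Re y. Proof. by case: x; case: y. Qed.
Lemma ImD (x y : C) : Im (x + y) = Im x + Im y. Proof. by case: x; case: y. Qed.

Lemma ReM (x y : C) : Re (x * y) = Re x * Re y - Im x * Im y.
Proof. by case: x; case: y. Qed.

Lemma ImM (x y : C) : Im (x * y) = Re x * Im y + Im x * Re y.
Proof. by case: x=> ? ?; case: y=> ? ?. Qed.

(** The norm of [C] has its values in [C], so the two kinds of smallness have to be matched: |Re z|
    and |Im z| are at most |z|, and |z| is at most their sum. *)
Lemma cvg_Cplx (T : Type) (F : set_system T) {FF : Filter F} (f : T -> C) z :
  f x @[x --> F] --> z <->
  Re (f x) @[x --> F] --> Re z /\ Im (f x) @[x --> F] --> Im z.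
Proof.
split=> [fz|[rf imf]].
  move/cvgrPdist_lt: fz => fz.
  by split; apply/cvgrPdist_lt => e e0;
    have := fz (rtoc e); rewrite ltcR => /(_ e0);
    apply: filterS => t; rewrite normc_def ltcR; apply: le_lt_trans;
    rewrite -sqrtr_sqr ler_sqrt ?addr_ge0 ?sqr_ge0//; case: (z)=> a b;
      case: (f t) => c k /=;
    rewrite ?lerDl ?lerDr sqr_ge0.
apply/cvgrPdist_lt => e e0.
(* A positive element of [C] is real, so the radius may be taken in [R]. *)
have [r er r0] : exists2 r : R, e = rtoc r & 0 < r.
  exists (Re e).
    by case: e e0 => a b; rewrite ltcE /= => /andP[/eqP -> _].
  by move: e0; rewrite ltcE => /andP[].
have r20 : 0 < r / 2 by rewrite divr_gt0.
near=> t.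
have h1 : `|Re z - Re (f t)| < r / 2 by near: t; move/cvgrPdist_lt: rf; exact.
have h2 : `|Im z - Im (f t)| < r / 2 by near: t; move/cvgrPdist_lt: imf; exact.
rewrite er (CplxE (z - f t)); apply: le_lt_trans (ler_normD _ _) _.
have nr (a : R) : `|rtoc a| = rtoc `|a|.
  by rewrite normc_def /= expr0n addr0 sqrtr_sqr.
rewrite normrM !nr.
have -> : `|'i : C| = 1 by rewrite normCi.
rewrite mul1r -rmorphD ltcR [r in _ < r](splitr r).
by apply: ltrD; [move: h1|move: h2]; case: (z) => ? ?; case: (f t).
Unshelve. all: by end_near. Qed.

Lemma continuous_Cplx (T : topologicalType) (f : T -> C) (x : T) :
  {for x, continuous f} <->
  {for x, continuous (fun y => Re (f y))} /\ {for x, continuous (fun y =>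
    Im (f y))}.
Proof. exact: cvg_Cplx. Qed.

Lemma Re_continuous : continuous (Re : C -> R).
Proof. by move=> z; have [] := (continuous_Cplx (id : C ->
  C) z).1 (fun _ => id). Qed.

Lemma Im_continuous : continuous (Im : C -> R).
Proof. by move=> z; have [] := (continuous_Cplx (id : C ->
  C) z).1 (fun _ => id). Qed.

Lemma rtoc_continuous : continuous (@rtoc R).
Proof.
by move=> z; apply/continuous_Cplx; split => /=; [exact: cvg_id|exact: cvg_cst].
Qed.

Lemma conj_continuous : continuous (fun z : C => z^*).
Proof.
have rc (z : C) : Re z^* = Re z by case: z.
have ic (z : C) : Im z^* = - Im z by case: z.
have {}rc : (fun z : C => Re z^*) = Re by apply/funext.
have {}ic : (fun z : C => Im z^*) = (fun z => - Im z) by apply/funext.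
move=> z; apply/continuous_Cplx; rewrite /prop_for rc ic.
by split; [exact: Re_continuous|exact: (continuousN (@Im_continuous z))].
Qed.

Lemma cvg_mxP (K : numFieldType) (T : Type) (F : set_system T)
  {FF : Filter F} m n (f : T -> 'M[K]_(m, n)) (M : 'M[K]_(m, n)) :
  f x @[x --> F] --> M <-> forall i j, f x i j @[x --> F] --> M i j.
Proof.
split=> [fM i j|h].
  apply: (@cvg_comp _ _ _ f (fun N : 'M[K]_(m, n) => N i j) _ (nbhs M)) => //.
  exact: coord_continuous.
apply/cvg_mx_entourageP => A entA.
apply: filter_forall => i; apply: filter_forall => j.
have /cvg_entourageP/(_ A entA) hA := h i j.
by apply: (@filterS _ F FF _ _ _ hA) => x xA; apply/mem_set; apply: xA.
Qed.

End ComplexNumbers.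

(** * Directional derivatives of real functions *)

Section RealCalculus.
Variable R : realType.
Local Notation C := (Cplx R).

Lemma is_derive1P (f : R -> R) (x d : R) :
  is_derive x 1 f d <-> h^-1 * (f (x + h) - f x) @[h --> 0^'] --> d.
Proof.
have E : (fun h : R => h^-1 *: ((f \o shift x) (h *: (1 : R)) - f x)) =
    (fun h => h^-1 * (f (x + h) - f x)).
  by apply/funext => h /=; rewrite /GRing.scale /= mulr1 (addrC x h).
split=> [[df <-]|fd].
  by move: df; rewrite /derivable /derive E => df; exact: df.
apply: DeriveDef; first by rewrite /derivable E; apply/cvg_ex; exists d.
by rewrite /derive E; exact/cvg_lim.
Qed.

(** As [a] vanishes at 0, the difference quotient is that of [a] times [sg], so continuity of [sg]
    is enough. It is applied to a slope [sg] provided by the mean value theorem, whose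
    differentiability is unknown. *)
Lemma is_derive0M (a sg : R -> R) (da : R) :
  a 0 = 0 -> is_derive (0 : R) 1 a da -> {for 0, continuous sg} ->
  is_derive (0 : R) 1 (fun s => a s * sg s) (da * sg 0).
Proof.
move=> a0 /is_derive1P ad sgc; apply/is_derive1P.
have -> : (fun h => h^-1 * (a (0 + h) * sg (0 + h) - a 0 * sg 0)) =
   (fun h => (h^-1 * (a (0 + h) - a 0)) * sg h).
  by apply/funext => h; rewrite a0 !add0r mul0r !subr0 mulrA.
by apply: cvgM => //; apply: cvg_within_filter.
Qed.

(** The increment may go in either direction from 0 and may be zero, which is why the intermediate
    point is located by absolute values. *)
Lemma mean_value (f df : R -> R) (b : R) :
  (forall t : R, `|t| <= `|b| -> is_derive t 1 f (df t)) ->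
  exists2 c, `|c| <= `|b| & f b - f 0 = df c * b.
Proof.
move=> fd; have [b0|b0] := leP 0 b.
  have dk (x : R) : x \in `[0, b]%R -> is_derive x 1 f (df x).
    rewrite in_itv /= => /andP[x0 xb]; apply: fd.
    by rewrite !ger0_norm.
  have dk' (x : R) : x \in `]0, b[%R -> is_derive x 1 f (df x).
    by move=> xb; apply: dk; exact: subset_itv_oo_cc xb.
  have fc : {within `[0, b], continuous f}.
    by apply: derivable_within_continuous => x /dk [].
  have [c] := MVT_segment b0 dk' fc.
  rewrite in_itv /= => /andP[c0 cb] ->.
  by exists c; rewrite ?subr0// !ger0_norm.
have dk (x : R) : x \in `[b, 0]%R -> is_derive x 1 f (df x).
  rewrite in_itv /= => /andP[x0 xb]; apply: fd.
  by rewrite !ler0_norm ?lerN2// ltW.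
have dk' (x : R) : x \in `]b, 0[%R -> is_derive x 1 f (df x).
  by move=> xb; apply: dk; exact: subset_itv_oo_cc xb.
have fc : {within `[b, 0], continuous f}.
  by apply: derivable_within_continuous => x /dk [].
have [c] := MVT_segment (ltW b0) dk' fc.
rewrite in_itv /= => /andP[c0 cb] E.
exists c; first by rewrite !ler0_norm ?lerN2// ltW.
by rewrite -opprB E sub0r mulrN opprK.
Qed.

Variable n : nat.
Local Notation V := 'rV[C]_n.
Implicit Types (g : V -> R) (x v w : V).

Definition realdir g v x : R := derive1 (fun s => g (x + rtoc s *: v)) 0.
Definition realdirable g v x : Prop :=
  derivable (fun s => g (x + rtoc s *: v)) 0 1.

Lemma is_derive_line g v x (t : R) : realdirable g v (x + rtoc t *: v) ->
  is_derive t 1 (fun s => g (x + rtoc s *: v)) (realdir g v (x + rtoc t *: v)).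
Proof.
move=> gd; apply/is_derive1P; rewrite /realdir derive1E.
have E h : h^-1 * (g (x + rtoc (t + h) *: v) - g (x + rtoc t *: v)) =
    h^-1 * (g (x + rtoc t *: v + rtoc (0 + h) *: v)
            - g (x + rtoc t *: v + rtoc 0 *: v)).
  by rewrite add0r rtocD scalerDl addrA rtoc0 scale0r addr0.
by rewrite (eq_cvg _ _ E); have /derivableP/is_derive1P := gd.
Qed.

Lemma line_continuous x v : continuous (fun s : R => x + rtoc s *: v).
Proof.
by move=> s; apply: cvgD; [exact: cvg_cst|apply: cvgZr_tmp;
  apply: rtoc_continuous].
Qed.

Lemma line0 x v : x + rtoc 0 *: v = x.
Proof. by rewrite rtoc0 scale0r addr0. Qed.

Lemma cvg_addline (T : Type) (F : set_system T) {FF : Filter F} (y : T -> V)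
    (a : T -> R) x v :
  y s @[s --> F] --> x -> a s @[s --> F] --> (0 : R) ->
  y s + rtoc (a s) *: v @[s --> F] --> x.
Proof.
move=> yx a0.
have h : rtoc (a s) *: v @[s --> F] --> rtoc 0 *: v.
  apply: cvgZr_tmp.
  by apply: (@cvg_comp _ _ _ a (@rtoc R) _ (nbhs (0 : R))) => //;
    exact: rtoc_continuous.
have hh := cvgD yx h.
rewrite line0 in hh.
exact: hh.
Qed.

(** The map (s, t) |-> y s + t v is jointly continuous at the origin, which gives a square of
    parameters on which [P] holds. The mean value theorem needs [P] on whole segments, not only at
    their end points. *)
Lemma near_plane (P : set V) (y : R -> V) v x :
  (\forall z \near x, P z) -> y s @[s --> (0 : R)] --> x ->
  exists2 e, 0 < e & forall s t : R, `|s| < e -> `|t| < e ->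
    P (y s + rtoc t *: v).
Proof.
move=> Px yx.
have hc : y p.1 + rtoc p.2 *: v @[p --> ((0 : R), (0 : R))] --> x.
  apply: (@cvg_addline _ _ _ (fun p => y p.1) snd); last exact: cvg_snd.
  by apply: (@cvg_comp _ _ _ fst y _ (nbhs (0 : R))) => //; exact: cvg_fst.
move: hc => /(_ _ Px) /= [[A B] /= [A0 B0] AB].
have /nbhs_ballP[e1 /= e10 e1A] := A0.
have /nbhs_ballP[e2 /= e20 e2B] := B0.
exists (Num.min e1 e2); first by rewrite lt_min e10.
move=> s t; rewrite !lt_min => /andP[s1 _] /andP[_ t2].
apply: (AB (s, t)); split; [apply: e1A|apply: e2B];
by rewrite -ball_normE /ball_ /= sub0r normrN.
Qed.

(* Telescoping along the directions of vs; each increment is evaluated by the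
   mean value theorem. *)
Lemma is_derive_chain g x (vs : seq (V * (R -> R))) :
  (\forall y \near x, forall v, realdirable g v y) ->
  (forall v, {for x, continuous (realdir g v)}) ->
  (forall p, p \in vs -> p.2 0 = 0 /\ derivable p.2 0 1) ->
  is_derive (0 : R) 1 (fun s => g (x + \sum_(p <- vs) rtoc (p.2 s) *: p.1))
    (\sum_(p <- vs) derive1 p.2 0 * realdir g p.1 x).
Proof.
move=> gx gc avs.
(* The convergence of the partial sums to x is carried through the induction, because the next
   segment has to start near x. *)
suff [] : x + \sum_(p <- vs) rtoc (p.2 s) *: p.1 @[s --> (0:R)] --> x /\
  is_derive (0 : R) 1 (fun s => g (x + \sum_(p <- vs) rtoc (p.2 s) *: p.1))
    (\sum_(p <- vs) derive1 p.2 0 * realdir g p.1 x) by [].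
elim: vs avs => [_|[v a] vs IH avs].
  split; first by under eq_fun do rewrite big_nil addr0; exact: cvg_cst.
  rewrite big_nil; under eq_fun do rewrite big_nil addr0.
  exact: is_derive_cst.
have [a0 ad] : a 0 = 0 /\ derivable a 0 1 by apply: (avs (v, a));
  rewrite mem_head.
have [|yc yd] := IH; first by move=> p pvs; apply: avs; rewrite inE pvs orbT.
set y := fun s => _ in yc yd.
have E s : x + \sum_(p <- (v,
  a) :: vs) rtoc (p.2 s) *: p.1 = y s + rtoc (a s) *: v.
  by rewrite big_cons addrCA addrC.
have ac : a s @[s --> (0 : R)] --> (0 : R).
  have /derivable1_diffP/differentiable_continuous := ad.
  by rewrite /prop_for /continuous_at a0.
split.
  under eq_fun do rewrite E.
  exact: cvg_addline.
(* The slope of g on the last segment. Where a s = 0 the segment is a point and the slope is given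
   its limit value, so that a s times sg s is the exact increment for every s. *)
pose sg s := if a s == 0 then realdir g v x
             else (g (y s + rtoc (a s) *: v) - g (y s)) / a s.
have sgE : (fun s => g (x + \sum_(p <- (v, a) :: vs) rtoc (p.2 s) *: p.1)) =
    (fun s => a s * sg s) + (fun s => g (y s)).
  apply/funext => s; rewrite E [RHS]/GRing.add /= /sg; case: eqVneq => [->|as0].
    by rewrite mul0r add0r line0.
  by rewrite mulrC divfK// subrK.
rewrite sgE big_cons /=; apply: is_deriveD.
have -> : realdir g v x = sg 0 by rewrite /sg a0 eqxx.
apply: is_derive0M => //; first by rewrite derive1E; exact/derivableP.
rewrite /prop_for /continuous_at {2}/sg a0 eqxx.
apply/cvgrPdist_lt => e e0.
have [] := @near_plane [set z | (forall v, realdirable g v z) /\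
    `|realdir g v x - realdir g v z| < e] y v x.
- apply: filterI => //.
  by have /cvgrPdist_lt := gc v; apply.
- by [].
move=> d d0 dP; near=> s.
have sd : `|s| < d by near: s; exact: (@nbhs0_lt R R^o).
have asd : `|a s| < d.
  near: s; move/cvgrPdist_lt: ac => /(_ d d0).
  by apply: filterS => t; rewrite sub0r normrN.
rewrite /sg; case: eqVneq => [_|as0]; first by rewrite subrr normr0.
have [c cas] : exists2 c, `|c| <= `|a s| & g (y s + rtoc (a s) *: v) -
    g (y s + rtoc 0 *: v) = realdir g v (y s + rtoc c *: v) * a s.
  apply: (@mean_value (fun t => g (y s + rtoc t *: v))
            (fun t => realdir g v (y s + rtoc t *: v))).
  move=> t tas; apply: is_derive_line.
  by apply: (dP s t _ _).1 => //; apply: le_lt_trans tas asd.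
rewrite line0 => ->; rewrite mulfK//.
by apply: (dP s c _ _).2 => //; apply: le_lt_trans cas asd.
Unshelve. all: by end_near. Qed.

(** The mean value theorem is used twice: along v for the difference of g between two parallel sides
    of the parallelogram, then along w for [realdir g v]. Only one order of differentiation is
    involved; exchanging v and w yields the other one from the same second difference. *)
Lemma second_difference g x v w (P : set V) :
  (\forall y \near x, P y) ->
  (forall y, P y -> realdirable g v y /\ realdirable (realdir g v) w y) ->
  \forall h \near (0 : R), exists2 p, P p &
    g (x + rtoc h *: v + rtoc h *: w) - g (x + rtoc h *: v)
    - g (x + rtoc h *: w) + g x = h * h * realdir (realdir g v) w p.
Proof.
move=> Px Pd.
have [e e0 eP] : exists2 e, 0 < e & forall s t : R, `|s| < e -> `|t| < e ->
    P ((x + rtoc s *: v) + rtoc t *: w).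
  apply: near_plane Px _; have := @line_continuous x v 0.
  by rewrite /continuous_at line0.
near=> h.
have he : `|h| < e by near: h; exact: (@nbhs0_lt R R^o).
pose phi s := g (x + rtoc h *: w + rtoc s *: v) - g (x + rtoc s *: v).
pose dphi s := realdir g v (x + rtoc h *: w + rtoc s *: v)
               - realdir g v (x + rtoc s *: v).
have [t th|c ch] := @mean_value phi dphi h.
  have te := le_lt_trans th he.
  apply: is_deriveB; apply: is_derive_line.
    by apply: (Pd _ _).1; rewrite addrAC; exact: eP.
  apply: (Pd _ _).1; rewrite -[X in P X](line0 _ w).
  by apply: eP; rewrite // normr0.
have [t th|k kh] := @mean_value (fun t =>
  realdir g v (x + rtoc c *: v + rtoc t *: w))
   (fun t => realdir (realdir g v) w (x + rtoc c *: v + rtoc t *: w)) h.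
  apply: is_derive_line; apply: (Pd _ _).2; apply: eP; exact: le_lt_trans he.
move=> E2 E1; rewrite (line0 (x + rtoc c *: v) w) in E2;
  rewrite /phi /dphi in E1.
exists (x + rtoc c *: v + rtoc k *: w).
  by apply: eP; exact: le_lt_trans he.
move: E1; rewrite (addrAC x _ (rtoc c *: v)) E2 !line0 => E1.
rewrite [RHS]mulrC mulrA -E1 (addrAC x (rtoc h *: v)); ring.
Unshelve. all: by end_near. Qed.

(** The second difference is symmetric in v and w. For every small h the two mixed derivatives thus
    have a common value, taken at two points close to x, and continuity at x forces equality
    there. *)
Lemma realdirC g x v w :
  (\forall y \near x, realdirable g v y /\ realdirable (realdir g v) w y) ->
  (\forall y \near x, realdirable g w y /\ realdirable (realdir g w) v y) ->
  {for x, continuous (realdir (realdir g v) w)} ->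
  {for x, continuous (realdir (realdir g w) v)} ->
  realdir (realdir g v) w x = realdir (realdir g w) v x.
Proof.
set A := realdir (realdir g v) w; set B := realdir (realdir g w) v.
move=> gv gw Ac Bc; apply/eqP; rewrite -subr_eq0 -normr_le0.
apply/ler_addgt0Pl => e e0; rewrite addr0.
have e20 : 0 < e / 2 by rewrite divr_gt0.
pose P z := (realdirable g v z /\ realdirable (realdir g v) w z) /\
            `|A x - A z| < e / 2.
pose Q z := (realdirable g w z /\ realdirable (realdir g w) v z) /\
            `|B x - B z| < e / 2.
have Px : \forall y \near x, P y.
  apply: filterI; first exact: gv.
  move/cvgrPdist_lt: Ac; exact.
have Qx : \forall y \near x, Q y.
  apply: filterI; first exact: gw.
  move/cvgrPdist_lt: Bc; exact.
have hA := @second_difference g x v w P Px (fun y Py => Py.1).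
have hB := @second_difference g x w v Q Qx (fun y Py => Py.1).
have [r r0 rA] := (@nbhs_norm0P R R^o _).1 (filterI hA hB).
(* The increment h = r / 2 is nonzero and lies within the radius r on which both second difference
   formulas hold. *)
have r20 : r / 2 != 0 by rewrite mulf_neq0 ?invr_eq0 ?gt_eqF ?pnatr_eq0.
have [|[p [_ Pp] Ep] [q [_ Qq] Eq]] := rA (r / 2).
  by rewrite /= gtr0_norm ?ltr_pdivrMr ?divr_gt0// ltr_pMr// ltr1n.
have pq : A p = B q.
  have E (a b c k : R) : a - b - c + k = a - c - b + k by ring.
  by apply: (mulfI (mulf_neq0 r20 r20)); rewrite -[LHS]Ep -[RHS]Eq (addrAC x) E.
have key (a b c k : R) : c = k -> `|a - c| < e / 2 -> `|b - k| < e / 2 ->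
    `|a - b| <= e.
  move=> <- ac bc; have -> : a - b = (a - c) - (b - c) by ring.
  apply: (le_trans (ler_normB _ _)); rewrite [e]splitr.
  by apply: lerD; exact: ltW.
exact: (key _ _ _ _ pq Pp Qq).
Qed.

End RealCalculus.

(** * Derivatives of complex functions *)

Section ComplexDerivatives.
Variable R : realType.
Local Notation C := (Cplx R).
Local Notation Re := (@complex.Re R).
Local Notation Im := (@complex.Im R).

Definition is_rderive (g : R -> C) (s : R) (d : C) : Prop :=
  is_derive s 1 (fun y => Re (g y)) (Re d) /\
  is_derive s 1 (fun y => Im (g y)) (Im d).

Lemma rderivableP (g : R -> C) s : rderivable g s ->
  is_rderive g s (rderive g s).
Proof.
case=> gr gi; rewrite /is_rderive /rderive /= !derive1E.
by split; [exact: derivableP gr|exact: derivableP gi].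
Qed.

Lemma is_rderive_derivable (g : R -> C) s d : is_rderive g s d ->
  rderivable g s.
Proof. case=> [[h _] [k _]]; exact (conj h k). Qed.

Lemma rderive_val (g : R -> C) s d : is_rderive g s d -> rderive g s = d.
Proof.
by case=> [[_ gr] [_ gi]]; rewrite /rderive !derive1E gr gi; case: d {gr gi}.
Qed.

Lemma is_rderive_near (f g : R -> C) s d :
  (\forall t \near s, f t = g t) -> is_rderive f s d -> is_rderive g s d.
Proof.
move=> fg [fr fi]; split.
  by apply: near_eq_is_derive fr; apply: filterS fg => t ->.
by apply: near_eq_is_derive fi; apply: filterS fg => t ->.
Qed.

Lemma is_rderive_cst (c : C) s : is_rderive (fun _ => c) s 0.
Proof. by split; exact: is_derive_cst. Qed.

Lemma is_rderiveD (f g : R -> C) s df dg :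
  is_rderive f s df -> is_rderive g s dg ->
  is_rderive (fun t => f t + g t) s (df + dg).
Proof.
move=> [fr fi] [gr gi]; split.
  rewrite ReD (_ : (fun y => _) = (fun y => Re (f y)) + (fun y => Re (g y))).
    exact: is_deriveD.
  by apply/funext => y; rewrite ReD.
rewrite ImD (_ : (fun y => _) = (fun y => Im (f y)) + (fun y => Im (g y))).
  exact: is_deriveD.
by apply/funext => y; rewrite ImD.
Qed.

Lemma is_rderiveM (f g : R -> C) s df dg :
  is_rderive f s df -> is_rderive g s dg ->
  is_rderive (fun t => f t * g t) s (df * g s + f s * dg).
Proof.
move=> [fr fi] [gr gi].
have frgr := @is_deriveM _ _ _ _ s 1 _ _ fr gr.
have figi := @is_deriveM _ _ _ _ s 1 _ _ fi gi.
have frgi := @is_deriveM _ _ _ _ s 1 _ _ fr gi.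
have figr := @is_deriveM _ _ _ _ s 1 _ _ fi gr.
split.
  rewrite (_ : (fun y => _) = (fun y => Re (f y)) * (fun y => Re (g y))
    - (fun y => Im (f y)) * (fun y => Im (g y))); last first.
    by apply/funext => y; rewrite ReM.
  apply: (is_derive_eq (is_deriveB frgr figi)).
  by rewrite /GRing.scale /= ReD !ReM; ring.
rewrite (_ : (fun y => _) = (fun y => Re (f y)) * (fun y => Im (g y))
    + (fun y => Im (f y)) * (fun y => Re (g y))); last first.
  by apply/funext => y; rewrite ImM.
apply: (is_derive_eq (is_deriveD frgi figr)).
by rewrite /GRing.scale /= ImD !ImM; ring.
Qed.

Lemma Re_conj (z : C) : Re z^* = Re z. Proof. by case: z. Qed.
Lemma Im_conj (z : C) : Im z^* = - Im z. Proof. by case: z. Qed.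

Lemma is_rderive_conj (f : R -> C) s df :
  is_rderive f s df -> is_rderive (fun t => (f t)^*) s df^*.
Proof.
move=> [fr fi]; split.
  rewrite Re_conj (_ : (fun y => _) = (fun y => Re (f y)))//.
  by apply/funext => y; rewrite Re_conj.
rewrite Im_conj (_ : (fun y => _) = - (fun y => Im (f y))).
  exact: is_deriveN.
by apply/funext => y; rewrite Im_conj.
Qed.

Lemma is_rderive_rtoc (f : R -> R) (s df : R) :
  is_derive s 1 f df -> is_rderive (fun t => rtoc (f t)) s (rtoc df).
Proof. by move=> fd; split => //=; exact: is_derive_cst. Qed.

(** The inverse of f is the conjugate of f times the real function 1/|f|^2, so conjugation, products
    and the real rule for inverses suffice. *)
Lemma is_rderiveV (f : R -> C) s df : f s != 0 ->
  is_rderive f s df -> is_rderive (fun t =>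
    (f t)^-1) s (- df * (f s)^-1 * (f s)^-1).
Proof.
move=> fs0 [fr fi].
pose N t := Re (f t) ^+ 2 + Im (f t) ^+ 2.
have Ns0 : N s != 0.
  apply: contra fs0; rewrite paddr_eq0 ?sqr_ge0// !sqrf_eq0.
  by case: (f s) => a b /=; rewrite eq_complex.
have VE t : (f t)^-1 = (f t)^* * rtoc (N t)^-1.
  rewrite /N; case: (f t) => a b; apply/eqP; rewrite eq_complex.
  by apply/andP; split; apply/eqP;
    rewrite /= ?mulr0 ?subr0 ?add0r ?addr0 // mulNr.
have dN : is_derive s 1 N (2 * (Re (f s) * Re df + Im (f s) * Im df)).
  have := is_deriveD (is_deriveM fr fr) (is_deriveM fi fi).
  rewrite (_ : _ + _ = N); last by apply/funext => t; rewrite /N !expr2.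
  by move=> h; apply: (is_derive_eq h); rewrite /GRing.scale /=; ring.
have dV := is_rderive_rtoc (is_deriveV Ns0 dN).
have := is_rderiveM (is_rderive_conj (conj fr fi : is_rderive f s df)) dV.
rewrite (_ : (fun t => _ * _) = (fun t => (f t)^-1)); last first.
  by apply/funext => t; rewrite VE.
move=> [h1 h2]; move: Ns0; rewrite /N => Ns0.
split; [apply: (is_derive_eq h1)|apply: (is_derive_eq h2)].
  rewrite ReD !(ReM, ImM, VE, Re_conj, Im_conj) /N.
  case: (f s) Ns0 => a b; case: (df) => p q /= Ns0.
  by rewrite /GRing.scale /=; field.
rewrite ImD !(ReM, ImM, VE, Re_conj, Im_conj) /N.
case: (f s) Ns0 => a b; case: (df) => p q /= Ns0.
by rewrite /GRing.scale /=; field.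
Qed.

(** * The chain rule along a curve, in terms of d/dz and d/dzbar *)

Section Chain.
Variable n : nat.
Local Notation V := 'rV[C]_n.
Implicit Types (f : V -> C) (v x : V).

Lemma dirderiveE f v x : dirderive f v x =
  (realdir (fun y => Re (f y)) v x +i* realdir (fun y => Im (f y)) v x)%C.
Proof. by []. Qed.

Lemma Re_dirderive f v :
  (fun x => Re (dirderive f v x)) = realdir (fun y => Re (f y)) v.
Proof. by apply/funext => x; rewrite dirderiveE. Qed.

Lemma Im_dirderive f v :
  (fun x => Im (dirderive f v x)) = realdir (fun y => Im (f y)) v.
Proof. by apply/funext => x; rewrite dirderiveE. Qed.

(** Just what the chain rule at x uses: the derivatives exist near x, for the mean value theorem,
    and are continuous at x. *)
Definition C1_near f x : Prop :=
  (\forall y \near x, forall v, rderivable (along f v y) 0) /\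
  forall v, {for x, continuous (dirderive f v)}.

Lemma along_derivative f v x : rderivable (along f v x) 0 ->
  is_rderive (along f v x) 0 (dirderive f v x).
Proof. exact: rderivableP. Qed.

Lemma Re_sum (I : Type) (r : seq I) (F : I -> C) :
  Re (\sum_(i <- r) F i) = \sum_(i <- r) Re (F i).
Proof.
by elim: r => [|i r IH]; rewrite ?big_nil// !big_cons ReD IH.
Qed.

Lemma Im_sum (I : Type) (r : seq I) (F : I -> C) :
  Im (\sum_(i <- r) F i) = \sum_(i <- r) Im (F i).
Proof.
by elim: r => [|i r IH]; rewrite ?big_nil// !big_cons ImD IH.
Qed.

Lemma Re_rtocM a (z : C) : Re (rtoc a * z) = a * Re z.
Proof. by rewrite ReM mul0r subr0. Qed.

Lemma Im_rtocM a (z : C) : Im (rtoc a * z) = a * Im z.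
Proof. by rewrite ImM mul0r addr0. Qed.

(** On the right stands the real vector c in the j-th coordinate line, split along the real basis 1,
    i; on the left, the same vector split by type. The identity turns the real chain rule into its
    complex form. *)
Lemma wirtinger f (c : C) j x :
  c * dz j f x + c^* * dzbar j f x =
  rtoc (Re c) * dirderive f (delta_mx 0 j) x +
  rtoc (Im c) * dirderive f ('i *: delta_mx 0 j) x.
Proof.
rewrite /dz /dzbar; set A := dirderive f _ x; set B := dirderive f _ x.
have rc : rtoc (Re c) = (c + c^* ) / 2 by exact: ReJ_add.
have ic : rtoc (Im c) = (c^* - c) / 2 * 'i by exact: ImJ_sub.
by rewrite rc ic; field.
Qed.

Lemma is_rderive_comp f (gam : R -> V) (dgam : V) : C1_near f (gam 0) ->
  (forall j, is_rderive (fun s => gam s 0 j) 0 (dgam 0 j)) ->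
  is_rderive (fun s => f (gam s)) 0
    (\sum_j (dgam 0 j * dz j f (gam 0) + (dgam 0 j)^* * dzbar j f (gam 0))).
Proof.
set x := gam 0 => -[fd fc] gd.
(* The 2n real coordinate directions, each with the matching real component of the curve. *)
pose vs : seq (V * (R -> R)) :=
  [seq (delta_mx 0 j, fun s =>
    Re (gam s 0 j - x 0 j)) | j <- index_enum 'I_n] ++
  [seq ('i *: delta_mx 0 j, fun s =>
    Im (gam s 0 j - x 0 j)) | j <- index_enum 'I_n].
have gamE s : gam s = x + \sum_(p <- vs) rtoc (p.2 s) *: p.1.
  rewrite big_cat /= !big_map -big_split /=.
  rewrite (eq_bigr (fun j => (gam s - x) 0 j *: delta_mx 0 j)); last first.
    move=> j _; rewrite scalerA -scalerDl; congr (_ *: _).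
    by rewrite !mxE mulrC -CplxE.
  by rewrite -row_sum_delta addrC subrK.
have reD j : is_derive (0 : R) 1 (fun s =>
  Re (gam s 0 j - x 0 j)) (Re (dgam 0 j)).
  have [h _] := is_rderiveD (gd j) (is_rderive_cst (- x 0 j) 0).
  by rewrite addr0 in h.
have imD j : is_derive (0 : R) 1 (fun s =>
  Im (gam s 0 j - x 0 j)) (Im (dgam 0 j)).
  have [_ h] := is_rderiveD (gd j) (is_rderive_cst (- x 0 j) 0).
  by rewrite addr0 in h.
have avs p : p \in vs -> p.2 0 = 0 /\ derivable p.2 0 1.
  rewrite mem_cat => /orP[] /mapP[j _ ->] /=; rewrite subrr; split=> //.
have E : \sum_j (dgam 0 j * dz j f x + (dgam 0 j)^* * dzbar j f x) =
   \sum_j (rtoc (Re (dgam 0 j)) * dirderive f (delta_mx 0 j) x +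
           rtoc (Im (dgam 0 j)) * dirderive f ('i *: delta_mx 0 j) x).
  by apply: eq_bigr => j _; exact: wirtinger.
have step (g : V -> R) : (\forall y \near x, forall v, realdirable g v y) ->
    (forall v, {for x, continuous (realdir g v)}) ->
    is_derive (0 : R) 1 (fun s => g (gam s))
     (\sum_j (Re (dgam 0 j) * realdir g (delta_mx 0 j) x +
              Im (dgam 0 j) * realdir g ('i *: delta_mx 0 j) x)).
  move=> gd' gc; have := is_derive_chain gd' gc avs.
  rewrite (_ : (fun s => _) = (fun s => g (gam s))); last first.
    by apply/funext => s; rewrite -gamE.
  rewrite big_cat /= !big_map -big_split /=.
  rewrite (eq_bigr (fun j => Re (dgam 0 j) * realdir g (delta_mx 0 j) x +
              Im (dgam 0 j) * realdir g ('i *: delta_mx 0 j) x)) // => j _.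
  rewrite !derive1E; have [_ ->] := reD j; by have [_ ->] := imD j.
split.
  rewrite E Re_sum.
  rewrite (eq_bigr (fun j => Re (dgam 0 j) * realdir (fun y =>
    Re (f y)) (delta_mx 0 j) x +
              Im (dgam 0 j) * realdir (fun y =>
                Re (f y)) ('i *: delta_mx 0 j) x)); last first.
    move=> j _; apply: (etrans (ReD _ _)).
    apply: (congr2 +%R); exact: Re_rtocM.
  apply: step; first by apply: filterS fd => y h v; exact: (h v).1.
  move=> v; rewrite -Re_dirderive;
    exact: ((continuous_Cplx (dirderive f v) x).1 (fc v)).1.
rewrite E.
rewrite Im_sum.
rewrite (eq_bigr (fun j => Re (dgam 0 j) * realdir (fun y =>
  Im (f y)) (delta_mx 0 j) x +
              Im (dgam 0 j) * realdir (fun y =>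
                Im (f y)) ('i *: delta_mx 0 j) x)); last first.
  move=> j _; apply: (etrans (ImD _ _)).
  apply: (congr2 +%R); exact: Im_rtocM.
apply: step; first by apply: filterS fd => y h v; exact: (h v).2.
move=> v; rewrite -Im_dirderive;
  exact: ((continuous_Cplx (dirderive f v) x).1 (fc v)).2.
Qed.

End Chain.

End ComplexDerivatives.

(** * Stability of the classes C^k under algebraic operations and composition *)

Section Smoothness.
Variable R : realType.
Local Notation C := (Cplx R).

Lemma continuous_rV (T : topologicalType) n (G : T -> 'rV[C]_n) (x : T) :
  {for x, continuous G} <-> forall j, {for x, continuous (fun y => G y 0 j)}.
Proof.
split=> [Gc j|Gc].
  exact: ((@cvg_mxP C T (nbhs x) _ _ _ G (G x)).1 Gc 0 j).
by apply: (@cvg_mxP C T (nbhs x) _ _ _ G (G x)).2 => i j; rewrite (ord1 i);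
  exact: Gc.
Qed.

Section Germs.
Variable n : nat.
Local Notation V := 'rV[C]_n.
Implicit Types (f g : V -> C) (v x : V) (U W : set V).

Lemma near_along (P : set V) v x : (\forall y \near x, P y) ->
  \forall s \near (0 : R), P (x + rtoc s *: v).
Proof.
move=> Px; have h := @line_continuous R n x v 0.
by rewrite /continuous_at line0 in h; exact: h.
Qed.

Lemma dirderive_near f g v x : (\forall y \near x, f y = g y) ->
  dirderive f v x = dirderive g v x.
Proof.
move=> fg; have fg0 := near_along v fg.
rewrite /dirderive /rderive !derive1E; congr (_ +i* _)%C;
  by apply: near_eq_derive; apply: filterS fg0 => s E; rewrite /along E.
Qed.

Lemma rderivable_near f g v x : (\forall y \near x, f y = g y) ->
  rderivable (along f v x) 0 -> rderivable (along g v x) 0.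
Proof.
move=> fg /rderivableP fd; apply: is_rderive_derivable.
by apply: is_rderive_near fd; exact: near_along fg.
Qed.

Lemma continuous_near (T : topologicalType) (f g : V -> T) x :
  (\forall y \near x, f y = g y) ->
  {for x, continuous f} -> {for x, continuous g}.
Proof.
rewrite /prop_for /continuous_at => fg.
rewrite (nbhs_singleton fg); apply: cvg_trans.
exact: (near_eq_cvg fg).
Qed.

Lemma near_open (T : topologicalType) (U P : set T) (x : T) : open U -> U x ->
  (forall y, U y -> P y) -> \forall y \near x, P y.
Proof. by move=> oU Ux UP; apply: (filterS UP); exact: open_nbhs_nbhs. Qed.

Lemma Ck_ext k U f g : open U -> (forall x, U x -> f x = g x) ->
  Ck k U f -> Ck k U g.
Proof.
move=> oU; elim: k f g => [|k IH] f g fg /=.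
  move=> fc x Ux; apply: continuous_near (fc x Ux).
  exact: near_open oU Ux fg.
have nfg x : U x -> \forall y \near x, f y = g y.
  by move=> Ux; apply: filterS (open_nbhs_nbhs (conj oU Ux)).
move=> [fc fd]; split=> [x Ux|v].
  exact: continuous_near (nfg x Ux) (fc x Ux).
have [fv fk] := fd v; split=> [x Ux|].
  exact: rderivable_near (nfg x Ux) (fv x Ux).
by apply: IH fk => x Ux; apply: dirderive_near; exact: nfg.
Qed.

Lemma Ck_continuous k U f x : Ck k U f -> U x -> {for x, continuous f}.
Proof. by case: k => [|k] /=; [exact|move=> [h _]; exact: h]. Qed.

Lemma CkW k U f : Ck k.+1 U f -> Ck k U f.
Proof.
elim: k f => [|k IH] f /=; first by case.
move=> [fc fd]; split=> // v; have [fv fk] := fd v; split=> //.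
exact: IH.
Qed.

Lemma Ck_sub k U W f : U `<=` W -> Ck k W f -> Ck k U f.
Proof.
move=> UW; elim: k f => [|k IH] f /=; first by move=> fc x /UW; exact: fc.
move=> [fc fd]; split=> [x /UW|v]; first exact: fc.
have [fv fk] := fd v; split=> [x /UW|]; first exact: fv.
exact: IH.
Qed.

(** [Ck] imposes conditions at the points of U on the iterated derivatives of a total function; it
    therefore makes sense on a single point, and can be checked one point at a time. *)
Lemma Ck_pointwise k U f : (forall x, U x -> Ck k [set x] f) -> Ck k U f.
Proof.
elim: k f => [|k IH] f h /=; first by move=> x Ux; exact: (h x Ux).
split=> [x Ux|v]; first exact: (h x Ux).1.
split=> [x Ux|]; first exact: ((h x Ux).2 v).1.
by apply: IH => x Ux; exact: ((h x Ux).2 v).2.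
Qed.

Lemma Ck_C1_near k U f x : open U -> U x -> Ck k.+1 U f -> C1_near f x.
Proof.
move=> oU Ux [fc fd]; split.
  apply: near_open oU Ux _ => y Uy v.
  by have [fv _] := fd v; exact: fv.
by move=> v; have [_ fk] := fd v; exact: Ck_continuous fk Ux.
Qed.

Lemma Ck_is_rderive k U f v x : U x -> Ck k.+1 U f ->
  is_rderive (along f v x) 0 (dirderive f v x).
Proof.
by move=> Ux [fc fd]; apply: along_derivative; have [fv _] := fd v; exact: fv.
Qed.

Lemma along0 f v x : along f v x 0 = f x.
Proof. by rewrite /along line0. Qed.

Lemma Ck_cst k U (c : C) : Ck k U (fun _ => c).
Proof.
elim: k c => [|k IH] c /=; first by move=> x _; exact: cst_continuous.
split=> [x _|v]; first exact: cst_continuous.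
have h x : is_rderive (along (fun _ : V => c) v x) 0 0 by exact: is_rderive_cst.
split=> [x _|]; first exact: is_rderive_derivable (h x).
rewrite (_ : dirderive _ v = (fun _ => 0)); first exact: IH.
by apply/funext => x; apply: rderive_val (h x).
Qed.

Lemma is_rderive_coord j v x : is_rderive (along (fun y : V =>
  y 0 j) v x) 0 (v 0 j).
Proof.
have -> : along (fun y : V => y 0 j) v x = (fun s => x 0 j + rtoc s * v 0 j).
  by apply/funext => s; rewrite /along !mxE.
have := is_rderiveD (is_rderive_cst (x 0 j) 0)
  (is_rderiveM (is_rderive_rtoc (is_derive_id (0 : R) 1))
    (is_rderive_cst (v 0 j) 0)).
by rewrite add0r mulr0 addr0 rtoc1 mul1r.
Qed.

Lemma Ck_coord k U j : Ck k U (fun x => x 0 j).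
Proof.
have xc x : {for x, continuous (fun y : V => y 0 j)} by exact: coord_continuous.
case: k => [|k]; first by move=> x _; exact: xc.
split=> [x _|v]; first exact: xc.
have h x := is_rderive_coord j v x.
split=> [x _|]; first exact: is_rderive_derivable (h x).
rewrite (_ : dirderive _ v = (fun _ => v 0 j)); first exact: Ck_cst.
by apply/funext => x; apply: rderive_val (h x).
Qed.

Lemma CkD k U f g : open U -> Ck k U f -> Ck k U g ->
  Ck k U (fun x => f x + g x).
Proof.
move=> oU; elim: k f g => [|k IH] f g /= fk gk.
  by move=> x Ux; exact: (continuousD (fk x Ux) (gk x Ux)).
have h v x : U x -> is_rderive (along (fun x => f x + g x) v x) 0
    (dirderive f v x + dirderive g v x).
  move=> Ux; apply: is_rderiveD;
    [exact: Ck_is_rderive fk|exact: Ck_is_rderive gk].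
move: fk gk => [fc fd] [gc gd].
split=> [x Ux|v]; first exact: (continuousD (fc x Ux) (gc x Ux)).
split=> [x Ux|]; first exact: is_rderive_derivable (h v x Ux).
apply: Ck_ext (IH _ _ (fd v).2 (gd v).2) => // x Ux.
by apply/esym; apply: rderive_val (h v x Ux).
Qed.

Lemma CkM k U f g : open U -> Ck k U f -> Ck k U g ->
  Ck k U (fun x => f x * g x).
Proof.
move=> oU; elim: k f g => [|k IH] f g fk gk.
  by move=> x Ux; exact: (continuousM (fk x Ux) (gk x Ux)).
have h v x : U x -> is_rderive (along (fun x => f x * g x) v x) 0
    (dirderive f v x * g x + f x * dirderive g v x).
  move=> Ux; rewrite -(along0 g v x) -(along0 f v x).
  by apply: is_rderiveM; [exact: Ck_is_rderive fk|exact: Ck_is_rderive gk].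
have fk' := CkW fk; have gk' := CkW gk.
move: fk gk => [fc fd] [gc gd].
split=> [x Ux|v]; first exact: (continuousM (fc x Ux) (gc x Ux)).
split=> [x Ux|]; first exact: is_rderive_derivable (h v x Ux).
apply: Ck_ext (CkD oU (IH _ _ (fd v).2 gk') (IH _ _ fk' (gd v).2)) => // x Ux.
by apply/esym; apply: rderive_val (h v x Ux).
Qed.

Lemma Ck_conj k U f : open U -> Ck k U f -> Ck k U (fun x => (f x)^*).
Proof.
move=> oU; elim: k f => [|k IH] f fk.
  by move=> x Ux; apply: (continuous_comp (fk x Ux)); exact: conj_continuous.
have h v x : U x -> is_rderive (along (fun x =>
  (f x)^*) v x) 0 (dirderive f v x)^*.
  by move=> Ux; apply: is_rderive_conj; exact: Ck_is_rderive fk.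
move: fk => [fc fd].
split=> [x Ux|v].
  by apply: (continuous_comp (fc x Ux)); exact: conj_continuous.
split=> [x Ux|]; first exact: is_rderive_derivable (h v x Ux).
apply: Ck_ext (IH _ (fd v).2) => // x Ux.
by apply/esym; apply: rderive_val (h v x Ux).
Qed.

Lemma CkV k U f : open U -> (forall x, U x -> f x != 0) -> Ck k U f ->
  Ck k U (fun x => (f x)^-1).
Proof.
move=> oU f0; elim: k => [|k IH] fk.
  by move=> x Ux; exact: (continuousV (f0 x Ux) (fk x Ux)).
have h v x : U x -> is_rderive (along (fun x => (f x)^-1) v x) 0
    (-1 * dirderive f v x * (f x)^-1 * (f x)^-1).
  move=> Ux; rewrite mulN1r -(along0 f v x).
  apply: (is_rderiveV (f := along f v x)); first by rewrite along0; exact: f0.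
  exact: Ck_is_rderive fk.
have fk' := IH (CkW fk).
move: fk => [fc fd].
split=> [x Ux|v]; first exact: (continuousV (f0 x Ux) (fc x Ux)).
split=> [x Ux|]; first exact: is_rderive_derivable (h v x Ux).
apply: Ck_ext (CkM oU (CkM oU (CkM oU (Ck_cst k U (-1)) (fd v).2) fk') fk') =>
  // x Ux.
by apply/esym; apply: rderive_val (h v x Ux).
Qed.

Lemma Ck_sum k U (I : Type) (r : seq I) (F : I -> V -> C) : open U ->
  (forall i, Ck k U (F i)) -> Ck k U (fun x => \sum_(i <- r) F i x).
Proof.
move=> oU Fk; elim: r => [|i r IH].
  by apply: Ck_ext (Ck_cst k U 0) => // x _; rewrite big_nil.
by apply: Ck_ext (CkD oU (Fk i) IH) => // x _; rewrite big_cons.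
Qed.

Lemma Ck_dz k U f j : open U -> Ck k.+1 U f -> Ck k U (dz j f).
Proof.
move=> oU [_ fd]; pose a : C := 2^-1; pose b : C := - 'i / 2.
apply: (Ck_ext (f := fun x => a * dirderive f (delta_mx 0 j) x +
   b * dirderive f ('i *: delta_mx 0 j) x)) => //.
  by move=> x _; rewrite /dz mulrBl /a /b !mulNr (mulrC _^-1) mulrAC.
by apply: CkD => //; apply: CkM;
  [| exact: Ck_cst| exact: (fd _).2 | |exact: Ck_cst|exact: (fd _).2].
Qed.

Lemma Ck_dzbar k U f j : open U -> Ck k.+1 U f -> Ck k U (dzbar j f).
Proof.
move=> oU [_ fd]; pose a : C := 2^-1; pose b : C := 'i / 2.
apply: (Ck_ext (f := fun x => a * dirderive f (delta_mx 0 j) x +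
   b * dirderive f ('i *: delta_mx 0 j) x)) => //.
  by move=> x _; rewrite /dzbar mulrDl /a /b (mulrC _^-1) mulrAC.
by apply: CkD => //; apply: CkM;
  [| exact: Ck_cst| exact: (fd _).2 | |exact: Ck_cst|exact: (fd _).2].
Qed.

End Germs.

Section Composition.
Variables (m n : nat) (f : 'rV[C]_n -> C) (G : 'rV[C]_m -> 'rV[C]_n).

Lemma is_rderive_along_comp v x : C1_near f (G x) ->
  (forall j, rderivable (along (fun y => G y 0 j) v x) 0) ->
  is_rderive (along (fun y => f (G y)) v x) 0
    (\sum_j (dirderive (fun y => G y 0 j) v x * dz j f (G x) +
             (dirderive (fun y => G y 0 j) v x)^* * dzbar j f (G x))).
Proof.
move=> f1 Gd; pose gam s := G (x + rtoc s *: v).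
have g0 : gam 0 = G x by rewrite /gam line0.
pose dgam := \row_j dirderive (fun y => G y 0 j) v x.
have := @is_rderive_comp R n f gam dgam; rewrite g0 => /(_ f1) h.
have : is_rderive (fun s => f (gam s)) 0
 (\sum_j (dgam 0 j * dz j f (G x) + (dgam 0 j)^* * dzbar j f (G x))).
  by apply: h => j; rewrite mxE; exact: along_derivative.
by rewrite (eq_bigr _ (fun j _ => congr1 (fun c =>
  c * _ + c^* * _) (mxE _ _ 0 j))).
Qed.

End Composition.

(** Induction on k for all f at once: the derivatives of the composite involve [dz j f] and
    [dzbar j f] composed with G, to which the induction hypothesis applies. *)
Lemma Ck_comp m n k (U : set 'rV[C]_m) (W : set 'rV[C]_n) f
    (G : 'rV[C]_m -> 'rV[C]_n) : open U -> open W ->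
  (forall x, U x -> W (G x)) -> (forall j, Ck k U (fun x => G x 0 j)) ->
  Ck k W f -> Ck k U (fun x => f (G x)).
Proof.
move=> oU oW UW; elim: k f => [|k IH] f Gk fk.
  move=> x Ux; apply: continuous_comp; last by apply: fk; exact: UW.
  by apply/continuous_rV => j; exact: Gk.
have Gc x : U x -> {for x, continuous G}.
  by move=> Ux; apply/continuous_rV => j; exact: Ck_continuous (Gk j) Ux.
have h v x : U x -> is_rderive (along (fun y => f (G y)) v x) 0
    (\sum_j (dirderive (fun y => G y 0 j) v x * dz j f (G x) +
             (dirderive (fun y => G y 0 j) v x)^* * dzbar j f (G x))).
  move=> Ux; apply: is_rderive_along_comp.
    exact: Ck_C1_near (UW _ Ux) fk.
  by move=> j; apply: is_rderive_derivable (Ck_is_rderive v Ux (Gk j)).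
have Gk' j : Ck k U (fun x => G x 0 j) by exact: CkW.
split=> [x Ux|v].
  apply: continuous_comp; first exact: Gc.
  by apply: Ck_continuous fk _; exact: UW.
split=> [x Ux|]; first exact: is_rderive_derivable (h v x Ux).
have Gv j := ((Gk j).2 v).2.
have fz j : Ck k U (fun x => dz j f (G x)) by apply: IH => //; exact: Ck_dz.
have fzb j : Ck k U (fun x => dzbar j f (G x)) by apply: IH => //;
  exact: Ck_dzbar.
have := Ck_sum (index_enum 'I_n) oU
  (fun j => CkD oU (CkM oU (Gv j) (fz j)) (CkM oU (Ck_conj oU (Gv j)) (fzb j))).
apply: Ck_ext => // x Ux.
by apply/esym; apply: rderive_val (h v x Ux).
Qed.

End Smoothness.

(** * Smooth germs and first order operators *)

Section SmoothGerms.
Variable R : realType.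
Local Notation C := (Cplx R).

(** Smoothness on some neighbourhood, not just at the point, so that the derivatives are again
    smooth there and no domain has to be carried along. *)
Definition smooth_at n (f : 'rV[C]_n -> C) (x : 'rV[C]_n) : Prop :=
  exists U, [/\ open U, U x & smooth U f].

(* First order operators with constant coefficients: the complex span of the
   real directional derivatives. *)
Definition cdir n (L : seq (C * 'rV[C]_n)) (f : 'rV[C]_n -> C) x : C :=
  \sum_(p <- L) p.1 * dirderive f p.2 x.

Lemma all_near (T : topologicalType) (P : T -> Prop) (x : T) :
  (forall y, P y) -> \forall y \near x, P y.
Proof. by move=> h; exact: (filterS (P := setT) (fun y _ => h y) filterT). Qed.

Section OneSpace.
Variable n : nat.
Local Notation V := 'rV[C]_n.
Implicit Types (f g : V -> C) (v x : V) (L : seq (C * V)).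

Lemma smooth_smooth_at U f x : open U -> U x -> smooth U f -> smooth_at f x.
Proof. by move=> oU Ux fU; exists U. Qed.

Lemma smooth_at_smooth (U : set V) f : (forall x, U x -> smooth_at f x) ->
  smooth U f.
Proof.
move=> h k; apply: Ck_pointwise => x /h[W [_ Wx fW]].
by apply: Ck_sub (fW k) => _ ->.
Qed.

Lemma smooth_at_near f x : smooth_at f x -> \forall y \near x, smooth_at f y.
Proof.
move=> [U [oU Ux fU]]; apply: (near_open oU Ux) => y Uy.
exact: smooth_smooth_at fU.
Qed.

Lemma smooth_at_ext f g x : (\forall y \near x, f y = g y) ->
  smooth_at f x -> smooth_at g x.
Proof.
move=> fg [U [oU Ux fU]]; exists (U `&` interior [set y | f y = g y]); split.
- by apply: openI => //; exact: open_interior.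
- by split.
- move=> k; apply: (Ck_ext (f := f)).
  + by apply: openI => //; exact: open_interior.
  + by move=> y [_ /interior_subset].
  + by apply: Ck_sub (fU k) => y [].
Qed.

Lemma smooth_at_continuous f x : smooth_at f x -> {for x, continuous f}.
Proof. by move=> [U [oU Ux fU]]; exact: Ck_continuous (fU 0%N) Ux. Qed.

Lemma smooth_at_C1 f x : smooth_at f x -> C1_near f x.
Proof. by move=> [U [oU Ux fU]]; exact: Ck_C1_near oU Ux (fU 1%N). Qed.

Lemma smooth_at_derivative f v x : smooth_at f x ->
  is_rderive (along f v x) 0 (dirderive f v x).
Proof. by move=> [U [oU Ux fU]]; exact: Ck_is_rderive Ux (fU 1%N). Qed.

Lemma smooth_at_cst (c : C) x : smooth_at (fun _ => c) x.
Proof. by exists setT; split=> //; [exact: openT|move=> k; exact: Ck_cst]. Qed.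

Lemma smooth_at_coord j x : smooth_at (fun y => y 0 j) x.
Proof. by exists setT; split=> //; [exact: openT|move=> k;
  exact: Ck_coord]. Qed.

Lemma smooth_at2 f g x : smooth_at f x -> smooth_at g x ->
  exists U, [/\ open U, U x, smooth U f & smooth U g].
Proof.
move=> [U [oU Ux fU]] [W [oW Wx gW]]; exists (U `&` W); split=> //.
- exact: openI.
- by move=> k; apply: Ck_sub (fU k) => y [].
- by move=> k; apply: Ck_sub (gW k) => y [].
Qed.

Lemma smooth_atD f g x : smooth_at f x -> smooth_at g x ->
  smooth_at (fun y => f y + g y) x.
Proof.
move=> fx gx; have [U [oU Ux fU gU]] := smooth_at2 fx gx.
by exists U; split=> // k; exact: CkD.
Qed.

Lemma smooth_atM f g x : smooth_at f x -> smooth_at g x ->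
  smooth_at (fun y => f y * g y) x.
Proof.
move=> fx gx; have [U [oU Ux fU gU]] := smooth_at2 fx gx.
by exists U; split=> // k; exact: CkM.
Qed.

Lemma smooth_atN f x : smooth_at f x -> smooth_at (fun y => - f y) x.
Proof.
move=> fx; apply: smooth_at_ext (smooth_atM (smooth_at_cst (-1) x) fx).
by apply: all_near => y; rewrite mulN1r.
Qed.

Lemma smooth_at_conj f x : smooth_at f x -> smooth_at (fun y => (f y)^*) x.
Proof. by move=> [U [oU Ux fU]]; exists U; split=> // k; exact: Ck_conj. Qed.

Lemma near_neq0 (T : topologicalType) (f : T -> C) (x : T) :
  {for x, continuous f} -> f x != 0 -> \forall y \near x, f y != 0.
Proof. by move=> fc fx0; exact: (@cvgr_neq0 C C T (nbhs x) _ f (f x)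
  fc fx0). Qed.

Lemma smooth_atV f x : smooth_at f x -> f x != 0 ->
  smooth_at (fun y => (f y)^-1) x.
Proof.
move=> fx fx0; have f0 := near_neq0 (smooth_at_continuous fx) fx0.
move: fx => [U [oU Ux fU]]; exists (U `&` interior [set y | f y != 0]); split.
- by apply: openI => //; exact: open_interior.
- by split.
- move=> k; apply: CkV.
  + by apply: openI => //; exact: open_interior.
  + by move=> y [_ /interior_subset].
  + by apply: Ck_sub (fU k) => y [].
Qed.

Lemma smooth_at_sum (I : Type) (r : seq I) (P : pred I) (F : I -> V -> C) x :
  (forall i, smooth_at (F i) x) ->
    smooth_at (fun y => \sum_(i <- r | P i) F i y) x.
Proof.
move=> Fx; elim: r => [|i r IH].
  by apply: smooth_at_ext (smooth_at_cst 0 x); apply: all_near => y;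
    rewrite big_nil.
case Pi: (P i).
  apply: smooth_at_ext (smooth_atD (Fx i) IH).
  by apply: all_near => y; rewrite big_cons Pi.
by apply: smooth_at_ext IH; apply: all_near => y; rewrite big_cons Pi.
Qed.

Lemma smooth_at_prod (I : Type) (r : seq I) (F : I -> V -> C) x :
  (forall i, smooth_at (F i) x) -> smooth_at (fun y => \prod_(i <- r) F i y) x.
Proof.
move=> Fx; elim: r => [|i r IH].
  by apply: smooth_at_ext (smooth_at_cst 1 x); apply: all_near => y;
    rewrite big_nil.
apply: smooth_at_ext (smooth_atM (Fx i) IH).
by apply: all_near => y; rewrite big_cons.
Qed.

Lemma smooth_at_dirderive f v x : smooth_at f x -> smooth_at (dirderive f v) x.
Proof.
move=> [U [oU Ux fU]]; exists U; split=> // k.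
by have [_ h] := fU k.+1; exact: (h v).2.
Qed.

Lemma cdir_smooth L f x : smooth_at f x -> smooth_at (cdir L f) x.
Proof.
move=> fx; apply: smooth_at_sum => p; apply: smooth_atM;
  first exact: smooth_at_cst.
exact: smooth_at_dirderive.
Qed.

Lemma cdir_near L f g x : (\forall y \near x, f y = g y) ->
  cdir L f x = cdir L g x.
Proof. by move=> fg; apply: eq_bigr => p _; congr (_ * _);
  exact: dirderive_near. Qed.

Lemma dirderive_cst (c : C) v x : dirderive (fun _ => c) v x = 0.
Proof. by apply: rderive_val; exact: is_rderive_cst. Qed.

Lemma dirderiveD f g v x : smooth_at f x -> smooth_at g x ->
  dirderive (fun y => f y + g y) v x = dirderive f v x + dirderive g v x.
Proof.
move=> fx gx; apply: rderive_val.
exact: is_rderiveD (smooth_at_derivative v fx) (smooth_at_derivative v gx).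
Qed.

Lemma dirderiveM f g v x : smooth_at f x -> smooth_at g x ->
  dirderive (fun y => f y * g y) v x =
  dirderive f v x * g x + f x * dirderive g v x.
Proof.
move=> fx gx; apply: rderive_val; rewrite -(along0 g v x) -(along0 f v x).
exact: is_rderiveM (smooth_at_derivative v fx) (smooth_at_derivative v gx).
Qed.

Lemma dirderive_conj f v x : smooth_at f x ->
  dirderive (fun y => (f y)^*) v x = (dirderive f v x)^*.
Proof.
move=> fx; apply: rderive_val.
exact: is_rderive_conj (smooth_at_derivative v fx).
Qed.

Lemma cdir_cst L (c : C) x : cdir L (fun _ => c) x = 0.
Proof. by apply: big1 => p _; rewrite dirderive_cst mulr0. Qed.

Lemma cdirD L f g x : smooth_at f x -> smooth_at g x ->
  cdir L (fun y => f y + g y) x = cdir L f x + cdir L g x.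
Proof.
move=> fx gx; rewrite -big_split; apply: eq_bigr => p _ /=.
by rewrite dirderiveD// mulrDr.
Qed.

Lemma cdirM L f g x : smooth_at f x -> smooth_at g x ->
  cdir L (fun y => f y * g y) x = cdir L f x * g x + f x * cdir L g x.
Proof.
move=> fx gx; rewrite /cdir big_distrl big_distrr -big_split.
apply: eq_bigr => p _ /=; rewrite dirderiveM//; ring.
Qed.

Lemma cdir_sum L (I : Type) (r : seq I) (F : I -> V -> C) x :
  (forall i, smooth_at (F i) x) ->
  cdir L (fun y => \sum_(i <- r) F i y) x = \sum_(i <- r) cdir L (F i) x.
Proof.
move=> Fx; elim: r => [|i r IH].
  rewrite big_nil; apply: etrans (cdir_cst L 0 x); apply: cdir_near.
  by apply: all_near => y; rewrite big_nil.
rewrite big_cons -IH -(cdirD _ (Fx i) (smooth_at_sum r xpredT Fx)).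
by apply: cdir_near; apply: all_near => y; rewrite big_cons.
Qed.

Lemma cdirN L f x : smooth_at f x -> cdir L (fun y => - f y) x = - cdir L f x.
Proof.
move=> fx; have := cdirM L (smooth_at_cst (-1) x) fx.
rewrite cdir_cst mul0r add0r mulN1r => <-.
by apply: cdir_near; apply: all_near => y; rewrite mulN1r.
Qed.

Lemma continuous_eq (T T' : topologicalType) (f g : T -> T') (x : T) : f = g ->
  {for x, continuous f} -> {for x, continuous g}.
Proof. by move=> ->. Qed.

Lemma complex_eta (z : C) : z = (complex.Re z +i* complex.Im z)%C.
Proof. by case: z. Qed.

Lemma dirderiveC f v w x : smooth_at f x ->
  dirderive (dirderive f v) w x = dirderive (dirderive f w) v x.
Proof.
move=> [U [oU Ux fU]].
have dd (a b : V) : [/\ forall y, U y -> rderivable (along f a y) 0,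
   forall y, U y -> rderivable (along (dirderive f a) b y) 0 &
   {for x, continuous (dirderive (dirderive f a) b)}].
  have [_ /(_ a)[h1 [_ /(_ b)[h2 h3]]]] := fU 2.
  by split; [exact: h1|exact: h2|exact: (h3 x Ux)].
have [v1 v2 v3] := dd v w; have [w1 w2 w3] := dd w v.
have ER (a b : V) : (fun y => complex.Re (dirderive (dirderive f a) b y)) =
    realdir (realdir (fun y => complex.Re (f y)) a) b.
  by rewrite (Re_dirderive (dirderive f a) b) (Re_dirderive f a).
have EI (a b : V) : (fun y => complex.Im (dirderive (dirderive f a) b y)) =
    realdir (realdir (fun y => complex.Im (f y)) a) b.
  by rewrite (Im_dirderive (dirderive f a) b) (Im_dirderive f a).
have E (a b : V) : dirderive (dirderive f a) b x =
    (realdir (realdir (fun y => complex.Re (f y)) a) b x +i*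
     realdir (realdir (fun y => complex.Im (f y)) a) b x)%C.
  by rewrite -ER -EI; exact: complex_eta.
have vc := (continuous_Cplx (dirderive (dirderive f v) w) x).1 v3.
have wc := (continuous_Cplx (dirderive (dirderive f w) v) x).1 w3.
have [vrc vic] := (continuous_eq (ER v w) vc.1, continuous_eq (EI v w) vc.2).
have [wrc wic] := (continuous_eq (ER w v) wc.1, continuous_eq (EI w v) wc.2).
have nd (a b : V) : (forall y, U y -> rderivable (along f a y) 0) ->
    (forall y, U y -> rderivable (along (dirderive f a) b y) 0) ->
    (\forall y \near x, realdirable (fun y => complex.Re (f y)) a y /\
      realdirable (realdir (fun y => complex.Re (f y)) a) b y) /\
    (\forall y \near x, realdirable (fun y => complex.Im (f y)) a y /\
      realdirable (realdir (fun y => complex.Im (f y)) a) b y).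
  move=> a1 a2; split; apply: (near_open oU Ux) => y Uy.
    rewrite -(Re_dirderive f a).
    by split; [exact: (a1 y Uy).1|exact: (a2 y Uy).1].
  rewrite -(Im_dirderive f a).
  by split; [exact: (a1 y Uy).2|exact: (a2 y Uy).2].
have [vr vi] := nd _ _ v1 v2; have [wr wi] := nd _ _ w1 w2.
rewrite (E v w) (E w v).
by rewrite (realdirC vr wr vrc wrc) (realdirC vi wi vic wic).
Qed.

(** By bilinearity this is [dirderiveC]. On C^(d+n) it provides the exchange of d/ds with dbar. *)
Lemma cdirC L L' f x : smooth_at f x ->
  cdir L (cdir L' f) x = cdir L' (cdir L f) x.
Proof.
have E K K' : smooth_at f x -> cdir K (cdir K' f) x =
    \sum_(p <- K) \sum_(q <- K') p.1 * (q.1 * dirderive (dirderive f q.2)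
      p.2 x).
  move=> fx; rewrite /cdir; apply: eq_bigr => p _; rewrite -mulr_sumr;
    congr (_ * _).
  have := @cdir_sum [:: (1, p.2)] _ K' (fun q y => q.1 * dirderive f q.2 y) x.
  rewrite {1}/cdir big_seq1 mul1r => -> => [|q]; last first.
    apply: smooth_atM; first exact: smooth_at_cst.
    exact: smooth_at_dirderive.
  apply: eq_bigr => q _; rewrite /cdir big_seq1 mul1r dirderiveM.
  - by rewrite dirderive_cst mul0r add0r.
  - exact: smooth_at_cst.
  - exact: smooth_at_dirderive.
move=> fx; rewrite !E// exchange_big; apply: eq_bigr => q _;
  apply: eq_bigr => p _.
by rewrite dirderiveC// mulrCA.
Qed.

Definition dz_op (j : 'I_n) : seq (C * V) :=
  [:: (2^-1, delta_mx 0 j); (- 'i / 2, 'i *: delta_mx 0 j)].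

Definition dzbar_op (j : 'I_n) : seq (C * V) :=
  [:: (2^-1, delta_mx 0 j); ('i / 2, 'i *: delta_mx 0 j)].

Lemma dzE j f x : dz j f x = cdir (dz_op j) f x.
Proof.
rewrite /dz /cdir big_cons big_seq1 /=.
move: (dirderive f (delta_mx 0 j) x) (dirderive f ('i *: delta_mx 0 j) x) =>
  A B.
by rewrite mulrBl !mulNr (mulrC _^-1) mulrAC.
Qed.

Lemma dzbarE j f x : dzbar j f x = cdir (dzbar_op j) f x.
Proof.
rewrite /dzbar /cdir big_cons big_seq1 /=.
move: (dirderive f (delta_mx 0 j) x) (dirderive f ('i *: delta_mx 0 j) x) =>
  A B.
by rewrite mulrDl (mulrC _^-1) mulrAC.
Qed.

Lemma dirderive_wirtinger f v x : smooth_at f x ->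
  dirderive f v x = \sum_j (v 0 j * dz j f x + (v 0 j)^* * dzbar j f x).
Proof.
move=> fx; apply: rderive_val; have fx1 := smooth_at_C1 fx.
have := @is_rderive_comp R n f (fun s => x + rtoc s *: v) v.
rewrite line0 => /(_ fx1); apply => j.
exact: is_rderive_coord.
Qed.

(** Additivity in the direction is no part of the definition of a directional derivative; it comes
    from the chain rule, through the expression by [dz] and [dzbar]. *)
Lemma dirderive_addr f v w x : smooth_at f x ->
  dirderive f (v + w) x = dirderive f v x + dirderive f w x.
Proof.
move=> fx; rewrite !dirderive_wirtinger// -big_split; apply: eq_bigr => j _ /=.
by rewrite !mxE rmorphD /=; ring.
Qed.

End OneSpace.

Section Composition.
Variables (m n : nat) (f : 'rV[C]_n -> C) (G : 'rV[C]_m -> 'rV[C]_n).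
Variable x : 'rV[C]_m.
Hypothesis Gx : forall j, smooth_at (fun y => G y 0 j) x.

Lemma smooth_at_rV_continuous : {for x, continuous G}.
Proof. by apply/continuous_rV => j; exact: smooth_at_continuous. Qed.

Lemma smooth_at_comp : smooth_at f (G x) -> smooth_at (fun y => f (G y)) x.
Proof.
move=> [W [oW Wx fW]].
have GW : \forall y \near x, W (G y).
  exact: (smooth_at_rV_continuous (open_nbhs_nbhs (conj oW Wx))).
have Gn : \forall y \near x, forall j, smooth_at (fun y => G y 0 j) y.
  have h j := smooth_at_near (Gx j).
  exact: (@filter_forall 'rV[C]_m 'I_n (fun j y => smooth_at (fun z =>
    G z 0 j) y) (nbhs x) _ h).
(* One open set has to serve for all components of G and for the condition that G y stays in W. *)
exists (interior [set y | W (G y) /\ forall j, smooth_at (fun y => G y 0 j) y]).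
split; [exact: open_interior|by apply: filterI|].
move=> k; apply: (Ck_comp (W := W)) => //; first exact: open_interior.
  by move=> y /interior_subset[].
move=> j; apply: (smooth_at_smooth (U := interior _)).
by move=> y /interior_subset[].
Qed.

Hypothesis fx : smooth_at f (G x).

(** The second factor is the derivative of the conjugate component and not the conjugate of the
    derivative: in this form the rule extends linearly to operators with complex coefficients. *)
Lemma dirderive_comp v : dirderive (fun y => f (G y)) v x =
  \sum_j (dirderive (fun y => G y 0 j) v x * dz j f (G x) +
          dirderive (fun y => (G y 0 j)^*) v x * dzbar j f (G x)).
Proof.
have h : is_rderive (along (fun y => f (G y)) v x) 0
    (\sum_j (dirderive (fun y => G y 0 j) v x * dz j f (G x) +
             (dirderive (fun y => G y 0 j) v x)^* * dzbar j f (G x))).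
  apply: is_rderive_along_comp; first exact: smooth_at_C1.
  by move=> j; apply: is_rderive_derivable (smooth_at_derivative v (Gx j)).
apply: etrans (rderive_val h) _; apply: eq_bigr => j _.
by rewrite dirderive_conj.
Qed.

Lemma cdir_comp L : cdir L (fun y => f (G y)) x =
  \sum_j (cdir L (fun y => G y 0 j) x * dz j f (G x) +
          cdir L (fun y => (G y 0 j)^*) x * dzbar j f (G x)).
Proof.
rewrite /cdir; under eq_bigr do rewrite dirderive_comp mulr_sumr.
rewrite exchange_big; apply: eq_bigr => j _ /=.
by rewrite !mulr_suml -big_split; apply: eq_bigr => p _ /=; ring.
Qed.

End Composition.

End SmoothGerms.

(** * Smooth matrices and their derivatives, in particular those of the inverse *)

Section MatrixGerms.
Variables (R : realType) (n : nat).
Local Notation C := (Cplx R).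
Local Notation V := 'rV[C]_n.
Implicit Types (x : V) (L : seq (C * V)).

Definition smooth_mx_at p q (M : V -> 'M[C]_(p, q)) x : Prop :=
  forall k l, smooth_at (fun y => M y k l) x.

Definition cdir_mx L p q (M : V -> 'M[C]_(p, q)) x : 'M[C]_(p, q) :=
  \matrix_(k, l) cdir L (fun y => M y k l) x.

Lemma smooth_at_eq f g x : f =1 g -> smooth_at f x -> smooth_at g x.
Proof. by move=> fg; apply: smooth_at_ext; exact: all_near. Qed.

Lemma cdir_eq L f g x : f =1 g -> cdir L f x = cdir L g x.
Proof. by move=> fg; apply: cdir_near; exact: all_near. Qed.

Lemma smooth_mx_ext p q (M N : V -> 'M[C]_(p, q)) x :
  (\forall y \near x, M y = N y) -> smooth_mx_at M x -> smooth_mx_at N x.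
Proof.
move=> MN Mx k l; apply: smooth_at_ext (Mx k l).
by apply: filterS MN => y ->.
Qed.

Lemma smooth_mx_cst p q (M : 'M[C]_(p, q)) x : smooth_mx_at (fun _ => M) x.
Proof. by move=> k l; exact: smooth_at_cst. Qed.

Lemma smooth_mxD p q (M N : V -> 'M[C]_(p, q)) x :
  smooth_mx_at M x -> smooth_mx_at N x -> smooth_mx_at (fun y => M y + N y) x.
Proof.
move=> Mx Nx k l; apply: (smooth_at_eq _ (smooth_atD (Mx k l) (Nx k l))) => y.
by rewrite mxE.
Qed.

Lemma smooth_mxN p q (M : V -> 'M[C]_(p, q)) x :
  smooth_mx_at M x -> smooth_mx_at (fun y => - M y) x.
Proof.
by move=> Mx k l; apply: (smooth_at_eq _ (smooth_atN (Mx k l))) => y;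
  rewrite mxE.
Qed.

Lemma smooth_mxB p q (M N : V -> 'M[C]_(p, q)) x :
  smooth_mx_at M x -> smooth_mx_at N x -> smooth_mx_at (fun y => M y - N y) x.
Proof. by move=> Mx Nx; apply: smooth_mxD => //; exact: smooth_mxN. Qed.

Lemma smooth_mxM p q r (M : V -> 'M[C]_(p, q)) (N : V -> 'M[C]_(q, r)) x :
  smooth_mx_at M x -> smooth_mx_at N x -> smooth_mx_at (fun y => M y *m N y) x.
Proof.
move=> Mx Nx k l; have h := @smooth_at_sum R n 'I_q (index_enum 'I_q) xpredT
  (fun j y => M y k j * N y j l) x (fun j => smooth_atM (Mx k j) (Nx j l)).
by apply: (smooth_at_eq _ h) => y; rewrite mxE.
Qed.

Lemma smooth_mxZ p q (c : V -> C) (M : V -> 'M[C]_(p, q)) x :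
  smooth_at c x -> smooth_mx_at M x -> smooth_mx_at (fun y => c y *: M y) x.
Proof.
move=> cx Mx k l; apply: (smooth_at_eq _ (smooth_atM cx (Mx k l))) => y.
by rewrite mxE.
Qed.

Lemma smooth_mx_sum p q (I : finType) (F : I -> V -> 'M[C]_(p, q)) x :
  (forall i, smooth_mx_at (F i) x) -> smooth_mx_at (fun y => \sum_i F i y) x.
Proof.
move=> Fx k l; have h := @smooth_at_sum R n I (index_enum I) xpredT
  (fun i y => F i y k l) x (fun i => Fx i k l).
by apply: (smooth_at_eq _ h) => y; rewrite summxE.
Qed.

Lemma smooth_at_det p (M : V -> 'M[C]_p) x :
  smooth_mx_at M x -> smooth_at (fun y => \det (M y)) x.
Proof.
move=> Mx; apply: smooth_at_sum => s; apply: smooth_atM;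
  first exact: smooth_at_cst.
by apply: smooth_at_prod => i; exact: Mx.
Qed.

(** Cramer's rule, which applies near x because the determinant is continuous and nonzero at x. *)
Lemma smooth_mx_inv p (M : V -> 'M[C]_p) x : M x \in unitmx ->
  smooth_mx_at M x -> smooth_mx_at (fun y => invmx (M y)) x.
Proof.
move=> Mu Mx; have dx := smooth_at_det Mx.
have d0 : \det (M x) != 0 by rewrite unitmxE unitfE in Mu.
apply: (smooth_mx_ext (M := fun y => (\det (M y))^-1 *: \adj (M y))).
  have := near_neq0 (smooth_at_continuous dx) d0; apply: filterS => y dy.
  by rewrite /invmx unitmxE unitfE dy.
apply: smooth_mxZ; first exact: smooth_atV.
move=> k l; apply: (smooth_at_eq (f := fun y => cofactor (M y) l k)).
  by move=> y; rewrite mxE.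
apply: smooth_atM; first exact: smooth_at_cst.
apply: (smooth_at_det (M := fun y => row' l (col' k (M y)))) => i j.
by apply: (smooth_at_eq _ (Mx (lift l i) (lift k j))) => y; rewrite !mxE.
Qed.

Lemma near_unitmx p (M : V -> 'M[C]_p) x : M x \in unitmx ->
  smooth_mx_at M x -> \forall y \near x, M y \in unitmx.
Proof.
move=> Mu Mx; have d0 : \det (M x) != 0 by rewrite unitmxE unitfE in Mu.
have := near_neq0 (smooth_at_continuous (smooth_at_det Mx)) d0.
by apply: filterS => y dy; rewrite unitmxE unitfE.
Qed.

Lemma cdir_mx_near L p q (M N : V -> 'M[C]_(p, q)) x :
  (\forall y \near x, M y = N y) -> cdir_mx L M x = cdir_mx L N x.
Proof.
move=> MN; apply/matrixP => k l; rewrite !mxE; apply: cdir_near.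
by apply: filterS MN => y ->.
Qed.

Lemma cdir_mx_smooth L p q (M : V -> 'M[C]_(p, q)) x :
  smooth_mx_at M x -> smooth_mx_at (cdir_mx L M) x.
Proof.
move=> Mx k l; apply: (smooth_at_eq _ (cdir_smooth L (Mx k l))) => y.
by rewrite mxE.
Qed.

Lemma cdir_mx_cst L p q (M : 'M[C]_(p, q)) x : cdir_mx L (fun _ => M) x = 0.
Proof. by apply/matrixP => k l; rewrite !mxE cdir_cst. Qed.

Lemma cdir_mxD L p q (M N : V -> 'M[C]_(p, q)) x :
  smooth_mx_at M x -> smooth_mx_at N x ->
  cdir_mx L (fun y => M y + N y) x = cdir_mx L M x + cdir_mx L N x.
Proof.
move=> Mx Nx; apply/matrixP => k l.
rewrite !mxE -(cdirD _ (Mx k l) (Nx k l)).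
by apply: cdir_eq => y; rewrite mxE.
Qed.

Lemma cdir_mxN L p q (M : V -> 'M[C]_(p, q)) x :
  smooth_mx_at M x -> cdir_mx L (fun y => - M y) x = - cdir_mx L M x.
Proof.
move=> Mx; apply/matrixP => k l; rewrite !mxE -(cdirN _ (Mx k l)).
by apply: cdir_eq => y; rewrite mxE.
Qed.

Lemma cdir_mxB L p q (M N : V -> 'M[C]_(p, q)) x :
  smooth_mx_at M x -> smooth_mx_at N x ->
  cdir_mx L (fun y => M y - N y) x = cdir_mx L M x - cdir_mx L N x.
Proof. by move=> Mx Nx; rewrite cdir_mxD ?cdir_mxN//; exact: smooth_mxN. Qed.

Lemma cdir_mxM L p q r (M : V -> 'M[C]_(p, q)) (N : V -> 'M[C]_(q, r)) x :
  smooth_mx_at M x -> smooth_mx_at N x ->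
  cdir_mx L (fun y => M y *m N y)
    x = cdir_mx L M x *m N x + M x *m cdir_mx L N x.
Proof.
move=> Mx Nx; apply/matrixP => k l; rewrite !mxE.
rewrite (@cdir_eq L _ (fun y => \sum_j M y k j * N y j l)); last by move=> y;
  rewrite mxE.
rewrite cdir_sum => [|j]; last exact: smooth_atM.
rewrite -big_split; apply: eq_bigr => j _ /=.
by rewrite cdirM// !mxE.
Qed.

Lemma cdir_mxZ L p q (c : V -> C) (M : V -> 'M[C]_(p, q)) x :
  smooth_at c x -> smooth_mx_at M x ->
  cdir_mx L (fun y => c y *: M y) x = cdir L c x *: M x + c x *: cdir_mx L M x.
Proof.
move=> cx Mx; apply/matrixP => k l; rewrite !mxE -(cdirM _ cx (Mx k l)).
by apply: cdir_eq => y; rewrite mxE.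
Qed.

Lemma cdir_mx_sum L p q (I : finType) (F : I -> V -> 'M[C]_(p, q)) x :
  (forall i, smooth_mx_at (F i) x) ->
  cdir_mx L (fun y => \sum_i F i y) x = \sum_i cdir_mx L (F i) x.
Proof.
move=> Fx; apply/matrixP => k l; rewrite !mxE summxE.
rewrite (@cdir_eq L _ (fun y => \sum_i F i y k l)); last by move=> y;
  rewrite summxE.
rewrite cdir_sum => [|i]; last exact: Fx.
by apply: eq_bigr => i _; rewrite mxE.
Qed.

Lemma cdir_mxC L L' p q (M : V -> 'M[C]_(p, q)) x : smooth_mx_at M x ->
  cdir_mx L (cdir_mx L' M) x = cdir_mx L' (cdir_mx L M) x.
Proof.
move=> Mx; apply/matrixP => k l; rewrite !mxE.
have E K : cdir_mx K M ^~ k ^~ l =1 cdir K (fun y => M y k l).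
  by move=> y; rewrite mxE.
rewrite (cdir_eq L (g := cdir L' (fun y => M y k l))); last exact: E.
by rewrite cdirC// (cdir_eq L' (g := cdir L (fun y => M y k l)))//; exact: E.
Qed.

(** The identity M^-1 M = 1 holds near x and can be differentiated. *)
Lemma cdir_mx_inv L p (M : V -> 'M[C]_p) x : M x \in unitmx ->
  smooth_mx_at M x ->
  cdir_mx L (fun y => invmx (M y)) x =
  - (invmx (M x) *m cdir_mx L M x *m invmx (M x)).
Proof.
move=> Mu Mx; have Nx := smooth_mx_inv Mu Mx.
have : cdir_mx L (fun y => invmx (M y) *m M y) x = 0.
  apply: etrans (cdir_mx_cst L 1%:M x); apply: cdir_mx_near.
  by have := near_unitmx Mu Mx; apply: filterS => y My; rewrite mulVmx.
rewrite cdir_mxM// => /(congr1 (mulmx^~ (invmx (M x)))).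
rewrite mul0mx mulmxDl mulmxK// => /eqP.
by rewrite addr_eq0 => /eqP.
Qed.

End MatrixGerms.

(** * Time and space directions in C^(d+n) *)

Section Slices.
Variables (R : realType) (d n : nat).
Local Notation C := (Cplx R).
Implicit Types (f : 'rV[C]_(d + n) -> C) (t u : 'rV[C]_d) (z : 'rV[C]_n).

Definition slice_op (L : seq (C * 'rV[C]_n)) : seq (C * 'rV[C]_(d + n)) :=
  [seq (p.1, row_mx 0 p.2) | p <- L].

Lemma smooth_at_slice f t z : smooth_at f (row_mx t z) ->
  smooth_at (fun y => f (row_mx t y)) z.
Proof.
move=> fx; apply: smooth_at_comp fx => j; case: (fintype.split_ordP j) => k ->.
  by apply: (smooth_at_eq _ (smooth_at_cst (t 0 k) z)) => y; rewrite row_mxEl.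
by apply: (smooth_at_eq _ (smooth_at_coord k z)) => y; rewrite row_mxEr.
Qed.

Lemma dirderive_slice f t v z :
  dirderive (fun y => f (row_mx t y)) v z = dirderive f (row_mx 0 v)
    (row_mx t z).
Proof.
rewrite /dirderive; congr (rderive _ 0); apply/funext => s; rewrite /along.
by rewrite scale_row_mx scaler0 add_row_mx addr0.
Qed.

Lemma cdir_slice L f t z :
  cdir L (fun y => f (row_mx t y)) z = cdir (slice_op L) f (row_mx t z).
Proof.
rewrite /cdir big_map; apply: eq_bigr => p _.
by rewrite dirderive_slice.
Qed.

(** The time derivative becomes an operator with constant coefficients on C^(d+n), of the same kind
    as those of [slice_op]; hence it commutes with them. *)
Lemma rderive_slice f u z :
  rderive (fun s => f (row_mx (rtoc s *: u) z)) 0 =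
  cdir [:: (1, row_mx u 0)] f (row_mx 0 z).
Proof.
rewrite /cdir big_seq1 mul1r /dirderive; congr (rderive _ 0).
apply/funext => s; rewrite /along.
by rewrite scale_row_mx scaler0 add_row_mx addr0 add0r.
Qed.

End Slices.

(** * Smooth functions and maps on manifolds *)

Section ManifoldGerms.
Variable R : realType.
Local Notation C := (Cplx R).

(** The part of the manifold axioms that allows functions and maps to be read in charts; it is what
    is proved of the product of time and X. *)
Definition charted n (X : atlased R n) : Prop :=
  (forall a, atlas X a -> is_chart a) /\
  (forall x : X, exists2 a, atlas X a & cdom a x).

Definition smooth_fun_at n (X : atlased R n) (f : X -> C) (x : X) : Prop :=
  forall a, atlas X a -> cdom a x ->
    smooth_at (fun z => f (cinv a z)) (cmap a x).

Definition smooth_map_at m n (X : atlased R m) (Y : atlased R n) (F : X -> Y)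
    (x : X) : Prop :=
  {for x, continuous F} /\
  forall b, atlas Y b -> cdom b (F x) -> forall j,
    smooth_fun_at (fun y => cmap b (F y) 0 j) x.

Lemma complex_manifold_charted n (X : atlased R n) :
  complex_manifold X -> charted X.
Proof. by case. Qed.

Section Charts.
Variables (n : nat) (X : atlased R n).
Hypothesis X_charted : charted X.
Implicit Types (a : chart R X n) (f g : X -> C) (x : X) (O : set X).

Lemma chartK a x : atlas X a -> cdom a x -> cinv a (cmap a x) = x.
Proof. by move=> aX ax; have [_ _ h _ _] := X_charted.1 _ aX; exact: h. Qed.

Lemma cdom_open a : atlas X a -> open (cdom a).
Proof. by move=> aX; have [] := X_charted.1 _ aX. Qed.

Lemma near_cdom a x : atlas X a -> cdom a x -> \forall y \near x, cdom a y.
Proof. by move=> aX ax; exact: (near_open (cdom_open aX) ax). Qed.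

Lemma chart_near a x (P : X -> Prop) : atlas X a -> cdom a x ->
  (\forall y \near x, P y) -> \forall z \near cmap a x, P (cinv a z).
Proof.
move=> aX ax Px; have [_ _ _ _ ic] := X_charted.1 _ aX.
have h : {for cmap a x, continuous (cinv a)} by apply: ic; exists x.
by apply: h; rewrite chartK.
Qed.

Lemma cinvK_near a x : atlas X a -> cdom a x ->
  \forall z \near cmap a x, cdom a (cinv a z) /\ cmap a (cinv a z) = z.
Proof.
move=> aX ax; have [_ io _ _ _] := X_charted.1 _ aX.
have xi : (cmap a @` cdom a) (cmap a x) by exists x.
apply: (near_open io xi) => z [y ay <-].
by rewrite chartK.
Qed.

Lemma chart_image_open a O : atlas X a -> open O ->
  open (cmap a @` (cdom a `&` O)).
Proof.
move=> aX oO; rewrite openE => z [x [ax Ox] <-]; rewrite /interior /=.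
have h1 := chart_near aX ax (open_nbhs_nbhs (conj oO Ox)).
have h2 := cinvK_near aX ax.
by apply: filterS2 h1 h2 => y Oy [ay <-]; exists (cinv a y).
Qed.

Lemma regular_smooth_fun_at O f x : open O ->
  regular_fun (@smooth R) O f -> O x -> smooth_fun_at f x.
Proof.
move=> oO fO Ox a aX ax; apply: (smooth_smooth_at (U :=
  cmap a @` (cdom a `&` O))).
- exact: chart_image_open.
- by exists x.
- exact: fO.
Qed.

Lemma smooth_fun_at_regular O f : (forall x, O x -> smooth_fun_at f x) ->
  regular_fun (@smooth R) O f.
Proof.
by move=> fO a aX; apply: smooth_at_smooth => z [x [ax Ox] <-]; exact: fO.
Qed.

Lemma smooth_fun_at_ext f g x : (\forall y \near x, f y = g y) ->
  smooth_fun_at f x -> smooth_fun_at g x.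
Proof.
move=> fg fx a aX ax; apply: smooth_at_ext (fx a aX ax).
exact: chart_near aX ax fg.
Qed.

Lemma holomorphic_smooth_fun_at O f x : open O ->
  regular_fun (@holomorphic R) O f -> O x -> smooth_fun_at f x.
Proof. by move=> oO fO; apply: (regular_smooth_fun_at oO) => a /fO[]. Qed.

Lemma holomorphic_dzbar O f x a j : regular_fun (@holomorphic R) O f -> O x ->
  atlas X a -> cdom a x -> dzbar j (fun z => f (cinv a z)) (cmap a x) = 0.
Proof. by move=> fO Ox aX ax; have [_ h] := fO a aX; apply: h; exists x. Qed.

End Charts.

Section Maps.
Variables (m n : nat) (X : atlased R m) (Y : atlased R n).
Hypothesis (X_charted : charted X) (Y_charted : charted Y).
Variable F : X -> Y.

Lemma regular_smooth_map_at O x : open O -> regular_map (@smooth R) O F ->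
  O x -> smooth_map_at F x.
Proof.
move=> oO [Fc Fs] Ox; split; first exact: Fc.
move=> b bY bFx j a aX ax.
apply: (smooth_smooth_at (U := cmap a @` (cdom a `&` O `&` F @^-1` cdom b))).
- rewrite -setIA; apply: chart_image_open => //.
  rewrite openE => y [Oy bFy]; rewrite /interior; apply: filterI.
    exact: open_nbhs_nbhs.
  exact: (Fc y Oy _ (open_nbhs_nbhs (conj (cdom_open Y_charted bY) bFy))).
- by exists x.
- exact: Fs.
Qed.

Lemma smooth_fun_at_comp f x : smooth_map_at F x -> smooth_fun_at f (F x) ->
  smooth_fun_at (fun y => f (F y)) x.
Proof.
move=> [Fc Fs] fFx a aX ax; have [b bY bFx] := Y_charted.2 (F x).
have E : \forall z \near cmap a x,
    f (cinv b (cmap b (F (cinv a z)))) = f (F (cinv a z)).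
  apply: (chart_near X_charted aX ax (P :=
    fun y => f (cinv b (cmap b (F y))) = f (F y))).
  have h : \forall y \near x, cdom b (F y) := Fc _ (near_cdom Y_charted bY bFx).
  by apply: filterS h => y by_; rewrite chartK.
apply: smooth_at_ext E _.
apply: (smooth_at_comp (G := fun z => cmap b (F (cinv a z)))
         (f := fun z => f (cinv b z))).
  by move=> j; exact: Fs.
by rewrite (chartK X_charted)//; exact: fFx.
Qed.

(* The conditions [cdir L (cmap b \o F) = 0] say that the image of L under F
   is of type (0,1). *)
Lemma holomorphic_pullback (O : set Y) (f : Y -> C) x L a b : open O ->
  regular_fun (@holomorphic R) O f -> O (F x) -> smooth_map_at F x ->
  atlas X a -> cdom a x -> atlas Y b -> cdom b (F x) ->
  (forall k, cdir L (fun z => cmap b (F (cinv a z)) 0 k) (cmap a x) = 0) ->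
  cdir L (fun z => f (F (cinv a z))) (cmap a x) = 0.
Proof.
move=> oO fO OFx [Fc Fs] aX ax bY bFx L0.
have E : \forall z \near cmap a x,
    f (F (cinv a z)) = f (cinv b (cmap b (F (cinv a z)))).
  apply: (chart_near X_charted aX ax (P :=
    fun y => f (F y) = f (cinv b (cmap b (F y))))).
  have h : \forall y \near x, cdom b (F y) := Fc _ (near_cdom Y_charted bY bFx).
  by apply: filterS h => y by_; rewrite chartK.
rewrite (cdir_near L E).
rewrite (@cdir_comp R _ _ (fun z => f (cinv b z)) (fun z =>
  cmap b (F (cinv a z)))).
- apply: big1 => k _; rewrite L0 mul0r add0r (chartK X_charted)//.
  by rewrite (holomorphic_dzbar _ fO OFx bY bFx) mulr0.
- by move=> j; exact: Fs.
- rewrite (chartK X_charted)//.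
  exact: (holomorphic_smooth_fun_at Y_charted oO fO OFx).
Qed.

End Maps.

Lemma smooth_map_at_comp m n p (X : atlased R m) (Y : atlased R n)
    (Z : atlased R p) (F : X -> Y) (G : Y -> Z) x :
  charted X -> charted Y -> smooth_map_at F x -> smooth_map_at G (F x) ->
  smooth_map_at (fun y => G (F y)) x.
Proof.
move=> Xc Yc Fx [Gc Gs]; split; first exact: continuous_comp Fx.1 Gc.
move=> b bZ bx j.
by apply: (smooth_fun_at_comp Xc Yc (f := fun y => cmap b (G y) 0 j)) => //;
  exact: Gs.
Qed.

Lemma holomorphic_regular_map m n (X : atlased R m) (Y : atlased R n) O
    (F : X -> Y) :
  regular_map (@holomorphic R) O F -> regular_map (@smooth R) O F.
Proof. by case=> Fc Fs; split=> // a b aX bY j; have [] := Fs a b aX bY j. Qed.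

Lemma cmap_smooth_fun_at n (X : atlased R n) b j x : complex_manifold X ->
  atlas X b -> cdom b x -> smooth_fun_at (fun y => cmap b y 0 j) x.
Proof.
move=> Xm bX bx a aX ax; have Xc := complex_manifold_charted Xm.
have [_ _ _ _ tr] := Xm.
apply: (smooth_smooth_at (U := cmap a @` (cdom a `&` cdom b))).
- by apply: (chart_image_open Xc) => //; exact: cdom_open.
- by exists x.
- by have [] := tr a b aX bX j.
Qed.

Section Products.
Variables (d n : nat) (X : atlased R n).
Local Notation W := (prod_atlased (Cspace R d) X).

Definition time_chart (a : chart R X n) : chart R W (d + n) :=
  prod_chart (Chart setT id id) a.

Lemma time_chart_atlas a : atlas X a -> atlas W (time_chart a).
Proof. by move=> aX; exists (Chart setT id id), a. Qed.

Lemma atlas_time_chart c : atlas W c -> exists2 a, atlas X a & c = time_chart a.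
Proof. by move=> [_ [a [-> aX ->]]]; exists a. Qed.

Lemma time_chart_is_chart a : is_chart a -> is_chart (time_chart a).
Proof.
move=> [cdo cio ck cc ic].
have imE : cmap (time_chart a) @` cdom (time_chart a) =
    [set z | (cmap a @` cdom a) (rsubmx z)].
  apply/seteqP; split=> [_ [[t x] /= [_ ax] <-]|z [x ax xz]] /=.
    by exists x; rewrite ?row_mxKr.
  by exists (lsubmx z, x) => //=; rewrite xz hsubmxK.
have rs : continuous (@rsubmx C 1 d n).
  move=> z; apply/continuous_rV => j.
  under [X in {for z, continuous X}]eq_fun do rewrite mxE.
  exact: coord_continuous.
have ls : continuous (@lsubmx C 1 d n).
  move=> z; apply/continuous_rV => j.
  under [X in {for z, continuous X}]eq_fun do rewrite mxE.
  exact: coord_continuous.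
split.
- have -> : cdom (time_chart a) = [set p | cdom a p.2].
    by apply/seteqP; split=> [p []|p].
  by apply: open_comp => // p _; exact: cvg_snd.
- by rewrite imE; apply: open_comp => // z _; exact: rs.
- by move=> [t x] /= [_ ax]; rewrite row_mxKl row_mxKr ck.
- move=> [t x] /= [_ ax].
  apply: (@continuous_rV R _ _ (fun p : W =>
    row_mx p.1 (cmap a p.2)) (t, x)).2 => j.
  case: (fintype.split_ordP j) => k ->.
    under [X in {for _, continuous X}]eq_fun do rewrite row_mxEl.
    apply: (continuous_comp (f := fst) (g := fun t : 'rV[C]_d => t 0 k)).
      exact: cvg_fst.
    exact: coord_continuous.
  under [X in {for _, continuous X}]eq_fun do rewrite row_mxEr.
  apply: (continuous_comp (f := snd) (g := fun x => cmap a x 0 k)).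
    exact: cvg_snd.
  by have := (continuous_rV _ _).1 (cc x ax) k.
- rewrite imE => z ax.
  exact: (cvg_pair (ls z) (continuous_comp (rs z) (ic _ ax))).
Qed.

End Products.

End ManifoldGerms.

(** * Frames of vector bundles *)

Section BundleAlgebra.
Variable R : realType.
Local Notation C := (Cplx R).

Lemma linear_comb (U V : lmodType C) (L : U -> V) (I : Type) (r : seq I)
    (c : I -> C) (v : I -> U) : linear L ->
  L (\sum_(i <- r) c i *: v i) = \sum_(i <- r) c i *: L (v i).
Proof.
move=> Ll; have L0 : L 0 = 0.
  by have := Ll (-1) 0 0; rewrite scaler0 add0r scaleN1r addNr.
elim: r => [|i r IH]; first by rewrite !big_nil.
by rewrite !big_cons Ll IH.
Qed.

Lemma col_sum_delta r (c : 'cV[C]_r) : c = \sum_k c k 0 *: delta_mx k 0.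
Proof.
rewrite [LHS]matrix_sum_delta; apply: eq_bigr => k _.
by rewrite big_ord1.
Qed.

Lemma col_mulmx m p q (A : 'M[C]_(m, p)) (B : 'M[C]_(p, q)) k :
  col k (A *m B) = A *m col k B.
Proof. by rewrite !colE mulmxA. Qed.

Section Coordinates.
Variables (m n r : nat) (X : atlased R m) (Y : atlased R n).
Variables (E : vbundle R X r) (E' : vbundle R Y r).
Hypothesis HE : holomorphic_vbundle E.
Implicit Types (e : triv E r) (f : triv E' r).

Lemma tmap_linear e x : trivs E e -> tdom e x -> linear (tmap e x).
Proof. by have [_ h _ _] := HE => eE ex; have [] := h e x eE ex. Qed.

Lemma tmapK e x : trivs E e -> tdom e x -> cancel (tmap e x) (tinv e x).
Proof. by have [_ h _ _] := HE => eE ex; have [] := h e x eE ex. Qed.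

Lemma tinvK e x : trivs E e -> tdom e x -> cancel (tinv e x) (tmap e x).
Proof. by have [_ h _ _] := HE => eE ex; have [] := h e x eE ex. Qed.

Lemma tdom_open e : trivs E e -> open (tdom e).
Proof. by have [h _ _ _] := HE; exact: h. Qed.

Lemma frame_expand e x (v : E x) : trivs E e -> tdom e x ->
  v = \sum_k tmap e x v k 0 *: tinv e x (delta_mx k 0).
Proof.
move=> eE ex; apply: (can_inj (tmapK eE ex)).
rewrite (linear_comb _ _ _ (tmap_linear eE ex)) [LHS]col_sum_delta.
by apply: eq_bigr => k _; rewrite (tinvK eE ex).
Qed.

Hypothesis HE' : holomorphic_vbundle E'.

Lemma tmap_coordmx e f x y (L : E x -> E' y) (v : E x) : linear L ->
  trivs E e -> tdom e x -> trivs E' f -> tdom f y ->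
  tmap f y (L v) = coordmx e f L *m tmap e x v.
Proof.
move=> Ll eE ex fE' fy; rewrite {1}(frame_expand v eE ex)
  (linear_comb _ _ _ Ll).
have [_ h _ _] := HE'; have [fl _ _] := h f y fE' fy.
rewrite (linear_comb _ _ _ fl); apply/colP => i; rewrite summxE mxE.
by apply: eq_bigr => k _; rewrite !mxE mulrC.
Qed.

Lemma transition1 e x : trivs E e -> tdom e x -> transition e e x = 1%:M.
Proof. by move=> eE ex; apply/matrixP => i j;
  rewrite mxE tinvK// !mxE andbT. Qed.

End Coordinates.

Lemma coordmx_comp m n p r (X : atlased R m) (Y : atlased R n) (Z : atlased R p)
    (E : vbundle R X r) (E' : vbundle R Y r) (E'' : vbundle R Z r)
    (e : triv E r) (f : triv E' r) (g : triv E'' r) x y z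
    (L : E x -> E' y) (L' : E' y -> E'' z) :
  holomorphic_vbundle E' -> holomorphic_vbundle E'' -> linear L' ->
  trivs E' f -> tdom f y -> trivs E'' g -> tdom g z ->
  coordmx e g (fun v => L' (L v)) = coordmx f g L' *m coordmx e f L.
Proof.
move=> HE' HE'' L'l fE' fy gE'' gz; apply/matrixP => i j.
rewrite [LHS]mxE (tmap_coordmx HE' HE'' _ L'l fE' fy gE'' gz) [LHS]mxE [RHS]mxE.
by apply: eq_bigr => k _; congr (_ * _); rewrite mxE.
Qed.

(** The inverse of a bijective linear map is linear, and by [coordmx_comp] its matrix is a one-sided
    inverse, hence the inverse. *)
Lemma coordmx_unit m n r (X : atlased R m) (Y : atlased R n)
    (E : vbundle R X r) (E' : vbundle R Y r) (e : triv E r) (f : triv E' r) x y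
    (L : E x -> E' y) :
  holomorphic_vbundle E -> holomorphic_vbundle E' -> linear L -> bijective L ->
  trivs E e -> tdom e x -> trivs E' f -> tdom f y -> coordmx e f L \in unitmx.
Proof.
move=> HE HE' Ll [L' LK L'K] eE ex fE' fy.
have L'l : linear L'.
  by move=> c u v; apply: (can_inj LK); rewrite L'K Ll !L'K.
suff h : coordmx e f L *m coordmx f e L' = 1%:M by exact: (mulmx1_unit h).1.
rewrite -(coordmx_comp _ _ HE HE' Ll eE ex fE' fy).
rewrite -(transition1 HE' fE' fy); congr coordmx.
by apply/funext => v; rewrite L'K.
Qed.

End BundleAlgebra.

(** * Tangent vectors and partial derivatives as operators in a chart *)

Section TangentOperators.
Variable R : realType.
Local Notation C := (Cplx R).
Variables (n : nat) (X : atlased R n) (a : chart R X n).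

Definition scale_op m (c : C) (L : seq (C * 'rV[C]_m)) : seq (C * 'rV[C]_m) :=
  [seq (c * p.1, p.2) | p <- L].

Definition tangent_op (v w : 'rV[C]_n) : seq (C * 'rV[C]_n) :=
  flatten [seq scale_op (v 0 j) (dz_op R j) | j <- index_enum 'I_n] ++
  flatten [seq scale_op (w 0 j) (dzbar_op R j) | j <- index_enum 'I_n].

Lemma cdir_scale_op m c (L : seq (C * 'rV[C]_m)) f x :
  cdir (scale_op c L) f x = c * cdir L f x.
Proof.
by rewrite /cdir big_map mulr_sumr; apply: eq_bigr => p _; rewrite mulrA.
Qed.

Lemma cdir_tangent_op v w f z :
  cdir (tangent_op v w) f z =
  \sum_j v 0 j * dz j f z + \sum_j w 0 j * dzbar j f z.
Proof.
rewrite /cdir big_cat /= !big_flatten /= !big_map.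
by congr (_ + _); apply: eq_bigr => j _; rewrite ?dzE ?dzbarE -cdir_scale_op.
Qed.

Lemma tangent_actE v w (f : X -> C) x :
  tangent_act a v w f x = cdir (tangent_op v w) (fun z =>
    f (cinv a z)) (cmap a x).
Proof. by rewrite cdir_tangent_op. Qed.

Lemma mpdE p q i (M : X -> 'M[C]_(p, q)) x :
  mpd a i M x = cdir_mx (dz_op R i) (fun z => M (cinv a z)) (cmap a x).
Proof. by apply/matrixP => k l; rewrite !mxE /pd dzE. Qed.

Lemma mpdbarE p q i (M : X -> 'M[C]_(p, q)) x :
  mpdbar a i M x = cdir_mx (dzbar_op R i) (fun z => M (cinv a z)) (cmap a x).
Proof. by apply/matrixP => k l; rewrite !mxE /pdbar dzbarE. Qed.

End TangentOperators.

(** * The product of the ball of parameters with X *)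

Section TimeProduct.
Variable R : realType.
Local Notation C := (Cplx R).

Lemma eball_open d (rho : R) : open (@eball R d rho).
Proof.
pose N (r : seq 'I_d) (t : 'rV[C]_d) :=
  \sum_(i <- r) (complex.Re (t 0 i) ^+ 2 + complex.Im (t 0 i) ^+ 2).
have Nc r : continuous (N r).
  elim: r => [|i r IH] t.
    rewrite (_ : N [::] = fun _ => 0); first exact: cst_continuous.
    by apply/funext => t'; rewrite /N big_nil.
  rewrite (_ : N (i :: r) = (fun t => (complex.Re (t 0 i) * complex.Re (t 0 i) +
     complex.Im (t 0 i) * complex.Im (t 0 i)) + N r t)); last first.
    by apply/funext => t'; rewrite /N big_cons !expr2.
  have tc := @coord_continuous C 1 d 0 i t.
  have rc := continuous_comp tc (@Re_continuous R _).
  have ic := continuous_comp tc (@Im_continuous R _).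
  exact: (continuousD (continuousD (continuousM rc rc) (continuousM ic ic))
    (IH t)).
rewrite openE => t tr; rewrite /interior.
have h := @cvgr_lt R _ (nbhs t) _ (N (index_enum 'I_d)) _ (Nc _ t) _ tr.
exact: h.
Qed.

Lemma eball0 d (rho : R) : 0 < rho -> @eball R d rho 0.
Proof.
move=> r0; rewrite /eball /= big1 ?exprn_gt0// => i _.
by rewrite mxE /= expr0n addr0.
Qed.

Lemma eball_line d (rho : R) (u : 'rV[C]_d) : 0 < rho ->
  \forall s \near (0 : R), @eball R d rho (rtoc s *: u).
Proof.
move=> r0; have h := @near_along R d (@eball R d rho) u 0 _.
have : \forall y \near (0 : 'rV[C]_d), eball rho y.
  by apply: (near_open (@eball_open d rho)) => //; exact: eball0.
by move/h; apply: filterS => s; rewrite add0r.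
Qed.

Variables (d n : nat) (X : atlased R n).
Hypothesis X_manifold : complex_manifold X.
Let X_charted := complex_manifold_charted X_manifold.
Local Notation W := (prod_atlased (Cspace R d) X).

Lemma time_charted : charted W.
Proof.
split=> [c /atlas_time_chart[a aX ->]|[t x]].
  by apply: time_chart_is_chart; exact: X_charted.1.
have [a aX ax] := X_charted.2 x.
by exists (time_chart d a); [exact: time_chart_atlas|].
Qed.

Lemma cylinder_open (rho : R) (O : set X) : open O ->
  open (@eball R d rho `*` O : set W).
Proof.
move=> oO; rewrite openE => -[t x] [tr Ox]; rewrite /interior.
exists (@eball R d rho, O) => //; split; apply: open_nbhs_nbhs; split=> //.
exact: eball_open.
Qed.

Lemma cylinder_openT (rho : R) : open (@eball R d rho `*` setT : set W).
Proof. by apply: cylinder_open; exact: openT. Qed.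

Lemma smooth_map_at_slice t x : smooth_map_at (fun y : X => (t, y) : W) x.
Proof.
have tc : {for x, continuous (fun _ : X => t)} by exact: cst_continuous.
have xc : {for x, continuous (fun y : X => y)} by move=> A.
split; first exact: (cvg_pair tc xc).
move=> c /atlas_time_chart[b bX ->] [_ bx] j.
case: (fintype.split_ordP j) => k ->.
  apply: (smooth_fun_at_ext X_charted (f := fun _ => t 0 k)).
    by apply: all_near => y; rewrite row_mxEl.
  by move=> a aX ax; exact: smooth_at_cst.
apply: (smooth_fun_at_ext X_charted (f := fun y => cmap b y 0 k)).
  by apply: all_near => y; rewrite row_mxEr.
exact: cmap_smooth_fun_at.
Qed.

End TimeProduct.

(** * The bundle part of a family in a holomorphic frame *)

Section FrameEquation.
Variable R : realType.
Local Notation C := (Cplx R).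
Variables (n r d : nat) (X : atlased R n) (E : vbundle R X r) (rho : R).
Hypothesis X_manifold : complex_manifold X.
Hypothesis HE : holomorphic_vbundle E.
Variables (D D' : deformation d E).
Hypotheses (HD : is_deformation rho D) (HD' : is_deformation rho D').
Variable T : trivialization D.
Hypothesis HT : is_trivialization rho T.
Variables (F : tot D -> tot D') (Phi : forall y, totE D y -> totE D' (F y)).
Hypothesis F_holomorphic : regular_map (@holomorphic R) setT F.
Hypothesis Phi_iso : bundle_iso (@holomorphic R) setT (@Phi).

Local Notation Delta := (@eball R d rho).
Local Notation W := (prod_atlased (Cspace R d) X).
Let X_charted := complex_manifold_charted X_manifold.
Let W_charted := time_charted d X_manifold.

Lemma tot_manifold : complex_manifold (tot D).
Proof. by have [] := HD. Qed.

Lemma totE_holomorphic : holomorphic_vbundle (totE D).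
Proof. by have [] := HD. Qed.

Let D_charted := complex_manifold_charted tot_manifold.
Let HED := totE_holomorphic.
Let HED' : holomorphic_vbundle (totE D'). Proof. by have [] := HD'. Qed.
Let D'_charted : charted (tot D').
Proof. by apply: complex_manifold_charted; have [] := HD'. Qed.

Lemma tr_map_smooth t x : Delta t -> smooth_map_at (X := W) (tr_map T) (t, x).
Proof.
move=> tD; have [[Ts _] _ _ _ _] := HT.
apply: (regular_smooth_map_at W_charted D_charted (@cylinder_openT R d n X rho)
  Ts).
by split.
Qed.

Lemma tr_map_slice_smooth t x : Delta t ->
  smooth_map_at (fun y => tr_map T (t, y)) x.
Proof.
move=> tD; apply: (smooth_map_at_comp X_charted W_charted).
  exact: smooth_map_at_slice.
exact: tr_map_smooth.
Qed.

Lemma F_smooth y : smooth_map_at F y.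
Proof.
apply: (regular_smooth_map_at D_charted D'_charted openT) => //.
exact: holomorphic_regular_map.
Qed.

(** F and Phi are arbitrary here because two cases are needed: the isomorphism of families, which
    yields M, and the identity of the second family, which yields M'. *)
Definition tr_total (p : W) : E p.2 -> totE D' (F (tr_map T p)) :=
  fun v => @Phi (tr_map T p) (@tr_mapE _ _ _ _ _ _ _ T p v).

(* With p = (t, x) this is the matrix M_t(x) of the proof. *)
Definition tr_mx (e : triv E r) (f : triv (totE D') r) (p : W) : 'M[C]_r :=
  coordmx e f (@tr_total p).

Section Matrix.
Variables (e : triv E r) (f : triv (totE D') r).
Hypotheses (eE : trivs E e) (fD : trivs (totE D') f).

Let e_time : triv (pull_snd (Cspace R d) E) r :=
  Triv (snd @^-1` tdom e) (fun p => tmap e p.2) (fun p => tinv e p.2).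

Let e_time_trivs : trivs (pull_snd (Cspace R d) E) e_time.
Proof. by exists e. Qed.

Definition tr_dom (p : W) : Prop :=
  [/\ Delta p.1, tdom e p.2 & tdom f (F (tr_map T p))].

Lemma tr_mapE_linear p : Delta p.1 -> linear (@tr_mapE _ _ _ _ _ _ _ T p).
Proof. by move=> pD; have [_ _ _ [h _] _] := HT; have [] := h p. Qed.

Lemma tr_mapE_bijective p : Delta p.1 -> bijective (@tr_mapE _ _ _ _ _ _ _ T p).
Proof. by move=> pD; have [_ _ _ [h _] _] := HT; have [] := h p. Qed.

(** A frame g of the first total bundle separates a factor that is holomorphic on the total space
    from one that comes from the smooth trivialization. Smoothness and invertibility of M are proved
    factor by factor. *)
Lemma tr_mx_factor g p : tr_dom p -> trivs (totE D) g -> tdom g (tr_map T p) ->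
  tr_mx e f p = coordmx g f (@Phi (tr_map T p))
    *m coordmx e g (@tr_mapE _ _ _ _ _ _ _ T p).
Proof.
move=> [pD pe pf] gD gp.
apply: (@coordmx_comp R _ _ _ _ _ _ _ _ _ _ e g f _ _ _
   (@tr_mapE _ _ _ _ _ _ _ T p) (@Phi (tr_map T p))) => //.
by have [h _] := Phi_iso; have [] := h (tr_map T p) I.
Qed.

Lemma Phi_mx_unit g y : trivs (totE D) g -> tdom g y -> tdom f (F y) ->
  coordmx g f (@Phi y) \in unitmx.
Proof.
move=> gD gy fy; have [h _] := Phi_iso; have [l b] := h y I.
exact: (coordmx_unit HED HED').
Qed.

Lemma tr_mapE_mx_unit g p : Delta p.1 -> tdom e p.2 ->
  trivs (totE D) g -> tdom g (tr_map T p) ->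
  coordmx e g (@tr_mapE _ _ _ _ _ _ _ T p) \in unitmx.
Proof.
move=> pD pe gD gp.
exact: (coordmx_unit HE HED (tr_mapE_linear pD) (tr_mapE_bijective pD)
  eE pe gD gp).
Qed.

Lemma tr_mx_unit p : tr_dom p -> tr_mx e f p \in unitmx.
Proof.
move=> pd; have [_ _ ex _] := HED; have [g gD gp] := ex (tr_map T p).
rewrite (tr_mx_factor pd gD gp) unitmx_mul; case: pd => pD pe pf.
by rewrite Phi_mx_unit// tr_mapE_mx_unit.
Qed.

Lemma Phi_mx_domain_open g : trivs (totE D) g ->
  open (tdom g `&` F @^-1` tdom f).
Proof.
move=> gD; apply: openI; first exact: (tdom_open HED).
apply: open_comp; last exact: (tdom_open HED').
by move=> y _; have [h _] := F_smooth y.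
Qed.

Lemma Phi_mx_holomorphic g k l : trivs (totE D) g ->
  regular_fun (@holomorphic R) (tdom g `&` F @^-1` tdom f)
    (fun y => coordmx g f (@Phi y) k l).
Proof.
by move=> gD; have [_ h] := Phi_iso; have := h g f gD fD k l; rewrite setTI.
Qed.

Lemma near_tr_dom p : tr_dom p -> \forall q \near p, tr_dom q.
Proof.
case: p => t x [/= pD pe pf].
have [Tc _] := tr_map_smooth x pD; have [Fc _] := F_smooth (tr_map T (t, x)).
have h1 : \forall q \near (t, x), (Delta `*` tdom e) q.
  apply: open_nbhs_nbhs; split; last by split.
  by apply: cylinder_open; exact: (tdom_open HE).
have FT := continuous_comp Tc Fc.
have h2 : \forall q \near (t, x), tdom f (F (tr_map T q)).
  exact: (FT _ (open_nbhs_nbhs (conj (tdom_open HED' fD) pf))).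
by apply: filterS2 h1 h2 => q [].
Qed.

Lemma tr_mx_smooth p k l : tr_dom p ->
  smooth_fun_at (X := W) (fun q => tr_mx e f q k l) p.
Proof.
case: p => t x pd; have [/= pD pe pf] := pd.
have [_ _ ex _] := HED; have [g gD gp] := ex (tr_map T (t, x)).
have Ts := tr_map_smooth x pD; have [Tc _] := Ts.
have gn : \forall q \near (t, x), tdom g (tr_map T q).
  exact: (Tc _ (open_nbhs_nbhs (conj (tdom_open HED gD) gp))).
apply: (smooth_fun_at_ext W_charted (f := fun q => \sum_j
  coordmx g f (@Phi (tr_map T q)) k j * coordmx e g (@tr_mapE _ _ _ _ _ _ _ T q)
    j l)).
  have := near_tr_dom pd; apply: filterS2 gn => q gq qd.
  by rewrite (tr_mx_factor qd gD gq) mxE.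
move=> c cW cp; apply: smooth_at_sum => j; apply: smooth_atM.
  apply: (smooth_fun_at_comp W_charted D_charted Ts
    (f := fun y => coordmx g f (@Phi y) k j)) => //.
  exact: (holomorphic_smooth_fun_at D_charted (Phi_mx_domain_open gD)
    (Phi_mx_holomorphic k j gD)).
have [_ _ _ [_ h] _] := HT; have hs := h e_time g e_time_trivs gD j l.
apply: (regular_smooth_fun_at W_charted _ hs) => //.
rewrite openE => -[t' x'] [[[/= t'D _] ex'] gx']; rewrite /interior.
apply: filterI; first apply: filterI.
- apply: open_nbhs_nbhs; split; last by split.
  exact: cylinder_openT.
- have o : open ((setT : set 'rV[C]_d) `*` tdom e : set W).
    rewrite (_ : _ `*` _ = snd @^-1` tdom e).
      by apply: open_comp; [move=> z _; exact: cvg_snd|exact: (tdom_open HE)].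
    by apply/seteqP; split=> [q []|q].
  have : ((setT : set 'rV[C]_d) `*` tdom e) (t', x') by [].
  by move=> h'; have := open_nbhs_nbhs (conj o h'); apply: filterS => q [].
- have [Tc' _] := tr_map_smooth x' t'D.
  exact: (Tc' _ (open_nbhs_nbhs (conj (tdom_open HED gD) gx'))).
Qed.

(** [tangent01] tests a vector on coordinate functions only. The chain rule extends this to every
    holomorphic function on the total space, as its dbar vanishes. *)
Lemma tangent01_holomorphic (O : set (tot D)) (H : tot D -> C) t a x v w :
  open O -> regular_fun (@holomorphic R) O H -> O (tr_map T (t, x)) ->
    Delta t ->
  atlas X a -> cdom a x -> tangent01 T t a x v w ->
  cdir (tangent_op v w) (fun z => H (tr_map T (t, cinv a z))) (cmap a x) = 0.
Proof.
move=> oO HO Ox tD aX ax tg; have [b bD bx] := D_charted.2 (tr_map T (t, x)).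
apply: (holomorphic_pullback X_charted D_charted (F := fun y => tr_map T (t, y))
  oO HO Ox (tr_map_slice_smooth x tD) aX ax bD bx) => k.
rewrite -(tangent_actE a v w (fun y => cmap b (tr_map T (t, y)) 0 k)).
exact: tg.
Qed.

Lemma near_tr_dom_slice t x : tr_dom (t, x) -> \forall y \near x, tr_dom (t, y).
Proof. by move=> td; exact: ((@smooth_map_at_slice R d n X X_manifold t x).1 _
  (near_tr_dom td)). Qed.

(** The sections of E that [tr_total] maps to the frame f. *)
Definition tr_frame t (k : 'I_r) (y : X) : E y :=
  tinv e y (col k (invmx (tr_mx e f (t, y)))).

Lemma tmap_tr_frame e' t k y : trivs E e' -> tdom e' y -> tdom e y ->
  tmap e' y (tr_frame t k y) =
  transition e e' y *m col k (invmx (tr_mx e f (t, y))).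
Proof.
move=> e'E e'y ey.
rewrite -[X in _ *m X](tinvK HE eE ey).
exact: (tmap_coordmx HE HE (L := fun v : E y => v) (tr_frame t k y)
  (fun c u v => erefl) eE ey e'E e'y).
Qed.

(** The factor Q of the trivialization cancels: Q (P Q)^-1 = P^-1, where P is the matrix of Phi.
    What is left is the inverse of a matrix that is holomorphic on the total space. *)
Lemma tmap_tr_mapE_frame g t k y : tr_dom (t, y) -> trivs (totE D) g ->
  tdom g (tr_map T (t, y)) ->
  tmap g (tr_map T (t, y)) (tr_mapE T (p := (t, y)) (tr_frame t k y)) =
  col k (invmx (coordmx g f (@Phi (tr_map T (t, y))))).
Proof.
move=> td gD gy; have [/= tD ey fy] := td.
rewrite (tmap_coordmx HE HED (L := @tr_mapE _ _ _ _ _ _ _ T (t, y))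
  _ (tr_mapE_linear (p := (t, y)) tD) eE ey gD gy).
rewrite (tinvK HE eE ey) (tr_mx_factor td gD gy).
have Pu := Phi_mx_unit gD gy fy.
have Qu := tr_mapE_mx_unit (p := (t, y)) tD ey gD gy.
set P := coordmx g f _ in Pu *; set Q := coordmx e g _ in Qu *.
suff -> : invmx P = Q *m invmx (P *m Q) by rewrite -col_mulmx.
have PQu : P *m Q \in unitmx by rewrite unitmx_mul Pu.
by rewrite -[LHS]mulmx1 -(mulmxV PQu) -mulmxA (mulKmx Pu).
Qed.

Lemma tr_frame_holomorphic t : Delta t ->
  holomorphic_frame T t [set y | tr_dom (t, y)] (tr_frame t).
Proof.
move=> tD; split=> [e' y e'E td e'y|g gD k l].
  have [_ ey _] := td.
  suff -> : \matrix_(i, k) tmap e' y (tr_frame t k y) i 0 =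
      transition e e' y *m invmx (tr_mx e f (t, y)).
    rewrite unitmx_mul unitmx_inv tr_mx_unit// andbT.
    apply: (coordmx_unit HE HE _ _ eE ey e'E e'y) => //.
    by exists id.
  apply/matrixP => i k; rewrite mxE tmap_tr_frame// !mxE.
  by apply: eq_bigr => j _; congr (_ * _); rewrite mxE.
set O' := [set x | _]; set s := fun x => _.
pose P y := coordmx g f (@Phi (tr_map T (t, y))).
have sE y : O' y -> s y = invmx (P y) l k.
  by move=> [td gy]; rewrite /s tmap_tr_mapE_frame// mxE.
have nO y : O' y -> \forall z \near y, O' z.
  move=> [td gy]; apply: filterI; first exact: near_tr_dom_slice.
  have [Tc _] := tr_map_slice_smooth y tD.
  exact: (Tc _ (open_nbhs_nbhs (conj (tdom_open HED gD) gy))).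
have Ps y a : O' y -> atlas X a -> cdom a y ->
    smooth_mx_at (fun z => P (cinv a z)) (cmap a y).
  move=> [[_ _ fy] gy] aX ay i j.
  apply: (smooth_fun_at_comp X_charted D_charted (tr_map_slice_smooth y tD)
    (f := fun q => coordmx g f (@Phi q) i j)) => //.
  exact: (holomorphic_smooth_fun_at D_charted (Phi_mx_domain_open gD)
    (Phi_mx_holomorphic i j gD)).
have Pu y : O' y -> P y \in unitmx by move=> [[_ _ fy] gy]; exact: Phi_mx_unit.
have sn y a : O' y -> atlas X a -> cdom a y ->
    \forall z \near cmap a y, invmx (P (cinv a z)) l k = s (cinv a z).
  move=> Oy aX ay.
  apply: (chart_near X_charted aX ay (P := fun y => invmx (P y) l k = s y)).
  by have := nO y Oy; apply: filterS => z /sE.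
split.
  apply: smooth_fun_at_regular => y Oy a aX ay.
  apply: smooth_at_ext (sn y a Oy aX ay) _.
  apply: (smooth_mx_inv (M := fun z => P (cinv a z))); last exact: Ps.
  by rewrite chartK//; exact: Pu.
move=> a x v w aX ax Ox tg;
  rewrite tangent_actE -(cdir_near _ (sn x a Ox aX ax)).
have Px : P (cinv a (cmap a x)) \in unitmx by rewrite chartK//; exact: Pu.
have := cdir_mx_inv (tangent_op v w) Px (Ps x a Ox aX ax).
(* The entries of P are holomorphic on the total space, so a vector of type (0,1) annihilates them,
   and then also those of P^-1. *)
rewrite (_ : cdir_mx _ (fun z => P (cinv a z)) _ = 0); last first.
  apply/matrixP => i j; rewrite !mxE; case: Ox => -[_ _ fx] gx.
  exact: (tangent01_holomorphic (Phi_mx_domain_open gD)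
    (Phi_mx_holomorphic i j gD)).
by rewrite mulmx0 mul0mx oppr0 => /matrixP/(_ l k); rewrite !mxE.
Qed.

Lemma frame_equation nabla w t a x i : represents_bundle T nabla t w ->
  Delta t -> atlas X a -> cdom a x -> tr_dom (t, x) ->
  tr_mx e f (t, x) *m f1Q w a e i x =
  mpdbar a i (fun y => tr_mx e f (t, y)) x +
  \sum_j f1T w a x i j *:
    (mpd a j (fun y => tr_mx e f (t, y)) x - tr_mx e f (t,
      x) *m conn10 nabla a e j x).
Proof.
move=> wT tD aX ax td; have [_ ex fx] := td.
pose M y := tr_mx e f (t, y); pose N y := invmx (M y).
have Mu : M x \in unitmx by exact: tr_mx_unit.
have Ms : smooth_mx_at (fun z => M (cinv a z)) (cmap a x).
  move=> k l; apply: (smooth_fun_at_comp X_charted W_charted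
    (smooth_map_at_slice X_manifold t x) (f := fun q => tr_mx e f q k l)) => //.
  exact: tr_mx_smooth.
have Mu' : M (cinv a (cmap a x)) \in unitmx by rewrite chartK.
have dN L : cdir_mx L (fun z => N (cinv a z)) (cmap a x) =
    - (N x *m cdir_mx L (fun z => M (cinv a z)) (cmap a x) *m N x).
  by rewrite /N (cdir_mx_inv L Mu' Ms) chartK.
have oO : open [set y | tr_dom (t, y)].
  by rewrite openE => y yd; exact: near_tr_dom_slice.
have key : f1Q w a e i x *m N x = - mpdbar a i N x
    - \sum_j f1T w a x i j *: (mpd a j N x + conn10 nabla a e j x *m N x).
  (* Constant coefficients, for which the section is the k-th vector of the frame and the term with
     Dbar_t vanishes. *)
  apply/matrixP => k0 k; pose c k' (y : X) : C := (k' == k)%:R.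
  have cs k' : regular_fun (@smooth R) [set y | tr_dom (t, y)] (c k').
    by move=> b bX m; exact: Ck_cst.
  have := wT _ _ oO (tr_frame_holomorphic tD) c cs a e x aX eE td ax ex i.
  cbv zeta; set s := fun y => tmap e y _.
  have sE y : tdom e y -> s y = col k (N y).
    move=> ey; rewrite /s (bigD1 k)//= big1 ?addr0 => [|k' /negPf k'k];
      last first.
      by rewrite /c k'k scale0r.
    by rewrite /c eqxx scale1r /tr_frame (tinvK HE eE ey).
  have sn : \forall z \near cmap a x, s (cinv a z) = col k (N (cinv a z)).
    apply: (chart_near X_charted aX ax (P := fun y => s y = col k (N y))).
    by apply: (near_open (tdom_open HE eE) ex) => y; exact: sE.
  have colD L : cdir_mx L (fun z => s (cinv a z)) (cmap a x) =
      col k (cdir_mx L (fun z => N (cinv a z)) (cmap a x)).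
    rewrite (cdir_mx_near L sn); apply/colP => j; rewrite !mxE.
    by apply: cdir_eq => z; rewrite mxE.
  rewrite (sE x ex) big1 ?sub0r => [|k' _]; last first.
    rewrite (_ : pdbar a i (c k') x = 0) ?add0r; last first.
      by rewrite /pdbar dzbarE cdir_cst.
    rewrite big1 ?scale0r// => j _.
    by rewrite /pd dzE cdir_cst mulr0.
  rewrite mpdbarE colD -mpdbarE.
  under eq_bigr do rewrite mpdE colD -mpdE -col_mulmx -linearD -linearZ.
  rewrite -col_mulmx -linear_sum -linearN -linearB.
  by move/colP/(_ k0); rewrite ![col _ _ _ _]mxE.
(* Multiplication by M on both sides turns each derivative of N = M^-1 into minus the derivative of
   M. *)
have := congr1 (fun A => M x *m A *m M x) key.
rewrite /N !mulmxA (mulmxKV Mu) => ->.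
rewrite mulmxBr mulmxBl mulmxN mulNmx mpdbarE dN mulmxN mulNmx opprK.
rewrite /N !mulmxA (mulmxV Mu) mul1mx (mulmxKV Mu) -mpdbarE; congr (_ + _).
rewrite mulmx_sumr mulmx_suml -sumrN; apply: eq_bigr => j _.
rewrite -scalemxAr -scalemxAl -scalerN; congr (_ *: _).
rewrite mpdE dN mulmxDr mulmxDl !mulmxN !mulNmx /N !mulmxA (mulmxV Mu) mul1mx.
by rewrite !(mulmxKV Mu) -mpdE opprD opprK.
Qed.

End Matrix.
End FrameEquation.

(** * Comparison of two isomorphic families *)

Section IdentityMorphism.
Variable R : realType.

(** The identity is used as a morphism from the second family to itself, so that everything proved
    of M holds for M' as well. *)
Lemma id_holomorphic n (X : atlased R n) : complex_manifold X ->
  regular_map (@holomorphic R) setT (fun x : X => x).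
Proof.
move=> [_ _ _ _ tr]; split=> [x _ A //|a b aX bX j].
by rewrite setIT; exact: tr.
Qed.

Lemma id_bundle_iso n r (X : atlased R n) (E : vbundle R X r) :
  holomorphic_vbundle E ->
  bundle_iso (E := E) (E' := E) (@holomorphic R) setT (fun x (v : E x) => v).
Proof.
move=> [_ _ _ tr]; split=> [x _|e f eE fE i j].
  by split; [by []|exists id].
by rewrite setTI; exact: tr.
Qed.

End IdentityMorphism.

(** * Derivatives in time, and along the graph of a family of maps *)

Section TimeDerivative.
Variable R : realType.
Local Notation C := (Cplx R).

Lemma rderive_near (f g : R -> C) s : (\forall t \near s, f t = g t) ->
  rderive f s = rderive g s.
Proof.
move=> fg; rewrite /rderive !derive1E; congr (_ +i* _)%C;
  by apply: near_eq_derive; apply: filterS fg => t ->.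
Qed.

Variables (d n : nat) (u : 'rV[C]_d).
Implicit Types (f g : 'rV[C]_(d + n) -> C) (z : 'rV[C]_n).

Definition time_op : seq (C * 'rV[C]_(d + n)) := [:: (1, row_mx u 0)].

Lemma cdir_time f p : cdir time_op f p = dirderive f (row_mx u 0) p.
Proof. by rewrite /cdir big_seq1 mul1r. Qed.

(** Agreement is required only on the line of the multiples s u over a fixed z. This is how the
    equations between the families are used: at a fixed point of X, for s small. *)
Lemma cdir_time_near f g z :
  (\forall s \near (0 : R),
    f (row_mx (rtoc s *: u) z) = g (row_mx (rtoc s *: u) z)) ->
  cdir time_op f (row_mx 0 z) = cdir time_op g (row_mx 0 z).
Proof. by move=> fg; rewrite -!rderive_slice; exact: rderive_near. Qed.

Lemma cdir_mx_time_near p q (f g : 'rV[C]_(d + n) -> 'M[C]_(p, q)) z :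
  (\forall s \near (0 : R),
    f (row_mx (rtoc s *: u) z) = g (row_mx (rtoc s *: u) z)) ->
  cdir_mx time_op f (row_mx 0 z) = cdir_mx time_op g (row_mx 0 z).
Proof.
move=> fg; apply/matrixP => k l; rewrite !mxE; apply: cdir_time_near.
by apply: filterS fg => s ->.
Qed.

(** The image vector is kept as one real direction, which [dirderive_addr] can then split. *)
Lemma dirderive_compE m p (f : 'rV[C]_p -> C) (G : 'rV[C]_m -> 'rV[C]_p) v x :
  (forall j, smooth_at (fun y => G y 0 j) x) -> smooth_at f (G x) ->
  dirderive (fun y => f (G y)) v x =
  dirderive f (\row_j dirderive (fun y => G y 0 j) v x) (G x).
Proof.
move=> Gx fx; rewrite dirderive_comp// dirderive_wirtinger//.
by apply: eq_bigr => j _; rewrite mxE dirderive_conj.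
Qed.

Lemma dirderive_coord m j (v x : 'rV[C]_m) : dirderive (fun y =>
  y 0 j) v x = v 0 j.
Proof.
exact: rderive_val (is_rderive_coord j v x).
Qed.

Lemma dz_coord m (j k : 'I_m) x :
  cdir (dz_op R j) (fun y => y 0 k) x = (j == k)%:R.
Proof.
rewrite -dzE /dz !dirderive_coord !mxE eqxx /= mulrA -expr2 sqrCi mulN1r opprK.
have half (c : C) : (c + c) / 2 = c by field.
by rewrite half eq_sym.
Qed.

Lemma dzbar_coord_conj m (j k : 'I_m) x :
  cdir (dzbar_op R j) (fun y => (y 0 k)^*) x = (j == k)%:R.
Proof.
rewrite -dzbarE /dzbar !dirderive_conj; try exact: smooth_at_coord.
rewrite !dirderive_coord !mxE eqxx /= rmorphM /= conjCi mulrA mulrN -expr2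
  sqrCi.
have half (c : C) : (c + c) / 2 = c by field.
by rewrite opprK mul1r rmorph_nat half eq_sym.
Qed.

Lemma sum_deltal (I : finType) i (c : I -> C) : \sum_l (i == l)%:R * c l = c i.
Proof.
rewrite (bigD1 i)//= eqxx mul1r big1 ?addr0// => l /negPf li.
by rewrite eq_sym li mul0r.
Qed.

Lemma sum_deltar (I : finType) i (c : I -> C) : \sum_l c l * (l == i)%:R = c i.
Proof.
rewrite (bigD1 i)//= eqxx mulr1 big1 ?addr0// => l /negPf li.
by rewrite li mulr0.
Qed.

Section Flow.
Variables (g : 'rV[C]_(d + n) -> 'rV[C]_n) (z : 'rV[C]_n).
Hypothesis gs : forall k, smooth_at (fun p => g p 0 k) (row_mx 0 z).
Hypothesis g0 : g (row_mx 0 z) = z.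

Lemma graph_smooth j :
  smooth_at (fun p => row_mx (lsubmx p) (g p) 0 j) (row_mx 0 z).
Proof.
case: (fintype.split_ordP j) => k ->.
  apply: (smooth_at_eq _ (smooth_at_coord (lshift n k) (row_mx 0 z))) => p.
  by rewrite row_mxEl mxE.
by apply: (smooth_at_eq _ (gs k)) => p; rewrite row_mxEr.
Qed.

Lemma graph0 : row_mx (lsubmx (row_mx (0 : 'rV[C]_d) z)) (g (row_mx 0 z))
  = row_mx 0 z.
Proof. by rewrite row_mxKl g0. Qed.

Lemma graph_comp_smooth f : smooth_at f (row_mx 0 z) ->
  smooth_at (fun p => f (row_mx (lsubmx p) (g p))) (row_mx 0 z).
Proof. by move=> fs; apply: smooth_at_comp;
  [exact: graph_smooth|rewrite graph0]. Qed.

(** The map (t, z) |-> (t, g(t, z)) fixes (0, z) and sends the direction (u, 0) there to u together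
    with the velocity of g. This vector is the sum of the time direction and of one tangent to the
    slice t = 0. *)
Lemma cdir_time_graph f : smooth_at f (row_mx 0 z) ->
  cdir time_op (fun p => f (row_mx (lsubmx p) (g p))) (row_mx 0 z) =
  cdir time_op f (row_mx 0 z) +
  dirderive (fun y => f (row_mx 0 y))
    (\row_k cdir time_op (fun p => g p 0 k) (row_mx 0 z)) z.
Proof.
move=> fs; rewrite !cdir_time dirderive_slice.
rewrite (dirderive_compE (G := fun p => row_mx (lsubmx p) (g p))); last first.
- by rewrite graph0.
- exact: graph_smooth.
rewrite graph0 -(dirderive_addr (row_mx u 0) (row_mx 0 _) fs).
apply: (congr1 (fun v => dirderive f v (row_mx 0 z))).
apply/rowP => j; rewrite mxE; case: (fintype.split_ordP j) => k ->.
  rewrite add_row_mx row_mxEl addr0.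
  rewrite (_ : (fun y => _) = (fun p : 'rV[C]_(d + n) => p 0 (lshift n k))).
    by rewrite dirderive_coord row_mxEl.
  by apply/funext => p; rewrite row_mxEl mxE.
rewrite add_row_mx row_mxEr add0r mxE cdir_time.
apply: (congr1 (fun h => dirderive h (row_mx u 0) (row_mx 0 z))).
by apply/funext => p; rewrite row_mxEr.
Qed.

End Flow.
End TimeDerivative.

(** * Time dependent objects on X read in a chart *)

Section Hat.
Variable R : realType.
Local Notation C := (Cplx R).
Variables (n d : nat) (X : atlased R n) (u : 'rV[C]_d).
Hypothesis X_manifold : complex_manifold X.
Local Notation W := (prod_atlased (Cspace R d) X).
Let X_charted := complex_manifold_charted X_manifold.

Lemma near_time (P : W -> Prop) x : (\forall p \near ((0, x) : W), P p) ->
  \forall s \near (0 : R), P (rtoc s *: u, x).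
Proof.
move=> Px; have h := @line_continuous R d 0 u 0.
have xc : {for (0 : R), continuous (fun _ : R => x)} by exact: cst_continuous.
have h' : {for (0 : R), continuous (fun s : R => rtoc s *: u)}.
  rewrite (_ : (fun s => _) = (fun s : R => 0 + rtoc s *: u)); first exact: h.
  by apply/funext => s; rewrite add0r.
apply: (cvg_pair h' xc); rewrite rtoc0 scale0r; exact: Px.
Qed.

(* A time dependent object read in the chart a of X, for which (lsubmx p,
   rsubmx p) is the pair of the time and of the coordinates. *)
Definition hat (U : Type) (a : chart R X n) (f : W ->
  U) (p : 'rV[C]_(d + n)) : U :=
  f (lsubmx p, cinv a (rsubmx p)).

Lemma hatE U a (f : W -> U) t z : hat a f (row_mx t z) = f (t, cinv a z).
Proof. by rewrite /hat row_mxKl row_mxKr. Qed.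

Lemma hat_smooth a (f : W -> C) t x : atlas X a -> cdom a x ->
  smooth_fun_at f (t, x) -> smooth_at (hat a f) (row_mx t (cmap a x)).
Proof.
move=> aX ax fs.
exact: (fs (time_chart d a) (@time_chart_atlas R d n X a aX) (conj I ax)).
Qed.

Lemma rderive_hat a (f : W -> C) x : atlas X a -> cdom a x ->
  rderive (fun s => f (rtoc s *: u, x)) 0 =
  cdir (time_op n u) (hat a f) (row_mx 0 (cmap a x)).
Proof.
move=> aX ax; rewrite -rderive_slice; congr (rderive _ 0).
by apply/funext => s; rewrite hatE chartK.
Qed.

Lemma cdir_hat a (f : W -> C) t z L :
  cdir L (fun y => f (t, cinv a y)) z = cdir (slice_op d L) (hat a f)
    (row_mx t z).
Proof.
by rewrite -cdir_slice; congr (cdir L _ z); apply/funext => y; rewrite hatE.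
Qed.

Lemma cdir_mx_hat p q a (f : W -> 'M[C]_(p, q)) t z L :
  cdir_mx L (fun y => f (t, cinv a y)) z =
  cdir_mx (slice_op d L) (hat a f) (row_mx t z).
Proof. by apply/matrixP => k l;
  rewrite !mxE (cdir_hat a (fun p => f p k l)). Qed.

Lemma cdir_mx_slice p q (f : 'rV[C]_(d + n) -> 'M[C]_(p, q)) t z L :
  cdir_mx L (fun y => f (row_mx t y)) z = cdir_mx (slice_op d L) f (row_mx t z).
Proof.
by apply/matrixP => k l; rewrite !mxE; exact: (cdir_slice L (fun y => f y k l)).
Qed.

Lemma hat_mx_smooth p q a (f : W -> 'M[C]_(p, q)) t x : atlas X a -> cdom a x ->
  (forall k l, smooth_fun_at (fun p => f p k l) (t, x)) ->
  smooth_mx_at (hat a f) (row_mx t (cmap a x)).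
Proof. by move=> aX ax fs k l; exact: (hat_smooth (f := fun p => f p k l)). Qed.

Lemma smooth_fun_at_snd (f : X -> C) t x :
  smooth_fun_at f x -> smooth_fun_at (fun p : W => f p.2) (t, x).
Proof.
move=> fs c /atlas_time_chart[a aX ->] [_ ax].
apply: (smooth_at_comp (G := @rsubmx C 1 d n) (f := fun z => f (cinv a z))).
  move=> j; apply: (smooth_at_eq _ (smooth_at_coord (rshift d j) _)) => p.
  by rewrite mxE.
by rewrite row_mxKr; exact: fs.
Qed.

End Hat.

(** * The flow of the isomorphism and the tangent part of the first order terms *)

Section Comparison.
Variable R : realType.
Local Notation C := (Cplx R).
Variables (n r d : nat) (X : atlased R n) (E : vbundle R X r) (rho : R).
Hypothesis X_manifold : complex_manifold X.
Variables (D D' : deformation d E).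
Hypotheses (HD : is_deformation rho D) (HD' : is_deformation rho D').
Variables (T : trivialization D) (T' : trivialization D').
Hypotheses (HT : is_trivialization rho T) (HT' : is_trivialization rho T').
Variable F : tot D -> tot D'.
Hypothesis F_holomorphic : regular_map (@holomorphic R) setT F.
Hypothesis F_proj : forall y, proj (F y) = proj y.
Hypothesis F_incl : forall x, F (incl D x) = incl D' x.
Hypothesis rho_gt0 : 0 < rho.

Local Notation Delta := (@eball R d rho).
Local Notation W := (prod_atlased (Cspace R d) X).
Let X_charted := complex_manifold_charted X_manifold.
Let W_charted := time_charted d X_manifold.
Let D_charted := complex_manifold_charted (tot_manifold HD).
Let D'_charted := complex_manifold_charted (tot_manifold HD').

(* F read in the two smooth trivializations, as a family of maps X -> X. *)
Definition flow (p : W) : X := tr_retr T' (F (tr_map T p)).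

(** F commutes with the projections, so in the trivializations its time component is t and the
    retraction retains all of F. *)
Lemma tr_map_flow t x : Delta t ->
  tr_map T' (t, flow (t, x)) = F (tr_map T (t, x)).
Proof.
move=> tD; have [_ _ h _ _] := HT'; have [_ k _ _ _] := HT.
by have := h (F (tr_map T (t, x))); rewrite F_proj (k t x tD).1.
Qed.

Lemma flow0 x : flow (0, x) = x.
Proof.
have [_ _ _ _ [h _]] := HT; have [_ k' _ _ [h' _]] := HT'.
by rewrite /flow h F_incl -h' (k' 0 x (eball0 d rho_gt0)).2.
Qed.

Lemma flow_smooth t x : Delta t -> smooth_map_at flow (t, x).
Proof.
move=> tD; apply: (smooth_map_at_comp W_charted D'_charted (F :=
  fun p => F (tr_map T p))).
  apply: (smooth_map_at_comp W_charted D_charted).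
    exact: (tr_map_smooth X_manifold HD HT x tD).
  exact: (F_smooth HD HD' F_holomorphic).
have [[_ h] _ _ _ _] := HT'.
exact: (regular_smooth_map_at D'_charted X_charted openT h).
Qed.

Lemma flow_slice_smooth t x : Delta t ->
  smooth_map_at (fun y => flow (t, y)) x.
Proof.
move=> tD; apply: (smooth_map_at_comp X_charted W_charted).
  exact: (smooth_map_at_slice X_manifold t x).
exact: flow_smooth.
Qed.

(** The two rows are the components of the image vector under g_t. By the chain rule it acts on a
    coordinate of the second total space as the given vector acts on this coordinate composed with
    F, which is holomorphic on the first total space. *)
Lemma tangent01_flow t a x v w : Delta t -> atlas X a -> cdom a x ->
  cdom a (flow (t, x)) -> tangent01 T t a x v w ->
  tangent01 T' t a (flow (t, x))
    (\row_k tangent_act a v w (fun y => cmap a (flow (t, y)) 0 k) x)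
    (\row_k tangent_act a v w (fun y => (cmap a (flow (t, y)) 0 k)^*) x).
Proof.
move=> tD aX ax agx tg b bD bx k; rewrite tangent_actE cdir_tangent_op.
pose H z := cmap b (tr_map T' (t, cinv a z)) 0 k.
pose G z := cmap a (flow (t, cinv a z)).
have Gx : G (cmap a x) = cmap a (flow (t, x)) by rewrite /G chartK.
have Gs j : smooth_at (fun z => G z 0 j) (cmap a x).
  exact: ((flow_slice_smooth x tD).2 a aX agx j a aX ax).
have Hs : smooth_at H (G (cmap a x)).
  rewrite Gx; apply: ((tr_map_slice_smooth X_manifold HD' HT' (flow (t,
    x)) tD).2 b bD bx k a aX agx).
have HG : \forall z \near cmap a x, cmap b (F (tr_map T (t,
  cinv a z))) 0 k = H (G z).
  have h := chart_near X_charted aX ax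
    ((flow_slice_smooth x tD).1 _ (near_cdom X_charted aX agx)).
  apply: filterS h => z gz; rewrite /H /G.
  by rewrite [cinv a (cmap a _)](chartK X_charted aX gz) tr_map_flow.
have bFx : cdom b (F (tr_map T (t, x))) by rewrite -tr_map_flow.
have oO : open (F @^-1` cdom b).
  apply: open_comp; last exact: (cdom_open D'_charted bD).
  by move=> y _; have [h _] := F_smooth HD HD' F_holomorphic y.
have hol : regular_fun (@holomorphic R) (F @^-1` cdom b) (fun q =>
  cmap b (F q) 0 k).
  move=> c cD; have [_ h] := F_holomorphic.
  by have := h c b cD bD k; rewrite setIT.
have := tangent01_holomorphic X_manifold HD HT oO hol bFx tD aX ax tg.
rewrite (cdir_near _ HG) (cdir_comp Gs Hs) Gx big_split /= => h0.
rewrite -[RHS]h0; congr (_ + _); apply: eq_bigr => j _;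
  rewrite mxE tangent_actE //.
Qed.

Definition dolbeault_act (phi : chart R X n -> X -> 'M[C]_n) (a : chart R X n)
    (i : 'I_n) (f : X -> C) (x : X) : C :=
  pdbar a i f x + \sum_j phi a x i j * pd a j f x.

(** The vector d/dzbar^i + phi_i^j d/dz^j is pushed forward by g_t. The image is of type (0,1) for
    the second structure, so its components along the d/dz^k are given by phi' from those along the
    d/dzbar^l. *)
Lemma structure_equation t (phi phi' : chart R X n -> X -> 'M[C]_n) a x i k :
  Delta t -> represents_structure T t phi -> represents_structure T' t phi' ->
  atlas X a -> cdom a x -> cdom a (flow (t, x)) ->
  dolbeault_act phi a i (fun y => cmap a (flow (t, y)) 0 k) x =
  \sum_l dolbeault_act phi a i (fun y => (cmap a (flow (t, y)) 0 l)^*) x *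
         phi' a (flow (t, x)) l k.
Proof.
move=> tD Tphi Tphi' aX ax agx; pose w : 'rV[C]_n := delta_mx 0 i.
have actE f : tangent_act a (w *m phi a x) w f x = dolbeault_act phi a i f x.
  rewrite /tangent_act /dolbeault_act addrC; congr (_ + _).
    rewrite (bigD1 i)//= big1 ?addr0 => [|j ji]; rewrite mxE ?eqxx ?mul1r//.
    by rewrite (negPf ji) mul0r.
  by apply: eq_bigr => j _; rewrite -rowE mxE.
have tg : tangent01 T t a x (w *m phi a x) w by exact/(Tphi a x aX ax).
have /(Tphi' a (flow (t, x)) aX agx) := tangent01_flow tD aX ax agx tg.
move=> /rowP/(_ k); rewrite !mxE actE => ->; apply: eq_bigr => l _.
by rewrite mxE actE.
Qed.

Variable u : 'rV[C]_d.

(* The (1,0)-part of the initial velocity of the flow. *)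
Definition velocity (a : chart R X n) (x : X) : 'rV[C]_n :=
  \row_k rderive (fun s => cmap a (flow (rtoc s *: u, x)) 0 k) 0.

Definition flow_coord (a : chart R X n) (k : 'I_n) (p : W) : C :=
  cmap a (flow p) 0 k.

Let Delta0 : Delta 0. Proof. exact: eball0. Qed.

Lemma flow_coord_smooth a k x : atlas X a -> cdom a x ->
  smooth_at (hat a (flow_coord a k)) (row_mx 0 (cmap a x)).
Proof.
move=> aX ax; apply: hat_smooth => //.
by apply: (flow_smooth x Delta0).2 => //; rewrite flow0.
Qed.

Lemma velocity_hat a x k : atlas X a -> cdom a x ->
  velocity a x 0 k =
  cdir (time_op n u) (hat a (flow_coord a k)) (row_mx 0 (cmap a x)).
Proof. by move=> aX ax; rewrite mxE -rderive_hat. Qed.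

Lemma velocity_near a x k : atlas X a -> cdom a x ->
  \forall z \near cmap a x, velocity a (cinv a z) 0 k =
    cdir (time_op n u) (hat a (flow_coord a k)) (row_mx 0 z).
Proof.
move=> aX ax; have := cinvK_near X_charted aX ax; apply: filterS => z [az zK].
have h := velocity_hat k aX az; rewrite zK in h; exact: h.
Qed.

Lemma velocity_smooth a x k : atlas X a -> cdom a x ->
  smooth_at (fun z => velocity a (cinv a z) 0 k) (cmap a x).
Proof.
move=> aX ax; apply: (smooth_at_ext (f := fun z =>
    cdir (time_op n u) (hat a (flow_coord a k)) (row_mx 0 z))).
  have := velocity_near k aX ax; apply: filterS => z h; exact: esym h.
by apply: smooth_at_slice; apply: cdir_smooth; exact: flow_coord_smooth.
Qed.

(** Here the derivatives in space are exchanged with d/ds. *)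
Lemma cdir_velocity a x k L : atlas X a -> cdom a x ->
  cdir L (fun z => velocity a (cinv a z) 0 k) (cmap a x) =
  cdir (time_op n u) (cdir (slice_op d L) (hat a (flow_coord a k)))
    (row_mx 0 (cmap a x)).
Proof.
move=> aX ax; rewrite (cdir_near _ (velocity_near k aX ax)) cdir_slice cdirC//.
exact: flow_coord_smooth.
Qed.

Lemma near_flow_cdom a x : atlas X a -> cdom a x ->
  \forall s \near (0 : R), Delta (rtoc s *: u) /\ cdom a (flow (rtoc s *: u,
    x)).
Proof.
move=> aX ax; apply: filterI; first exact: eball_line.
apply: (near_time u (P := fun p => cdom a (flow p))).
by apply: (flow_smooth x Delta0).1; rewrite flow0; exact: near_cdom.
Qed.

Lemma graph_flow_coord a x : atlas X a -> cdom a x ->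
  \row_k hat a (flow_coord a k) (row_mx 0 (cmap a x)) = cmap a x.
Proof.
move=> aX ax; apply/rowP => k; rewrite mxE hatE chartK// /flow_coord.
by rewrite flow0.
Qed.

(** The graph of the flow in the chart a. It describes g_t as long as the flow stays in [cdom a],
    which at a given point it does for small s. *)
Definition moved (a : chart R X n) (p : 'rV[C]_(d + n)) : 'rV[C]_(d + n) :=
  row_mx (lsubmx p) (\row_k hat a (flow_coord a k) p).

Lemma hat_moved U a (f : W -> U) t x : atlas X a -> cdom a x ->
  cdom a (flow (t, x)) ->
  hat a f (moved a (row_mx t (cmap a x))) = f (t, flow (t, x)).
Proof.
move=> aX ax afx; rewrite hatE row_mxKl; congr (f (t, _)).
rewrite -[RHS](chartK X_charted aX afx); congr (cinv a _).
by apply/rowP => k; rewrite mxE hatE chartK.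
Qed.

Let row_flow_smooth a x (aX : atlas X a) (ax : cdom a x) k :
  smooth_at (fun p => (\row_l hat a (flow_coord a l) p) 0 k)
    (row_mx 0 (cmap a x)).
Proof.
apply: (smooth_at_eq _ (flow_coord_smooth k aX ax)) => p.
by rewrite mxE.
Qed.

Lemma hat_moved_smooth a (f : W -> C) x : atlas X a -> cdom a x ->
  smooth_at (hat a f) (row_mx 0 (cmap a x)) ->
  smooth_at (fun p => hat a f (moved a p)) (row_mx 0 (cmap a x)).
Proof.
move=> aX ax fs.
exact: (graph_comp_smooth (row_flow_smooth aX ax) (graph_flow_coord aX ax) fs).
Qed.

Lemma cdir_hat_moved a (f : W -> C) x : atlas X a -> cdom a x ->
  smooth_at (hat a f) (row_mx 0 (cmap a x)) ->
  cdir (time_op n u) (fun p => hat a f (moved a p)) (row_mx 0 (cmap a x)) =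
  cdir (time_op n u) (hat a f) (row_mx 0 (cmap a x)) +
  dirderive (fun y => f (0, cinv a y)) (velocity a x) (cmap a x).
Proof.
move=> aX ax fs.
rewrite (cdir_time_graph u (row_flow_smooth aX ax) (graph_flow_coord aX ax) fs).
congr (_ + _).
rewrite (_ : (fun y => f (0, cinv a y)) = (fun y => hat a f (row_mx 0 y)));
  last first.
  by apply/funext => y; rewrite hatE.
apply: (congr1 (fun v => dirderive (fun y =>
  hat a f (row_mx 0 y)) v (cmap a x))).
apply/rowP => k; rewrite velocity_hat// mxE.
by apply: cdir_eq => p; rewrite mxE.
Qed.

Variables (w w' : 'rV[C]_d -> form01 E).
Hypotheses (w_family : is_family rho w) (w'_family : is_family rho w').
Hypothesis w_structure : forall t, Delta t ->
  represents_structure T t (f1T (w t)).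
Hypothesis w'_structure : forall t, Delta t ->
  represents_structure T' t (f1T (w' t)).

Definition structure_coef (w : 'rV[C]_d ->
  form01 E) (a : chart R X n) i j (p : W) : C :=
  f1T (w p.1) a p.2 i j.

Lemma structure_coef_smooth (v : 'rV[C]_d ->
  form01 E) a i j x : is_family rho v ->
  atlas X a -> cdom a x ->
  smooth_at (hat a (structure_coef v a i j)) (row_mx 0 (cmap a x)).
Proof.
move=> [_ _ h _] aX ax; apply: hat_smooth => //.
apply: (regular_smooth_fun_at W_charted _ (h a aX i j)); last by split.
by apply: cylinder_open; exact: (cdom_open X_charted).
Qed.

Lemma structure_coef0 (v : 'rV[C]_d -> form01 E) a i j x : is_family rho v ->
  atlas X a -> cdom a x -> structure_coef v a i j (0, x) = 0.
Proof. by move=> [_ _ _ [_ h]] aX ax; rewrite /structure_coef /= h// mxE. Qed.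

Lemma first_order_structure a x i k : atlas X a -> cdom a x ->
  f1T (first_order u w') a x i k - f1T (first_order u w) a x i k =
  pdbar a i (fun y => velocity a y 0 k) x.
Proof.
move=> aX ax; pose z0 := cmap a x; pose p0 := row_mx (0 : 'rV[C]_d) z0.
pose phi i j := hat a (structure_coef w a i j).
pose phi' i j := hat a (structure_coef w' a i j).
pose g k := hat a (flow_coord a k).
pose gc k := hat a (fun p => (flow_coord a k p)^*).
have phis i' j : smooth_at (phi i' j) p0 by exact: structure_coef_smooth.
have phi's i' j : smooth_at (phi' i' j) p0 by exact: structure_coef_smooth.
have gs k' : smooth_at (g k') p0 by exact: flow_coord_smooth.
have gcs k' : smooth_at (gc k') p0 by exact: (smooth_at_conj (gs k')).
pose zb := slice_op d (dzbar_op R i);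
  pose z_ (j : 'I_n) := slice_op d (dz_op R j).
pose act f p := cdir zb f p + \sum_j phi i j p * cdir (z_ j) f p.
have actE t f : cdom a x -> act (hat a f) (row_mx t z0) =
    dolbeault_act (f1T (w t)) a i (fun y => f (t, y)) x.
  move=> _; rewrite /act /dolbeault_act /pdbar dzbarE cdir_hat; congr (_ + _).
  apply: eq_bigr => j _; rewrite /pd dzE cdir_hat /phi hatE /structure_coef /=.
  by rewrite /z0 chartK.
have acts f : smooth_at f p0 -> smooth_at (act f) p0.
  move=> fs; apply: smooth_atD; first exact: cdir_smooth.
  by apply: smooth_at_sum => j; apply: smooth_atM => //; exact: cdir_smooth.
have phi0 i' j : phi i' j p0 = 0.
  by rewrite /phi /p0 hatE /z0 chartK//; exact: structure_coef0.
(* Since phi vanishes at time 0, the product rule leaves only the term in which phi is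
   differentiated. *)
have dact f : smooth_at f p0 -> cdir (time_op n u) (act f) p0 =
    cdir (time_op n u) (cdir zb f) p0 +
    \sum_j cdir (time_op n u) (phi i j) p0 * cdir (z_ j) f p0.
  move=> fs; rewrite cdirD; last 2 first.
  - exact: cdir_smooth.
  - by apply: smooth_at_sum => j; apply: smooth_atM => //; exact: cdir_smooth.
  congr (_ + _); rewrite cdir_sum => [|j]; last first.
    by apply: smooth_atM => //; exact: cdir_smooth.
  apply: eq_bigr => j _; rewrite cdirM//; last exact: cdir_smooth.
  by rewrite phi0 mul0r addr0.
pose psi l := fun p => phi' l k (moved a p).
have psis l : smooth_at (psi l)
  p0 by exact: (hat_moved_smooth aX ax (phi's l k)).
have eqn : cdir (time_op n u) (act (g k)) p0 =
    cdir (time_op n u) (fun p => \sum_l act (gc l) p * psi l p) p0.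
  apply: cdir_time_near; have := near_flow_cdom aX ax;
    apply: filterS => s [sD afx].
  rewrite actE// (structure_equation i k sD (w_structure sD) (w'_structure sD)
    aX ax afx).
  apply: eq_bigr => l _; rewrite actE//; congr (_ * _).
  by rewrite /psi /phi' hat_moved.
have slice0 L k' : cdir (slice_op d L) (g k') p0 = cdir L (fun z => z 0 k') z0.
  rewrite -cdir_slice; apply: cdir_near; have := cinvK_near X_charted aX ax.
  apply: filterS => z [az zK]; rewrite /g hatE /flow_coord.
  by rewrite flow0 zK.
have slice0c L k' : cdir (slice_op d L) (gc k') p0 = cdir L (fun z =>
  (z 0 k')^*) z0.
  rewrite -cdir_slice; apply: cdir_near; have := cinvK_near X_charted aX ax.
  apply: filterS => z [az zK]; rewrite /gc hatE /flow_coord.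
  by rewrite flow0 zK.
have psi0 l : psi l p0 = 0.
  rewrite /psi /phi' hat_moved ?flow0//.
  exact: structure_coef0.
(* As phi' vanishes on the whole slice t = 0, the motion of the base point contributes nothing. *)
have dpsi l : cdir (time_op n u) (psi l) p0 = cdir (time_op n u) (phi' l k) p0.
  rewrite (cdir_hat_moved aX ax (phi's l k)).
  rewrite -[RHS]addr0; congr (_ + _).
  apply: etrans (dirderive_cst (0 : C) (velocity a x) (cmap a x)).
  apply: dirderive_near; have := cinvK_near X_charted aX ax.
  by apply: filterS => z [az _]; exact: structure_coef0.
(* At time 0 the flow is the identity and phi is zero; what remains is dbar_i of a conjugate
   coordinate. *)
have act0 l : act (gc l) p0 = (i == l)%:R.
  have s0 : \sum_j phi i j p0 * cdir (z_ j) (gc l) p0 = 0.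
    by apply: big1 => j _; rewrite (phi0 i j) mul0r.
  by rewrite /act s0 addr0 (slice0c (dzbar_op R i) l) dzbar_coord_conj.
have rhs : cdir (time_op n u) (fun p => \sum_l act (gc l) p * psi l p) p0 =
    cdir (time_op n u) (phi' i k) p0.
  apply: etrans (cdir_sum _ _ (fun l =>
    smooth_atM (acts _ (gcs l)) (psis l))) _.
  apply: etrans (sum_deltal i (fun l => cdir (time_op n u) (phi' l k) p0)).
  apply: eq_bigr => l _; apply: (etrans (cdirM _ (acts _ (gcs l)) (psis l))).
  by rewrite (psi0 l) mulr0 add0r (act0 l) (dpsi l).
have lhs : \sum_j cdir (time_op n u) (phi i j) p0 * cdir (z_ j) (g k) p0 =
    cdir (time_op n u) (phi i k) p0.
  apply: etrans (sum_deltar k (fun j => cdir (time_op n u) (phi i j) p0)).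
  by apply: eq_bigr => j _; rewrite (slice0 (dz_op R j) k) dz_coord.
(* The linearized equation now reads: the time derivative of dbar_i g^k, plus phi_1, equals
   phi'_1. *)
rewrite (dact _ (gs k)) rhs lhs in eqn.
rewrite /pdbar dzbarE (cdir_velocity k (dzbar_op R i) aX ax) -/p0.
rewrite !mxE (rderive_hat u X_manifold (structure_coef w' a i k) aX ax).
rewrite (rderive_hat u X_manifold (structure_coef w a i k) aX ax).
exact: (canLR (addrK _) (esym eqn)).
Qed.

End Comparison.
(** * First order terms and the gauge transformation *)

Section FirstOrderFrame.
Variable R : realType.
Local Notation C := (Cplx R).
Variables (n r d : nat) (X : atlased R n) (E : vbundle R X r) (rho : R).
Hypothesis X_manifold : complex_manifold X.
Hypothesis HE : holomorphic_vbundle E.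
Variables (D D' : deformation d E).
Hypotheses (HD : is_deformation rho D) (HD' : is_deformation rho D').
Variable T : trivialization D.
Hypothesis HT : is_trivialization rho T.
Variables (F : tot D -> tot D') (Phi : forall y, totE D y -> totE D' (F y)).
Hypothesis F_holomorphic : regular_map (@holomorphic R) setT F.
Hypothesis Phi_iso : bundle_iso (@holomorphic R) setT (@Phi).
Hypothesis rho_gt0 : 0 < rho.
Variables (nabla : connection E) (w : 'rV[C]_d -> form01 E) (u : 'rV[C]_d).
Hypothesis nabla_connection : is_connection nabla.
Hypothesis w_family : is_family rho w.
Hypothesis w_bundle : forall t, @eball R d rho t ->
  represents_bundle T nabla t (w t).
Variables (e : triv E r) (f : triv (totE D') r).
Hypotheses (eE : trivs E e) (fD : trivs (totE D') f).

Local Notation Delta := (@eball R d rho).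
Local Notation W := (prod_atlased (Cspace R d) X).
Local Notation M := (tr_mx T (@Phi) e f).
Local Notation dom := (tr_dom rho T F e f).
Let X_charted := complex_manifold_charted X_manifold.
Let W_charted := time_charted d X_manifold.
Let Delta0 : Delta 0. Proof. exact: eball0. Qed.

Lemma tr_mx_hat_smooth a t x : atlas X a -> cdom a x -> dom (t, x) ->
  smooth_mx_at (hat a M) (row_mx t (cmap a x)).
Proof.
move=> aX ax tx; apply: hat_mx_smooth => // k l.
exact: (tr_mx_smooth X_manifold HE HD HD' HT F_holomorphic Phi_iso eE fD).
Qed.

Lemma tr_mx_slice_smooth a t x : atlas X a -> cdom a x -> dom (t, x) ->
  smooth_mx_at (fun z => M (t, cinv a z)) (cmap a x).
Proof.
move=> aX ax tx k l.
apply: (smooth_at_eq _ (smooth_at_slice (tr_mx_hat_smooth aX ax tx k l))) => z.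
by rewrite hatE.
Qed.

Lemma connection_smooth a j x : atlas X a -> cdom a x -> tdom e x ->
  smooth_mx_at (fun z => conn10 nabla a e j (cinv a z)) (cmap a x).
Proof.
move=> aX ax ex k l; have [h _] := nabla_connection.
have [s _] := h a e aX eE j k l.
apply: (regular_smooth_fun_at X_charted _ s) => //.
by apply: openI; [exact: (cdom_open X_charted)|exact: (tdom_open HE)].
Qed.

Lemma connection_hat_smooth a j t x : atlas X a -> cdom a x -> tdom e x ->
  smooth_mx_at (hat a (fun p : W =>
    conn10 nabla a e j p.2)) (row_mx t (cmap a x)).
Proof.
move=> aX ax ex k l; have [h _] := nabla_connection.
have [s _] := h a e aX eE j k l.
apply: (hat_smooth (f := fun p : W => conn10 nabla a e j p.2 k l)) => //.
apply: (smooth_fun_at_snd (f := fun y => conn10 nabla a e j y k l)).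
apply: (regular_smooth_fun_at X_charted _ s) => //.
by apply: openI; [exact: (cdom_open X_charted)|exact: (tdom_open HE)].
Qed.

Lemma first_form_hat_smooth a i x : atlas X a -> cdom a x -> tdom e x ->
  smooth_mx_at (hat a (fun p : W =>
    f1Q (w p.1) a e i p.2)) (row_mx 0 (cmap a x)).
Proof.
move=> aX ax ex; have [_ h _ _] := w_family.
apply: hat_mx_smooth => // k l.
apply: (regular_smooth_fun_at W_charted _ (h a e aX eE i k l)); last by split.
by apply: cylinder_open; apply: openI;
  [exact: (cdom_open X_charted)|exact: (tdom_open HE)].
Qed.

(** The frame equation at t = 0, where A and phi vanish. *)
Lemma dbar_tr_mx0 a i x : atlas X a -> cdom a x -> dom (0, x) ->
  mpdbar a i (fun y => M (0, y)) x = 0.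
Proof.
move=> aX ax dx; have [_ _ _ [q0 s0]] := w_family; have [_ ex _] := dx.
have := frame_equation X_manifold HE HD HD' HT F_holomorphic Phi_iso eE fD
  i (w_bundle Delta0) Delta0 aX ax dx.
rewrite q0// mulmx0 big1 ?addr0 => [<- //|j _].
by rewrite s0// mxE scale0r.
Qed.

Lemma near_time_dom x : dom (0, x) ->
  \forall s \near (0 : R), dom (rtoc s *: u, x).
Proof.
move=> dx; apply: (near_time u (P := fun p => dom p)).
exact: (near_tr_dom X_manifold HE HD HD' HT F_holomorphic eE fD).
Qed.

(** The derivative of the frame equation at s = 0. Because A_0 and phi_0 vanish, M and the bracket
    d_j M - M Gamma_j enter with their values at t = 0; in the term dbar_i M the two derivatives are
    exchanged. *)
Lemma first_order_frame a i x : atlas X a -> cdom a x -> dom (0, x) ->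
  M (0, x) *m f1Q (first_order u w) a e i x =
  cdir_mx (dzbar_op R i) (fun z =>
    cdir_mx (time_op n u) (hat a M) (row_mx 0 z)) (cmap a x)
  + \sum_j f1T (first_order u w) a x i j *:
     (mpd a j (fun y => M (0, y)) x - M (0, x) *m conn10 nabla a e j x).
Proof.
move=> aX ax dx; have [_ ex _] := dx.
pose z0 := cmap a x; pose p0 := row_mx (0 : 'rV[C]_d) z0.
pose Mh := hat a M; pose A := hat a (fun p : W => f1Q (w p.1) a e i p.2).
pose phi j := hat a (structure_coef w a i j).
pose G j := hat a (fun p : W => conn10 nabla a e j p.2).
have Ms : smooth_mx_at Mh p0 by exact: tr_mx_hat_smooth.
have As : smooth_mx_at A p0 by exact: first_form_hat_smooth.
have ps j : smooth_at (phi j)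
  p0 by exact: (structure_coef_smooth X_manifold rho_gt0 i j w_family aX ax).
have Gs j : smooth_mx_at (G j) p0 by exact: connection_hat_smooth.
have x0 : cinv a z0 = x by rewrite /z0 chartK.
have A0 : A p0 = 0.
  by have [_ _ _ [q0 _]] := w_family; rewrite /A /p0 hatE x0 /= q0.
have phi0 j : phi j p0 = 0.
  by rewrite /phi /p0 hatE x0; exact: (structure_coef0 i j w_family aX ax).
pose B j p := cdir_mx (slice_op d (dz_op R j)) Mh p - Mh p *m G j p.
have Bs j : smooth_mx_at (B j) p0.
  by apply: smooth_mxB; [exact: cdir_mx_smooth|exact: smooth_mxM].
pose zb := slice_op d (dzbar_op R i).
have eqn : cdir_mx (time_op n u) (fun p => Mh p *m A p) p0 =
    cdir_mx (time_op n u) (fun p =>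
      cdir_mx zb Mh p + \sum_j phi j p *: B j p) p0.
  apply: cdir_mx_time_near; have := near_time_dom dx; apply: filterS => s ds.
  have [sD _ _] := ds.
  have fe := frame_equation X_manifold HE HD HD' HT F_holomorphic Phi_iso eE fD
    i (w_bundle sD) sD aX ax ds.
  have e1 : Mh (row_mx (rtoc s *: u) z0) *m A (row_mx (rtoc s *: u) z0) =
      M (rtoc s *: u, x) *m f1Q (w (rtoc s *: u)) a e i x.
    by rewrite /Mh /A !hatE x0.
  have e2 : mpdbar a i (fun y => M (rtoc s *: u, y)) x =
      cdir_mx zb Mh (row_mx (rtoc s *: u) z0).
    by rewrite mpdbarE (cdir_mx_hat a M).
  have e3 j : f1T (w (rtoc s *: u)) a x i j *:
      (mpd a j (fun y => M (rtoc s *: u, y)) x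
       - M (rtoc s *: u, x) *m conn10 nabla a e j x) =
      phi j (row_mx (rtoc s *: u) z0) *: B j (row_mx (rtoc s *: u) z0).
    by rewrite /phi /B /Mh /G !hatE x0 mpdE (cdir_mx_hat a M).
  apply: (etrans e1); apply: (etrans fe); apply: (congr2 +%R e2).
  by apply: eq_bigr => j _; exact: e3.
move: eqn; rewrite (cdir_mxM _ Ms As) A0 mulmx0 add0r.
rewrite (cdir_mxD _ (cdir_mx_smooth zb Ms)
  (smooth_mx_sum (fun j => smooth_mxZ (ps j) (Bs j)))).
rewrite (cdir_mx_sum _ (fun j => smooth_mxZ (ps j) (Bs j))).
rewrite (cdir_mxC _ _ Ms).
have -> : cdir_mx zb (cdir_mx (time_op n u) Mh) p0 =
  cdir_mx (dzbar_op R i) (fun z => cdir_mx (time_op n u) Mh (row_mx 0 z)) z0.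
  by rewrite cdir_mx_slice.
have -> : cdir_mx (time_op n u) A p0 = f1Q (first_order u w) a e i x.
  apply/matrixP => k l; rewrite !mxE.
  by rewrite (rderive_hat u X_manifold (fun p : W =>
    f1Q (w p.1) a e i p.2 k l) aX ax).
have -> : Mh p0 = M (0, x) by rewrite /Mh /p0 hatE x0.
have phi1 j : cdir (time_op n u) (phi j) p0 = f1T (first_order u w) a x i j.
  by rewrite [RHS]mxE (rderive_hat u X_manifold (structure_coef w a i j) aX ax).
have B0 j : B j p0 = mpd a j (fun y =>
  M (0, y)) x - M (0, x) *m conn10 nabla a e j x.
  by rewrite /B /Mh /G !hatE x0 mpdE (cdir_mx_hat a M).
have E0 j : phi j p0 *: cdir_mx (time_op n u) (B j) p0 = 0 by rewrite (phi0 j)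
  scale0r.
have term j : cdir_mx (time_op n u) (fun p => phi j p *: B j p) p0 =
    f1T (first_order u w) a x i j *:
     (mpd a j (fun y => M (0, y)) x - M (0, x) *m conn10 nabla a e j x).
  apply: (etrans (cdir_mxZ _ (ps j) (Bs j))).
  by rewrite (E0 j) addr0 (phi1 j) (B0 j).
move=> h; apply: (etrans h); apply: congr1.
by apply: eq_bigr => j _; exact: term.
Qed.

End FirstOrderFrame.

(** * Dependence of M on the local frames *)

Section ChangeOfFrames.
Variable R : realType.
Local Notation C := (Cplx R).
Variables (n r d : nat) (X : atlased R n) (E : vbundle R X r) (rho : R).
Hypothesis HE : holomorphic_vbundle E.
Variables (D D' : deformation d E).
Hypothesis HD' : is_deformation rho D'.
Variable T : trivialization D.
Hypothesis HT : is_trivialization rho T.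
Variables (F : tot D -> tot D') (Phi : forall y, totE D y -> totE D' (F y)).
Hypothesis Phi_iso : bundle_iso (@holomorphic R) setT (@Phi).
Local Notation W := (prod_atlased (Cspace R d) X).

Lemma tr_total_linear (p : W) : @eball R d rho p.1 ->
  linear (tr_total T (@Phi) (p := p)).
Proof.
move=> pD c v1 v2; have [h _] := Phi_iso; have [l _] := h (tr_map T p) I.
by rewrite /tr_total (tr_mapE_linear HT pD) l.
Qed.

Lemma tr_mx_change_e (e e2 : triv E r) (f : triv (totE D') r) (p : W) :
  trivs E e2 -> trivs (totE D') f -> tr_dom rho T F e2 f p ->
  tr_mx T (@Phi) e f p = tr_mx T (@Phi) e2 f p *m transition e e2 p.2.
Proof.
move=> e2E fD [pD ep fp].
apply: (@coordmx_comp R _ _ _ _ X X (tot D') E E (totE D') e e2 f _ _ _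
   (fun v => v) (tr_total T (@Phi) (p := p))) => //.
  exact: totE_holomorphic HD'.
exact: tr_total_linear.
Qed.

Lemma tr_mx_change_f (e : triv E r) (f g : triv (totE D') r) (p : W) :
  trivs (totE D') f -> trivs (totE D') g -> tr_dom rho T F e f p ->
  tdom g (F (tr_map T p)) ->
  tr_mx T (@Phi) e g p = transition f g (F (tr_map T p)) *m tr_mx T (@Phi)
    e f p.
Proof.
move=> fD gD [pD ep fp] gp; have HED' := totE_holomorphic HD'.
by apply: (@coordmx_comp R _ _ _ _ X (tot D') (tot D') E (totE D') (totE D')
  e f g
  _ _ _ (tr_total T (@Phi) (p := p)) (fun v => v)).
Qed.

End ChangeOfFrames.

Lemma dirderive_holomorphic (R : realType) n (f : 'rV[Cplx R]_n -> Cplx R) v x :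
  smooth_at f x -> (forall j, dzbar j f x = 0) ->
  dirderive f v x = \sum_j v 0 j * dz j f x.
Proof.
move=> fx fz; rewrite dirderive_wirtinger//; apply: eq_bigr => j _.
by rewrite fz mulr0 addr0.
Qed.

(** * The form eta: independence of choices, smoothness and its image under dbar *)

Section Gauge.
Variable R : realType.
Local Notation C := (Cplx R).
Variables (n r d : nat) (X : atlased R n) (E : vbundle R X r) (rho : R).
Hypothesis X_manifold : complex_manifold X.
Hypothesis HE : holomorphic_vbundle E.
Variables (D D' : deformation d E).
Hypotheses (HD : is_deformation rho D) (HD' : is_deformation rho D').
Variables (T : trivialization D) (T' : trivialization D').
Hypotheses (HT : is_trivialization rho T) (HT' : is_trivialization rho T').
Variables (F : tot D -> tot D') (Phi : forall y, totE D y -> totE D' (F y)).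
Hypothesis F_holomorphic : regular_map (@holomorphic R) setT F.
Hypothesis Phi_iso : bundle_iso (@holomorphic R) setT (@Phi).
Hypothesis F_proj : forall y, proj (F y) = proj y.
Hypothesis F_incl : forall x, F (incl D x) = incl D' x.
Hypothesis Phi_incl : forall x (v : E x),
  total_point (Phi (inclE D v)) = total_point (inclE D' v).
Hypothesis rho_gt0 : 0 < rho.
Variables (nabla : connection E) (w w' : 'rV[C]_d -> form01 E) (u : 'rV[C]_d).
Hypothesis nabla_connection : is_connection nabla.
Hypothesis nabla01 : forall a e i x, atlas X a -> trivs E e ->
  cdom a x -> tdom e x -> conn01 nabla a e i x = 0.
Hypotheses (w_family : is_family rho w) (w'_family : is_family rho w').
Hypothesis w_structure : forall t, @eball R d rho t ->
  represents_structure T t (f1T (w t)).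
Hypothesis w'_structure : forall t, @eball R d rho t ->
  represents_structure T' t (f1T (w' t)).
Hypothesis w_bundle : forall t, @eball R d rho t ->
  represents_bundle T nabla t (w t).
Hypothesis w'_bundle : forall t, @eball R d rho t ->
  represents_bundle T' nabla t (w' t).

Local Notation Delta := (@eball R d rho).
Local Notation W := (prod_atlased (Cspace R d) X).
Local Notation M := (tr_mx T (@Phi)).
Local Notation M' := (tr_mx T' (F := fun y => y) (fun y (v : totE D' y) => v)).
Local Notation dom := (tr_dom rho T F).
Local Notation dom' := (tr_dom rho T' (fun y => y)).
Local Notation fl := (flow T T' F).
Local Notation vel := (velocity T T' F u).
Let X_charted := complex_manifold_charted X_manifold.
Let W_charted := time_charted d X_manifold.
Let D_charted := complex_manifold_charted (tot_manifold HD).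
Let D'_charted := complex_manifold_charted (tot_manifold HD').
Let HED' := totE_holomorphic HD'.
Let idF := id_holomorphic (tot_manifold HD').
Let idPhi := id_bundle_iso HED'.
Let Delta0 : Delta 0. Proof. exact: eball0. Qed.
Implicit Types (a b : chart R X n) (e : triv E r) (f g : triv (totE D') r).

Lemma tr_map0 x : tr_map T (0, x) = incl D x.
Proof. by have [_ _ _ _ [h _]] := HT. Qed.

Lemma tr_map0' x : tr_map T' (0, x) = incl D' x.
Proof. by have [_ _ _ _ [h _]] := HT'. Qed.

Definition frames_at e f x : Prop := tdom e x /\ tdom f (incl D' x).

Lemma frames_dom e f x : frames_at e f x -> dom e f (0, x).
Proof. by move=> [ex fx]; split=> //; rewrite tr_map0 F_incl. Qed.

Lemma frames_dom' e f x : frames_at e f x -> dom' e f (0, x).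
Proof. by move=> [ex fx]; split=> //; rewrite tr_map0'. Qed.

Lemma near_frames e f x : trivs E e -> trivs (totE D') f -> frames_at e f x ->
  \forall y \near x, frames_at e f y.
Proof.
move=> eE fD /frames_dom' ed.
have := near_tr_dom_slice X_manifold HE HD' HD' HT' idF eE fD ed.
by apply: filterS => y [_ ey fy]; split=> //; rewrite tr_map0' in fy.
Qed.

Lemma tr_mx0 e f x : M e f (0, x) = M' e f (0, x).
Proof.
have [_ _ _ _ [_ h]] := HT; have [_ _ _ _ [_ h']] := HT'.
(* The vectors to be compared lie in fibres over points that are only provably equal. Functions
   defined on the total spaces make a transport between the fibres unnecessary. *)
pose tf (p : total (totE D')) := tmap f (projT1 p) (projT2 p).
pose tPhi (p : total (totE D)) : total (totE D') :=
  total_point (Phi (projT2 p)).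
apply/matrixP => i j; rewrite !mxE; set v := tinv e x _.
have := congr1 tf (congr1 tPhi (h x v)).
have -> : tf (tPhi (total_point (inclE D v)))
  = tf (total_point (tr_mapE T' (p := (0, x)) v)).
  by rewrite h'; congr tf; exact: Phi_incl.
by move=> /(congr1 (fun c : 'cV[C]_r => c i 0)).
Qed.

(** The two matrices have a common target fibre, but their source fibres are those of E at g_t x and
    at x. Hence the derivative transforms homogeneously under a change of f and inhomogeneously
    under a change of e. *)
Definition variation e f x : 'M[C]_r :=
  \matrix_(k, l) rderive (fun s =>
    (M' e f (rtoc s *: u, fl (rtoc s *: u, x)) - M e f (rtoc s *: u, x)) k l) 0.

Let mv a := moved T T' F a.

Lemma M_hat_smooth e f a x : trivs E e -> trivs (totE D') f ->
  frames_at e f x ->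
  atlas X a -> cdom a x -> smooth_mx_at (hat a (M e f)) (row_mx 0 (cmap a x)).
Proof.
move=> eE fD /frames_dom ed aX ax.
exact: (tr_mx_hat_smooth X_manifold HE HD HD' HT F_holomorphic Phi_iso eE fD aX
  ax ed).
Qed.

Lemma M'_hat_smooth e f a x : trivs E e -> trivs (totE D') f ->
  frames_at e f x ->
  atlas X a -> cdom a x -> smooth_mx_at (hat a (M' e f)) (row_mx 0 (cmap a x)).
Proof.
move=> eE fD /frames_dom' ed aX ax.
exact: (tr_mx_hat_smooth X_manifold HE HD' HD' HT' idF idPhi eE fD aX ax ed).
Qed.

Lemma M'_moved_smooth e f a x : trivs E e -> trivs (totE D') f ->
  frames_at e f x ->
  atlas X a -> cdom a x ->
  smooth_mx_at (fun p => hat a (M' e f) (mv a p)) (row_mx 0 (cmap a x)).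
Proof.
move=> eE fD efx aX ax k l.
exact: (hat_moved_smooth X_manifold HD HD' HT HT' F_holomorphic F_incl rho_gt0
  (f := fun p => M' e f p k l) aX ax (M'_hat_smooth eE fD efx aX ax k l)).
Qed.

Lemma variation_hat e f a x : atlas X a -> cdom a x ->
  variation e f x = cdir_mx (time_op n u)
    (fun p => hat a (M' e f) (mv a p) - hat a (M e f) p) (row_mx 0 (cmap a x)).
Proof.
move=> aX ax; apply/matrixP => k l; rewrite !mxE -rderive_slice.
apply: rderive_near.
have := near_flow_cdom X_manifold HD HD' HT HT' F_holomorphic F_incl rho_gt0 u
  aX ax.
apply: filterS => s [_ afx].
by rewrite (hat_moved X_manifold (M' e f) aX ax afx) hatE (chartK X_charted).
Qed.

(** The chain rule for the flow adds the derivative of M'_0 along the velocity; as dbar M'_0 = 0,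
    only its (1,0)-part contributes. *)
Lemma variation_local e f a x : trivs E e -> trivs (totE D') f ->
  frames_at e f x -> atlas X a -> cdom a x ->
  variation e f x =
  cdir_mx (time_op n u) (hat a (M' e f)) (row_mx 0 (cmap a x)) -
  cdir_mx (time_op n u) (hat a (M e f)) (row_mx 0 (cmap a x)) +
  \sum_j vel a x 0 j *: mpd a j (fun y => M' e f (0, y)) x.
Proof.
move=> eE fD efx aX ax; rewrite (variation_hat e f aX ax).
rewrite (cdir_mxB _ (M'_moved_smooth eE fD efx aX ax)
  (M_hat_smooth eE fD efx aX ax)).
rewrite addrAC; congr (_ - _); apply/matrixP => k l; rewrite !mxE summxE.
have Ms := M'_hat_smooth eE fD efx aX ax k l.
apply: (etrans (cdir_hat_moved X_manifold HD HD' HT HT' F_holomorphic F_incl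
  rho_gt0 u
  (f := fun p => M' e f p k l) aX ax Ms)).
congr (_ + _).
have ed := frames_dom' efx.
have Mss := tr_mx_slice_smooth X_manifold HE HD' HD' HT' idF idPhi eE fD aX ax
  ed k l.
rewrite (dirderive_holomorphic _ Mss) => [|j].
  by apply: eq_bigr => j _; rewrite [RHS]mxE mpdE [X in _ = _ * X]mxE dzE.
have := dbar_tr_mx0 X_manifold HE HD' HD' HT' idF idPhi rho_gt0 w'_family
  w'_bundle
  eE fD j aX ax ed.
by move/matrixP/(_ k l); rewrite mxE [RHS]mxE.
Qed.

(** Both matrices are multiplied by the same transition matrix H, taken at their common point of the
    total space. Their difference vanishes at t = 0, so no derivative of H appears. *)
Lemma variation_change_f e f g x : trivs E e -> trivs (totE D') f ->
  trivs (totE D') g -> frames_at e f x -> frames_at e g x ->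
  variation e g x = transition f g (incl D' x) *m variation e f x.
Proof.
move=> eE fD gD efx egx; have [a aX ax] := X_charted.2 x.
have Ms := smooth_mxB (M'_moved_smooth eE fD efx aX ax)
  (M_hat_smooth eE fD efx aX ax).
rewrite !(variation_hat _ _ aX ax).
pose H q := transition f g (F (tr_map T q)).
have [ex fx] := efx; have [_ gx] := egx.
have FT0 : F (tr_map T (0, x)) = incl D' x by rewrite tr_map0 F_incl.
have Hs : smooth_mx_at (hat a H) (row_mx 0 (cmap a x)).
  apply: hat_mx_smooth => // k l.
  have [_ _ _ tr] := HED'.
  apply: (smooth_fun_at_comp W_charted D'_charted (F := fun q => F (tr_map T q))
    (f := fun y => transition f g y k l)).
    apply: (smooth_map_at_comp W_charted D_charted).
      exact: (tr_map_smooth X_manifold HD HT x Delta0).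
    exact: (F_smooth HD HD' F_holomorphic).
  apply: (holomorphic_smooth_fun_at D'_charted _ (tr f g fD gD k l)).
    by apply: openI; exact: (tdom_open HED').
  by rewrite FT0.
have key : cdir_mx (time_op n u) (fun p =>
  hat a (M' e g) (mv a p) - hat a (M e g) p)
    (row_mx 0 (cmap a x)) =
  cdir_mx (time_op n u)
    (fun p => hat a H p *m (hat a (M' e f) (mv a p) - hat a (M e f) p))
    (row_mx 0 (cmap a x)).
  apply: cdir_mx_time_near.
  have n1 := near_flow_cdom X_manifold HD HD' HT HT' F_holomorphic F_incl
    rho_gt0 u aX ax.
  have n2 := near_time_dom X_manifold HE HD HD' HT F_holomorphic u eE fD
    (frames_dom efx).
  have n3 := near_time_dom X_manifold HE HD HD' HT F_holomorphic u eE gD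
    (frames_dom egx).
  have n4 : \forall s \near (0 : R), tdom e (fl (rtoc s *: u, x)).
    apply: (near_time u (P := fun p => tdom e (fl p))).
    have [fc _] := flow_smooth X_manifold HD HD' HT HT' F_holomorphic x Delta0.
    apply: fc; rewrite (flow0 HT HT' F_incl rho_gt0).
    exact: (open_nbhs_nbhs (conj (tdom_open HE eE) ex)).
  apply: filterS (filterI (filterI n1 n4) (filterI n2 n3)) =>
    s [[[sD afx] efl] [ds gs]].
  rewrite !(hat_moved X_manifold _ aX ax afx) !hatE (chartK X_charted aX ax).
  have [_ _ fs] := ds; have [_ _ gs'] := gs.
  have TF := tr_map_flow HT HT' F_proj x sD.
  have d'f : dom' e f (rtoc s *: u, fl (rtoc s *: u, x)) by split=> //;
    rewrite TF.
  rewrite (tr_mx_change_f HD' (F :=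
    fun y => y) (fun y (v : totE D' y) => v) fD gD d'f) ?TF//.
  rewrite (tr_mx_change_f HD' (@Phi) fD gD ds gs') /H.
  by rewrite -mulmxBr.
rewrite key (cdir_mxM _ Hs Ms).
have -> : hat a (M' e f) (mv a (row_mx 0 (cmap a x))) - hat a (M e f)
  (row_mx 0 (cmap a x)) = 0.
  have f0 := flow0 HT HT' F_incl rho_gt0 x.
  rewrite (hat_moved X_manifold (M' e f) aX ax)
    f0// hatE (chartK X_charted aX ax).
  by rewrite tr_mx0 subrr.
by rewrite mulmx0 add0r hatE (chartK X_charted aX ax) /H FT0.
Qed.

(** M is multiplied by the transition matrix at x, but M' by the one at g_t x; the latter moves with
    the flow, and its derivative along the velocity is the additional term. *)
Lemma variation_change_e e e2 f x a : trivs E e -> trivs E e2 ->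
  trivs (totE D') f ->
  frames_at e f x -> frames_at e2 f x -> atlas X a -> cdom a x ->
  variation e f x = variation e2 f x *m transition e e2 x +
    M' e2 f (0, x) *m \sum_j vel a x 0 j *: mpd a j (transition e e2) x.
Proof.
move=> eE e2E fD efx e2fx aX ax; have [ex fx] := efx; have [e2x _] := e2fx.
have timeE (D1 : deformation d E) (T1 : trivialization D1) (F1 : tot D1 ->
  tot D')
    (Phi1 : forall y, totE D1 y -> totE D' (F1 y)) : is_trivialization rho T1 ->
    bundle_iso (@holomorphic R) setT Phi1 ->
    (\forall s \near (0 : R), tr_dom rho T1 F1 e2 f (rtoc s *: u, x)) ->
    smooth_mx_at (hat a (tr_mx T1 Phi1 e2 f)) (row_mx 0 (cmap a x)) ->
    cdir_mx (time_op n u) (hat a (tr_mx T1 Phi1 e f)) (row_mx 0 (cmap a x)) =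
    cdir_mx (time_op n u) (hat a (tr_mx T1 Phi1 e2 f)) (row_mx 0 (cmap a x))
      *m transition e e2 x.
  move=> HT1 Phi1_iso near1 s1.
  have -> : cdir_mx (time_op n u) (hat a (tr_mx T1 Phi1 e f))
    (row_mx 0 (cmap a x)) =
    cdir_mx (time_op n u) (fun p =>
      hat a (tr_mx T1 Phi1 e2 f) p *m transition e e2 x)
     (row_mx 0 (cmap a x)).
    apply: cdir_mx_time_near; apply: filterS near1 => s ds.
    by rewrite !hatE (chartK X_charted aX ax)
      (tr_mx_change_e HE HD' HT1 Phi1_iso e e2E fD ds).
  by rewrite (cdir_mxM _ s1 (smooth_mx_cst _ _)) cdir_mx_cst mulmx0 addr0.
have n1 := near_time_dom X_manifold HE HD HD' HT F_holomorphic u e2E fD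
  (frames_dom e2fx).
have n2 := near_time_dom X_manifold HE HD' HD' HT' idF u e2E fD
  (frames_dom' e2fx).
rewrite (variation_local eE fD efx aX ax) (variation_local e2E fD e2fx aX ax).
rewrite (timeE _ _ _ _ HT Phi_iso n1 (M_hat_smooth e2E fD e2fx aX ax)).
rewrite (timeE _ _ _ _ HT' idPhi n2 (M'_hat_smooth e2E fD e2fx aX ax)).
rewrite mulmxDl mulmxBl -[RHS]addrA; congr (_ + _).
rewrite mulmx_suml mulmx_sumr -big_split; apply: eq_bigr => j _ /=.
rewrite -scalemxAl -scalemxAr -scalerDr; congr (_ *: _).
have nE : \forall z \near cmap a x, M' e f (0, cinv a z) =
    M' e2 f (0, cinv a z) *m transition e e2 (cinv a z).
  apply: (chart_near X_charted aX ax
    (P := fun y => M' e f (0, y) = M' e2 f (0, y) *m transition e e2 y)).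
  have := near_frames e2E fD e2fx; apply: filterS => y /frames_dom' dy.
  exact: (tr_mx_change_e HE HD' HT' idPhi e e2E fD dy).
rewrite !mpdE (cdir_mx_near _ nE).
have s1 := tr_mx_slice_smooth X_manifold HE HD' HD' HT' idF idPhi e2E fD aX ax
  (frames_dom' e2fx).
have s2 : smooth_mx_at (fun z => transition e e2 (cinv a z)) (cmap a x).
  move=> k l; have [_ _ _ tr] := HE.
  apply: (holomorphic_smooth_fun_at X_charted _ (tr e e2 eE e2E k l)) => //.
  by apply: openI; exact: (tdom_open HE).
by rewrite (cdir_mxM _ s1 s2) (chartK X_charted aX ax).
Qed.

(** The change of charts is holomorphic, so only its complex Jacobian acts and the (1,0)-part of the
    velocity is a vector field of its own. *)
Lemma velocity_change a b x : atlas X a -> atlas X b -> cdom a x -> cdom b x ->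
  vel b x = vel a x *m jac a (cmap b) x.
Proof.
move=> aX bX ax bx; apply/rowP => k.
pose h (q : W) := cmap b q.2 0 k.
have cs := cmap_smooth_fun_at k X_manifold bX bx.
have hs : smooth_at (hat a h) (row_mx 0 (cmap a x)).
  by apply: hat_smooth => //;
    exact: (smooth_fun_at_snd (f := fun y => cmap b y 0 k)).
rewrite (velocity_hat X_manifold T T' F u k bX bx).
rewrite -(rderive_hat u X_manifold (flow_coord T T' F b k) bX bx).
rewrite (rderive_hat u X_manifold (flow_coord T T' F b k) aX ax).
have -> : cdir (time_op n u) (hat a (flow_coord T T' F b k))
  (row_mx 0 (cmap a x)) =
    cdir (time_op n u) (fun p => hat a h (mv a p)) (row_mx 0 (cmap a x)).
  apply: cdir_time_near.
  have := near_flow_cdom X_manifold HD HD' HT HT' F_holomorphic F_incl rho_gt0 u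
    aX ax.
  apply: filterS => s [_ afx].
  by rewrite (hat_moved X_manifold h aX ax afx) hatE (chartK X_charted aX ax).
rewrite (cdir_hat_moved X_manifold HD HD' HT HT' F_holomorphic F_incl rho_gt0 u
  aX ax hs).
have -> : cdir (time_op n u) (hat a h) (row_mx 0 (cmap a x)) = 0.
  apply: etrans (cdir_cst (time_op n u) (cmap b x 0 k) (row_mx 0 (cmap a x))).
  apply: cdir_time_near; apply: all_near => s.
  by rewrite hatE (chartK X_charted aX ax).
rewrite add0r dirderive_holomorphic => [| |j]; last 2 first.
- exact: (cs a aX ax).
- have [_ _ _ _ tr] := X_manifold; have [_ hz] := tr a b aX bX k.
  by apply: hz; exists x.
by rewrite [RHS]mxE; apply: eq_bigr => j _; congr (_ * _); rewrite mxE.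
Qed.

Lemma jac_self a x : atlas X a -> cdom a x -> jac a (cmap a) x = 1%:M.
Proof.
move=> aX ax; apply/matrixP => i k;
  rewrite !mxE /pd dzE -(dz_coord i k (cmap a x)).
apply: cdir_near; have := cinvK_near X_charted aX ax.
by apply: filterS => z [_ ->].
Qed.

Lemma transition_ee_dz e a j x : trivs E e -> tdom e x -> atlas X a ->
  cdom a x ->
  mpd a j (transition e e) x = 0.
Proof.
move=> eE ex aX ax; rewrite mpdE.
apply: etrans (cdir_mx_cst (dz_op R j) (1%:M : 'M[C]_r) (cmap a x)).
apply: cdir_mx_near.
apply: (chart_near X_charted aX ax (P := fun y => transition e e y = 1%:M)).
by apply: (near_open (tdom_open HE eE) ex) => y ey; exact: transition1.
Qed.

(** For a fixed frame e the transformation law of Gamma has no derivative term, so xi^j Gamma_j is a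
    contraction of tensors and independent of the chart. *)
Lemma velocity_connection a b e x : trivs E e -> tdom e x ->
  atlas X a -> atlas X b -> cdom a x -> cdom b x ->
  \sum_j vel b x 0 j *: conn10 nabla b e j x =
  \sum_j vel a x 0 j *: conn10 nabla a e j x.
Proof.
move=> eE ex aX bX ax bx; have [_ h] := nabla_connection.
have conn i : conn10 nabla a e i x =
    \sum_k jac a (cmap b) x i k *: conn10 nabla b e k x.
  have [+ _] := h a b e e aX bX eE eE x ax bx ex ex i.
  by rewrite (transition_ee_dz _ eE ex aX ax) (transition1 HE eE ex)
    mul1mx mulmx1 addr0.
rewrite (velocity_change aX bX ax bx).
under [RHS]eq_bigr do rewrite conn scaler_sumr.
rewrite exchange_big; apply: eq_bigr => k _ /=.
by rewrite mxE scaler_suml; apply: eq_bigr => j _; rewrite scalerA.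
Qed.

Variables (fs : X -> triv (totE D') r) (cs : X -> chart R X n).
Hypothesis fsP : forall x, trivs (totE D') (fs x) /\ tdom (fs x) (incl D' x).
Hypothesis csP : forall x, atlas X (cs x) /\ cdom (cs x) x.

(** The frame [fs x] and the chart [cs x] are chosen at each point, without any regularity in x.
    [gaugeQ_local] replaces them by fixed ones near a point, and only then can smoothness be
    seen. *)
Definition gaugeQ e x : 'M[C]_r :=
  invmx (M' e (fs x) (0, x)) *m variation e (fs x) x
  - \sum_j vel (cs x) x 0 j *: conn10 nabla (cs x) e j x.

Definition gauge : form0 E := Form0 gaugeQ (velocity T T' F u).

Lemma M'_unit e f x : trivs E e -> trivs (totE D') f -> frames_at e f x ->
  M' e f (0, x) \in unitmx.
Proof.
move=> eE fD /frames_dom' ed; exact: (tr_mx_unit HE HD' HD' HT' idPhi eE fD ed).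
Qed.

Lemma gaugeQ_local e f a x : trivs E e -> trivs (totE D') f ->
  frames_at e f x ->
  atlas X a -> cdom a x ->
  gaugeQ e x = invmx (M' e f (0, x)) *m variation e f x
    - \sum_j vel a x 0 j *: conn10 nabla a e j x.
Proof.
move=> eE fD efx aX ax; have [ex fx] := efx.
have [gD gx] := fsP x; have [bX bx] := csP x.
have egx : frames_at e (fs x) x by split.
rewrite /gaugeQ (velocity_connection eE ex aX bX ax bx).
apply: (congr1 (fun A => A - \sum_j vel a x 0 j *: conn10 nabla a e j x)).
rewrite (variation_change_f eE gD fD egx efx).
have gx' : tdom f (tr_map T' (0, x)) by rewrite tr_map0'.
have hM := tr_mx_change_f HD' (F :=
  fun y => y) (fun y (v : totE D' y) => v) gD fD
  (frames_dom' egx) gx'.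
rewrite tr_map0' in hM.
have hu := M'_unit eE fD efx.
rewrite -[LHS](mulKmx hu); congr (_ *m _).
by rewrite hM -mulmxA (mulKVmx (M'_unit eE gD egx)).
Qed.

(** The derivative of the transition matrix along xi occurs both in the variation and in the
    transformation law of xi^j Gamma_j, and cancels in the difference. *)
Lemma gaugeQ_change e e2 x : trivs E e -> trivs E e2 -> tdom e x -> tdom e2 x ->
  gaugeQ e2 x *m transition e e2 x = transition e e2 x *m gaugeQ e x.
Proof.
move=> eE e2E ex e2x; have [fD fx] := fsP x; have [aX ax] := csP x.
have efx : frames_at e (fs x) x by split.
have e2fx : frames_at e2 (fs x) x by split.
rewrite (gaugeQ_local eE fD efx aX ax) (gaugeQ_local e2E fD e2fx aX ax).
rewrite (variation_change_e eE e2E fD efx e2fx aX ax).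
have Mu := M'_unit eE fD efx; have M2u := M'_unit e2E fD e2fx.
have Mg := tr_mx_change_e HE HD' HT' idPhi e e2E fD (frames_dom' e2fx).
rewrite /= in Mg; set g := transition e e2 x in Mg *.
have gM : g *m invmx (M' e (fs x) (0, x)) = invmx (M' e2 (fs x) (0, x)).
  rewrite -[LHS](mulKmx M2u) -[RHS]mulmx1; congr (_ *m _).
  by rewrite mulmxA -Mg (mulmxV Mu).
rewrite mulmxBr mulmxA gM mulmxDr mulKmx// mulmxA mulmxBl -addrA; congr (_ + _).
rewrite mulmx_suml mulmx_sumr -!sumrN -big_split; apply: eq_bigr => j _ /=.
have [_ h] := nabla_connection.
have [+ _] := h (cs x) (cs x) e e2 aX aX eE e2E x ax ax ex e2x j.
rewrite jac_self// (bigD1 j)//= big1 => [|k kj]; last first.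
  by rewrite mxE eq_sym (negPf kj) scale0r.
rewrite addr0 mxE eqxx scale1r => hj.
by rewrite -scalemxAr /g hj scalerDr opprD addrCA subrr addr0 -scalemxAl.
Qed.

Section LocalExpression.
Variables (e : triv E r) (f : triv (totE D') r) (a : chart R X n) (x : X).
Hypotheses (eE : trivs E e) (fD : trivs (totE D') f) (aX : atlas X a).
Hypotheses (efx : frames_at e f x) (ax : cdom a x).

Let z0 := cmap a x.
Let mu z := M' e f (0, cinv a z).
Let dm z := cdir_mx (time_op n u) (hat a (M e f)) (row_mx 0 z).
Let dm' z := cdir_mx (time_op n u) (hat a (M' e f)) (row_mx 0 z).
Let v j z := vel a (cinv a z) 0 j.
Let G j z := conn10 nabla a e j (cinv a z).

Let x0 : cinv a z0 = x. Proof. by rewrite /z0 chartK. Qed.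

Let near_frames_chart : \forall z \near z0,
  [/\ frames_at e f (cinv a z), cdom a (cinv a z) & cmap a (cinv a z) = z].
Proof.
have h1 := chart_near X_charted aX ax (near_frames eE fD efx).
by apply: filterS2 h1 (cinvK_near X_charted aX ax) => z ? [].
Qed.

Let mu_smooth : smooth_mx_at mu z0.
Proof.
exact: (tr_mx_slice_smooth X_manifold HE HD' HD' HT' idF idPhi eE fD aX ax
  (frames_dom' efx)).
Qed.

Let mu_unit : mu z0 \in unitmx.
Proof. by rewrite /mu x0; exact: M'_unit. Qed.

Let dm_smooth : smooth_mx_at dm z0.
Proof.
move=> k l; apply: (smooth_at_slice (f :=
  fun p => cdir_mx (time_op n u) (hat a (M e f)) p k l)).
exact: (cdir_mx_smooth _ (M_hat_smooth eE fD efx aX ax)).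
Qed.

Let dm'_smooth : smooth_mx_at dm' z0.
Proof.
move=> k l; apply: (smooth_at_slice (f :=
  fun p => cdir_mx (time_op n u) (hat a (M' e f)) p k l)).
exact: (cdir_mx_smooth _ (M'_hat_smooth eE fD efx aX ax)).
Qed.

Let v_smooth j : smooth_at (v j) z0.
Proof.
exact: (velocity_smooth X_manifold HD HD' HT HT' F_holomorphic F_incl rho_gt0 u
  j aX ax).
Qed.

Let G_smooth j : smooth_mx_at (G j) z0.
Proof. by apply: (connection_smooth X_manifold HE nabla_connection eE j aX ax);
  have [] := efx. Qed.

Let dmu j z := cdir_mx (dz_op R j) mu z.

Let dmu_smooth j : smooth_mx_at (dmu j) z0.
Proof. exact: cdir_mx_smooth. Qed.

Let Q z := invmx (mu z) *m (dm' z - dm z + \sum_j v j z *: dmu j z)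
  - \sum_j v j z *: G j z.

Let gaugeQ_near : \forall z \near z0, gaugeQ e (cinv a z) = Q z.
Proof.
apply: filterS near_frames_chart => z [efz az zK].
rewrite (gaugeQ_local eE fD efz aX az) (variation_local eE fD efz aX az) zK.
have dmuE j : mpd a j (fun y =>
  M' e f (0, y)) (cinv a z) = dmu j z by rewrite mpdE zK.
by rewrite (eq_bigr _ (fun j _ =>
  congr1 (GRing.scale (vel a (cinv a z) 0 j)) (dmuE j))).
Qed.

Let Q_smooth : smooth_mx_at Q z0.
Proof.
apply: smooth_mxB; last by apply: smooth_mx_sum => j; exact: smooth_mxZ.
apply: smooth_mxM; first exact: smooth_mx_inv.
apply: smooth_mxD; first exact: smooth_mxB.
by apply: smooth_mx_sum => j; exact: smooth_mxZ.
Qed.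

Lemma gaugeQ_smooth : smooth_mx_at (fun z => gaugeQ e (cinv a z)) z0.
Proof.
apply: smooth_mx_ext Q_smooth; apply: filterS gaugeQ_near => z h; exact: esym h.
Qed.

Variable i : 'I_n.
Local Notation db := (cdir_mx (dzbar_op R i)).

Let dbar_mu : \forall z \near z0, db mu z = 0.
Proof.
apply: filterS near_frames_chart => z [efz az zK].
have := dbar_tr_mx0 X_manifold HE HD' HD' HT' idF idPhi rho_gt0 w'_family
  w'_bundle
  eE fD i aX az (frames_dom' efz).
by rewrite mpdbarE zK.
Qed.

(** The equation dbar mu = 0 holds on a neighbourhood, so it may be differentiated by d_j, which
    commutes with dbar. *)
Let dbar_dmu j : db (dmu j) z0 = 0.
Proof.
rewrite /dmu (cdir_mxC _ _ mu_smooth).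
by rewrite (cdir_mx_near _ dbar_mu) cdir_mx_cst.
Qed.

Let dbar_mu0 : db mu z0 = 0.
Proof. exact: (nbhs_singleton dbar_mu). Qed.

(** Since dbar mu = 0, multiplication by mu commutes with dbar, and it removes the inverse of mu
    from the expression. *)
Lemma dbar_gaugeQ : mu z0 *m db (fun z => gaugeQ e (cinv a z)) z0 =
  db dm' z0 - db dm z0
  + \sum_j cdir (dzbar_op R i) (v j) z0 *: (dmu j z0 - mu z0 *m G j z0)
  - mu z0 *m \sum_j v j z0 *: db (G j) z0.
Proof.
have -> : db (fun z => gaugeQ e (cinv a z))
  z0 = db Q z0 by exact: cdir_mx_near gaugeQ_near.
have vs j := smooth_mxZ (v_smooth j) (dmu_smooth j).
have vG j := smooth_mxZ (v_smooth j) (G_smooth j).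
have -> : mu z0 *m db Q z0 = db (fun z => mu z *m Q z) z0.
  by rewrite (cdir_mxM _ mu_smooth Q_smooth) dbar_mu0 mul0mx add0r.
have -> : db (fun z => mu z *m Q z) z0 = db (fun z => dm' z - dm z +
    \sum_j v j z *: dmu j z - mu z *m \sum_j v j z *: G j z) z0.
  apply: cdir_mx_near; have := near_unitmx mu_unit mu_smooth.
  by apply: filterS => z uz; rewrite /Q mulmxBr mulKVmx.
have sG := smooth_mx_sum vG; have sv := smooth_mx_sum vs.
have sd := smooth_mxB dm'_smooth dm_smooth.
rewrite (cdir_mxB _ (smooth_mxD sd sv) (smooth_mxM mu_smooth sG)).
rewrite (cdir_mxD _ sd sv) (cdir_mxB _ dm'_smooth dm_smooth).
rewrite (cdir_mxM _ mu_smooth sG) dbar_mu0 mul0mx add0r.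
rewrite (cdir_mx_sum _ vs) (cdir_mx_sum _ vG).
have key (V : zmodType) (p a1 b1 c1 k1 : V) : a1 - b1 = c1 - k1 ->
    p + a1 - b1 = p + c1 - k1 by rewrite -!addrA => ->.
apply: key.
rewrite !mulmx_sumr -!sumrN -!big_split; apply: eq_bigr => j _ /=.
rewrite (cdir_mxZ _ (v_smooth j) (dmu_smooth j)) (cdir_mxZ _ (v_smooth j)
  (G_smooth j)).
rewrite dbar_dmu scaler0 addr0 mulmxDr opprD scalerBr.
by rewrite -!scalemxAr addrA.
Qed.

Lemma first_order_bundle :
  f1Q (first_order u w') a e i x - f1Q (first_order u w) a e i x =
  mpdbar a i (gaugeQ e) x
  - \sum_j vel a x 0 j *: curvature nabla a e j i x.
Proof.
have [ex fx] := efx.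
have F' := first_order_frame X_manifold HE HD' HD' HT' idF idPhi rho_gt0 u
  nabla_connection w'_family w'_bundle eE fD i aX ax (frames_dom' efx).
have F0 := first_order_frame X_manifold HE HD HD' HT F_holomorphic Phi_iso
  rho_gt0 u
  nabla_connection w_family w_bundle eE fD i aX ax (frames_dom efx).
have Mnear : \forall y \near x, M e f (0, y) = M' e f (0, y).
  by apply: all_near => y; exact: tr_mx0.
have dmE j : mpd a j (fun y => M e f (0, y)) x = dmu j z0.
  rewrite mpdE; apply: cdir_mx_near; apply: all_near => z; exact: tr_mx0.
have dm'E j : mpd a j (fun y => M' e f (0, y)) x = dmu j z0 by rewrite mpdE.
have mux : M' e f (0, x) = mu z0 by rewrite /mu x0.
have Gx j : conn10 nabla a e j x = G j z0 by rewrite /G x0.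
rewrite mux in F'; rewrite tr_mx0 mux in F0.
(* The (0,1)-part of the connection vanishes on a neighbourhood, hence so does its derivative by
   d_j; of the curvature only - dbar_i Gamma_j is left. *)
have curvE j : curvature nabla a e j i x = - db (G j) z0.
  rewrite /curvature (nabla01 _ aX eE ax ex) mulmx0 mul0mx subr0 addr0.
  rewrite (_ : mpd a j (conn01 nabla a e i) x = 0) ?sub0r ?mpdbarE//.
  rewrite mpdE; apply: etrans (cdir_mx_cst (dz_op R j) (0 : 'M[C]_r) z0).
  apply: cdir_mx_near; apply: filterS near_frames_chart => z [[ez _] az _].
  exact: nabla01.
(* Both sides are compared after multiplication by the invertible mu. The factors of d_j mu - mu
   Gamma_j agree by phi'_1 - phi_1 = dbar xi, and the remaining terms by the formula for the
   curvature. *)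
apply: (can_inj (mulKmx mu_unit)); rewrite mulmxBr F' F0 mulmxBr.
rewrite mpdbarE -/z0 dbar_gaugeQ.
have key (V : zmodType) (b' b s' s s0 c k : V) : s0 = s' - s -> k = - c ->
    b' + s' - (b + s) = b' - b + s0 - c - k.
  by move=> -> ->; rewrite opprK subrK opprD addrACA.
apply: key.
  rewrite -sumrB; apply: eq_bigr => j _; rewrite dm'E dmE Gx -scalerBl.
  apply: (congr1 (fun c : C => c *: (dmu j z0 - mu z0 *m G j z0))).
  rewrite (first_order_structure X_manifold HD HD' HT HT' F_holomorphic F_proj
    F_incl
    rho_gt0 u w_family w'_family w_structure w'_structure i j aX ax).
  by rewrite /pdbar dzbarE.
rewrite -mulmxN -sumrN; apply: (congr1 (mulmx (mu z0))).
by apply: eq_bigr => j _; rewrite curvE scalerN /v x0.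
Qed.

End LocalExpression.

Lemma gauge_form0 : is_form0 gauge.
Proof.
split=> [e eE k l|a aX j|e e2 eE e2E x ex e2x|a b aX bX x ax bx] /=.
- apply: smooth_fun_at_regular => x ex a aX ax; have [fD fx] := fsP x.
  exact: (gaugeQ_smooth eE fD aX (conj ex fx) ax k l).
- apply: smooth_fun_at_regular => x ax b bX bx.
  (* [velocity_smooth] reads the components of the field in the chart they belong to. The components
     for the chart a, when read in b, are therefore first expressed by those for b. *)
  apply: (smooth_at_ext (f := fun z =>
    \sum_l vel b (cinv b z) 0 l * jac b (cmap a) (cinv b z) l j)).
    apply: (chart_near X_charted bX bx (P := fun y =>
      \sum_l vel b y 0 l * jac b (cmap a) y l j = vel a y 0 j)).
    apply: filterS2 (near_cdom X_charted aX ax) (near_cdom X_charted bX bx) =>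
      y ay by_.
    by rewrite (velocity_change bX aX by_ ay) [RHS]mxE.
  apply: smooth_at_sum => l; apply: smooth_atM.
    exact: (velocity_smooth X_manifold HD HD' HT HT' F_holomorphic F_incl
      rho_gt0 u l bX bx).
  apply: (smooth_at_ext (f :=
    cdir (dz_op R l) (fun z => cmap a (cinv b z) 0 j))).
    have := cinvK_near X_charted bX bx; apply: filterS => z [bz zK].
    by rewrite mxE /pd zK dzE.
  apply: cdir_smooth; exact: (cmap_smooth_fun_at j X_manifold aX ax bX bx).
- exact: gaugeQ_change.
- exact: velocity_change.
Qed.

Lemma first_order_gauge :
  form01_eq (form01_sub (first_order u w') (first_order u w))
            (dbar_atiyah nabla gauge).
Proof.
split=> [a e aX eE i x ax ex|a aX x ax] /=.
  have [fD fx] := fsP x.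
  exact: (first_order_bundle eE fD aX (conj ex fx) ax i).
apply/matrixP => i k; rewrite [LHS]mxE [X in _ + X]mxE [RHS]mxE.
exact: (first_order_structure X_manifold HD HD' HT HT' F_holomorphic F_proj
  F_incl
  rho_gt0 u w_family w'_family w_structure w'_structure).
Qed.

End Gauge.

Theorem corollary4p3 (R : realType) (n r d : nat)
  (X : atlased R n) (E : vbundle R X r)
  (X_complex : complex_manifold X) (X_compact : compact [set: X])
  (E_holomorphic : holomorphic_vbundle E)
  (h : forall x, E x -> E x -> Cplx R) (h_metric : hermitian_metric h)
  (nabla : connection E) (nabla_chern : is_chern h nabla)
  (rho : R) (rho_gt0 : 0 < rho)
  (D D' : deformation d E)
  (D_family : is_deformation rho D) (D'_family : is_deformation rho D')
  (DD'_iso : isomorphic D D')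
  (w w' : 'rV[Cplx R]_d -> form01 E)
  (w_D : represented_by rho nabla D w) (w'_D' : represented_by rho nabla D' w')
  (u : 'rV[Cplx R]_d) :
  exists2 eta : form0 E, is_form0 eta &
    form01_eq (form01_sub (first_order u w') (first_order u w))
              (dbar_atiyah nabla eta).
Proof.
have [F [G [Phi [[F_hol _ _ _] F_proj Phi_iso F_incl Phi_incl]]]] := DD'_iso.
have [w_family [T T_triv w_rep]] := w_D.
have [w'_family [T' T'_triv w'_rep]] := w'_D'.
have [nabla_conn nabla_metric] := nabla_chern.
have HED' : holomorphic_vbundle (totE D') by have [] := D'_family.
(* A frame of the second total bundle and a chart of X are chosen at every point, as neither need
   exist globally. *)
have [|fs fsP] := @choice X (triv (totE D') r)
    (fun x f => trivs (totE D') f /\ tdom f (incl D' x)).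
  move=> x; have [_ _ ex _] := HED'.
  by have [f fD fx] := ex (incl D' x); exists f.
have [|cs csP] := @choice X (chart R X n) (fun x a => atlas X a /\ cdom a x).
  move=> x; have [_ _ _ ex _] := X_complex.
  by have [a aX ax] := ex x; exists a.
have nabla01 a e i x : atlas X a -> trivs E e -> cdom a x -> tdom e x ->
    conn01 nabla a e i x = 0.
  by move=> aX eE ax ex; have [] := nabla_metric a e aX eE x ax ex i.
have w_str t tD := (w_rep t tD).1; have w_bun t tD := (w_rep t tD).2.
have w'_str t tD := (w'_rep t tD).1; have w'_bun t tD := (w'_rep t tD).2.
exists (gauge T T' Phi nabla u fs cs).
  exact: (gauge_form0 X_complex E_holomorphic D_family D'_family T_triv T'_triv
    F_hol Phi_iso F_proj F_incl Phi_incl rho_gt0 u nabla_conn w'_family w'_bun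
      fsP csP).
exact: (first_order_gauge X_complex E_holomorphic D_family D'_family T_triv
  T'_triv
  F_hol Phi_iso F_proj F_incl Phi_incl rho_gt0 u nabla_conn nabla01
  w_family w'_family w_str w'_str w_bun w'_bun fsP csP).
Qed.
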